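(* Let $X$ be a germ at $0\in\mathbb{C}^2$ of holomorphic vector field, $X\not\equiv 0$. If the centralizer $C(X)$ has infinite dimension as a complex vector space, $d(X)=\dim_{\mathbb{C}}C(X)=\infty$, then $X$ has a non-constant holomorphic first integral, i.e. $\mathcal{I}(X)\neq\mathbb{C}$.
   Context: $\mathcal{O}_2$ is the ring of germs at $0\in\mathbb{C}^2$ of holomorphic functions and $\mathcal{X}_2$ the $\mathcal{O}_2$-module of germs at $0\in\mathbb{C}^2$ of holomorphic vector fields (a germ may or may not vanish at $0$). For $X\in\mathcal{X}_2$, $C(X)=\{Y\in\mathcal{X}_2\mid [X,Y]=0\}$, where $[\cdot,\cdot]$ is the Lie bracket, and $d(X)=\dim_{\mathbb{C}}C(X)$. $\mathcal{I}(X)=\{f\in\mathcal{O}_2\mid X(f)=0\}$ is the ring of holomorphic first integrals of $X$; it contains the constants $\mathbb{C}$. *)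

(* Defs.v *)
From HB Require Import structures.
From mathcomp Require Import all_boot all_order all_algebra.
From mathcomp Require Import all_classical all_reals all_analysis.
From mathcomp Require Import complex.

Set Implicit Arguments.
Unset Strict Implicit.
Unset Printing Implicit Defensive.

Import Order.TTheory GRing.Theory Num.Theory.
Import numFieldNormedType.Exports.

Local Open Scope classical_set_scope.
Local Open Scope ring_scope.

(* The complex numbers and C^2. The copy [^o] of R[i] is the one that
   MathComp-Analysis equips with the norm topology and with the structure of a
   normed module over R[i]. *)
Notation CC R := (complex R)^o.
Notation CC2 R := (CC R * CC R)%type.

(* A germ at 0 is given by a representative, a total function on C^2 of which
   only the values near 0 matter; equality of germs is [eq_germ]. *)
Definition eq_germ (R : realType) (V : Type) (f g : CC2 R -> V) : Prop :=
  \forall p \near (0 : CC2 R), f p = g p.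

(* [differentiable] is Frechet differentiability over the scalars R[i], hence
   complex differentiability. *)
Definition holomorphic_germ (R : realType) (V : normedModType R[i])
    (f : CC2 R -> V) : Prop :=
  \forall p \near (0 : CC2 R), differentiable f p.

(* A vector field a d/dx + b d/dy is identified with the map (a, b). *)
Definition vector_field_germ (R : realType) (X : CC2 R -> CC2 R) : Prop :=
  holomorphic_germ X.

(* (a d/dx + b d/dy) f is the derivative of f in the direction (a, b). *)
Definition lie_derivative (R : realType) (V : normedModType R[i])
    (X : CC2 R -> CC2 R) (f : CC2 R -> V) : CC2 R -> V :=
  fun p => 'D_(X p) f p.

(* The j-th component of [X, Y] is X(Y_j) - Y(X_j). *)
Definition lie_bracket (R : realType) (X Y : CC2 R -> CC2 R) :
    CC2 R -> CC2 R :=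
  fun p => lie_derivative X Y p - lie_derivative Y X p.

Definition centralizer (R : realType) (X : CC2 R -> CC2 R) :
    set (CC2 R -> CC2 R) :=
  [set Y | vector_field_germ Y /\ eq_germ (lie_bracket X Y) (fun=> 0)].

Definition first_integrals (R : realType) (X : CC2 R -> CC2 R) :
    set (CC2 R -> CC R) :=
  [set f | holomorphic_germ f /\ eq_germ (lie_derivative X f) (fun=> 0)].

Definition constant_germs (R : realType) : set (CC2 R -> CC R) :=
  [set f | exists c : CC R, eq_germ f (fun=> c)].

(* For a set S of representatives of the germs of a complex vector space:
   the space is spanned by finitely many of its elements. *)
Definition finite_dim_germs (R : realType) (V : normedModType R[i])
    (S : set (CC2 R -> V)) : Prop :=
  exists (n : nat) (B : 'I_n -> CC2 R -> V),
    (forall i, S (B i)) /\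
    forall Y, S Y -> exists c : 'I_n -> R[i],
      eq_germ Y (fun p => \sum_(i < n) c i *: B i p).

(* Main.v *)
(** Let [a], [b] be the components of [X] and let [Y] in [C(X)] be independent
    of [X], so that [g := a Y_2 - b Y_1] is not zero. Cramer's rule gives
    [g Z = u X + v Y] for every [Z] in [C(X)], and [g], [u], [v] are wedges of
    fields commuting with [X]: [X] multiplies each of them by the divergence of
    [X], hence [u / g] and [v / g] are meromorphic first integrals.

    For formal series, the numerators [h] of first integrals [h / g] span a
    finite dimensional space modulo [g]. By induction on the irreducible factors
    of [g] it suffices to work modulo an irreducible [v], which is then
    [X]-invariant; a Weierstrass degree count gives linear relations with
    coefficients in [K[[x]]] modulo [v], and a Wronskian argument makes their
    coefficients constant.

    If [C(X)] has infinite dimension, then modulo the span of [X] and [Y] there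
    are arbitrarily many independent [Z], and some nontrivial combination of
    them has [u] and [v] both divisible by [g]. The quotients are holomorphic
    first integrals, and they are not both constant since the combination is
    not in the span of [X] and [Y]. If all of [C(X)] is collinear with [X], the
    same argument applies with [g] a nonzero component of [X].

    Passing between germs and convergent series uses Cauchy's theorem, proved
    for functions that are only known to be complex differentiable. *)

Require Import Defs.
From HB Require Import structures.
From mathcomp Require Import all_boot all_order all_algebra.
From mathcomp Require Import all_classical all_reals all_analysis.
From mathcomp Require Import complex.
From mathcomp Require Import ring lra zify.

Set Implicit Arguments.
Unset Strict Implicit.
Unset Printing Implicit Defensive.

Import Order.TTheory GRing.Theory Num.Theory.
Import numFieldNormedType.Exports.

Local Open Scope classical_set_scope.
Local Open Scope ring_scope.

(** * Formal power series *)

(** Fixing the denominator is what makes the count finite: without a non-constant holomorphic first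
    integral there may still be infinitely many independent meromorphic ones (the powers of y/x for
    the radial field), but all of C(X) is expressed over one g. Invariance of v is forced: if v
    divides g but not the numerator of some first integral over g, then in characteristic zero v
    divides X(v). The finiteness result is purely formal; convergence matters when a quotient by g
    has to become a germ again, for only there can the absence of holomorphic first integrals be
    invoked. A series in x, y is a series in x with coefficients in K[[y]]: [F i j] is the
    coefficient of x^i y^j and [F 0] is F(0, y). On the analytic side only the existence of a
    derivative at each point near 0 is given, hence Goursat's argument. Contours are squares
    parallel to the axes, so that sides are real segments and subdivision stays among squares. The
    value 2 pi i is never computed: the integral of 1/z only has to be nonzero. *)

Definition fps (T : Type) := nat -> T.

(** Course-of-values recursion: after n iterations the values below n no longer depend on the number
    of iterations, and [x0] is only a seed. It produces inverses of units and Weierstrass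
    quotients. *)
Lemma strong_recursion (T : Type) (step : nat -> (nat -> T) -> T) (x0 : T) :
  (forall n q q', (forall k, (k < n)%N -> q k = q' k) -> step n q = step n q') ->
  exists q : fps T, forall n, q n = step n q.
Proof.
move=> stepE.
pose it := fix it n := if n is m.+1 then (fun k => step k (it m)) else (fun=> x0).
have itE n m k : (k < n)%N -> (k < m)%N -> it n k = it m k.
  elim/ltn_ind: k n m => k IH [//|n] [//|m] kn km /=.
  by apply: stepE => l lk; apply: IH => //; apply: leq_trans lk _.
exists (fun n => it n.+1 n) => n /=.
by apply: stepE => k kn; exact: (itE n k.+1 k).
Qed.

Section FormalPowerSeries.
Context {T : comNzRingType}.
Implicit Types (f g h : fps T).

HB.instance Definition _ := GRing.Zmodule.copy (fps T) (nat -> T).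

Definition fps_mul f g : fps T := fun n => \sum_(i < n.+1) f i * g (n - i)%N.
Definition fps_one : fps T := fun n => (n == 0)%:R.

(** Coefficient n of a product depends only on the truncations of the factors, so the ring laws and
    the Leibniz rule are inherited from polynomials. *)
Let trunc N f : {poly T} := \poly_(i < N) f i.

Let coef_trunc_mul N f g n : (n < N)%N ->
  (trunc N f * trunc N g)`_n = fps_mul f g n.
Proof.
move=> nN; rewrite coefM; apply: eq_bigr => i _.
rewrite !coef_poly (leq_ltn_trans (leq_subr _ _) nN).
by rewrite (leq_ltn_trans _ nN)// -ltnS.
Qed.

Let coefM_lt (p p' q q' : {poly T}) N : (forall k, (k < N)%N -> p`_k = p'`_k) ->
  (forall k, (k < N)%N -> q`_k = q'`_k) ->
  forall k, (k < N)%N -> (p * q)`_k = (p' * q')`_k.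
Proof.
move=> pp' qq' k kN; rewrite !coefM; apply: eq_bigr => i _.
rewrite pp' ?qq' ?(leq_ltn_trans (leq_subr _ _) kN)//.
by rewrite (leq_ltn_trans _ kN)// -ltnS.
Qed.

Let coef_trunc N f k : (k < N)%N -> (trunc N f)`_k = f k.
Proof. by move=> kN; rewrite coef_poly kN. Qed.

Let fps_mulA : associative fps_mul.
Proof.
move=> f g h; apply/funext => n; rewrite -!(@coef_trunc_mul n.+1)//.
have E k : (k < n.+1)%N ->
    (trunc n.+1 f * (trunc n.+1 g * trunc n.+1 h))`_k =
    (trunc n.+1 f * trunc n.+1 (fps_mul g h))`_k.
  by apply: coefM_lt => // l ln; rewrite coef_trunc// coef_trunc_mul.
rewrite -E// mulrA; apply: (@coefM_lt _ _ _ _ n.+1) => // l ln.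
by rewrite coef_trunc// coef_trunc_mul.
Qed.

Let fps_mulC : commutative fps_mul.
Proof.
by move=> f g; apply/funext => n; rewrite -!(@coef_trunc_mul n.+1)// mulrC.
Qed.

Let fps_mul1 : left_id fps_one fps_mul.
Proof.
move=> f; apply/funext => n; rewrite /fps_mul big_ord_recl /= subn0 mul1r.
by rewrite big1 ?addr0// => i _; rewrite mul0r.
Qed.

Let fps_mulDl : left_distributive fps_mul +%R.
Proof.
move=> f g h; apply/funext => n.
transitivity (fps_mul f h n + fps_mul g h n) => //.
by rewrite -big_split; apply: eq_bigr => i _; exact: mulrDl.
Qed.

Let fps_one_neq0 : fps_one != 0.
Proof. by apply/eqP => /(congr1 (fun f => f 0%N)) /eqP; rewrite oner_eq0. Qed.

HB.instance Definition _ :=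
  GRing.Zmodule_isComNzRing.Build (fps T) fps_mulA fps_mulC fps_mul1 fps_mulDl
    fps_one_neq0.

Lemma fps_mulE f g n : (f * g) n = \sum_(i < n.+1) f i * g (n - i)%N.
Proof. by []. Qed.
Lemma fps_addE f g n : (f + g) n = f n + g n. Proof. by []. Qed.
Lemma fps_oppE f n : (- f) n = - f n. Proof. by []. Qed.
Lemma fps_oneE n : (1 : fps T) n = (n == 0)%:R. Proof. by []. Qed.
Lemma fps_sumE (I : Type) (r : seq I) (P : pred I) (F : I -> fps T) n :
  (\sum_(i <- r | P i) F i) n = \sum_(i <- r | P i) F i n.
Proof. by elim/big_rec2: _ => // i x y _ <-. Qed.

Lemma fps_neq0 f : f != 0 -> exists n, f n != 0.
Proof.
by move=> f0; apply: contrapT => H; move/eqP: f0; apply; apply/funext => n;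
  apply/eqP/negPn/negP => fn; apply: H; exists n.
Qed.

Definition fpsD f : fps T := fun n => f n.+1 *+ n.+1.

Lemma fpsD_mul f g : fpsD (f * g) = fpsD f * g + f * fpsD g.
Proof.
apply/funext => n; pose p := trunc n.+2 f; pose q := trunc n.+2 g.
rewrite /fpsD -[(f * g) _](@coef_trunc_mul n.+2)// -coef_deriv derivM coefD.
rewrite fps_addE -![(_ * _ : fps T) n](@coef_trunc_mul n.+1)//.
by congr (_ + _); apply: (@coefM_lt _ _ _ _ n.+1) => // k kn;
  rewrite ?coef_deriv !coef_trunc// ltnW.
Qed.

Lemma fpsD_add f g : fpsD (f + g) = fpsD f + fpsD g.
Proof. by apply/funext => n; rewrite /fpsD fps_addE mulrnDl. Qed.

Definition fpsX : fps T := fun n => (n == 1)%:R.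
Definition fpsC (c : T) : fps T := fun n => c *+ (n == 0).
Definition fps_shift f : fps T := fun n => f n.+1.

Lemma fps_mul0E f g : (f * g) 0%N = f 0%N * g 0%N.
Proof. by rewrite fps_mulE big_ord_recl big_ord0 addr0. Qed.

Lemma fpsC_mulE c f n : (fpsC c * f) n = c * f n.
Proof.
rewrite fps_mulE big_ord_recl /= subn0 /fpsC mulr1n big1 ?addr0// => i _.
by rewrite mulr0n mul0r.
Qed.

Lemma fpsX_mulE f n : (fpsX * f) n = if n is m.+1 then f m else 0.
Proof.
case: n => [|n]; first by rewrite fps_mul0E mul0r.
rewrite fps_mulE 2!big_ord_recl /= mul0r add0r mul1r subSS subn0.
by rewrite big1 ?addr0// => i _; rewrite /fpsX mul0r.
Qed.

Lemma shiftK f : f 0%N = 0 -> f = fpsX * fps_shift f.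
Proof. by move=> f0; apply/funext => -[|n]; rewrite fpsX_mulE. Qed.

Lemma fpsX_mulI f g : fpsX * f = fpsX * g -> f = g.
Proof.
move=> fg; apply/funext => n.
by move: (congr1 (fun h : fps T => h n.+1) fg); rewrite !fpsX_mulE.
Qed.

Let fpsC_opp x y : fpsC (x - y) = fpsC x - fpsC y.
Proof. by apply/funext => n; rewrite fps_addE /fpsC mulrnBl. Qed.
Let fpsC_one : fpsC 1 = 1. Proof. by []. Qed.
Let fpsC_mul : {morph fpsC : x y / x * y}.
Proof. by move=> x y; apply/funext => n; rewrite fpsC_mulE /fpsC mulrnAr. Qed.

HB.instance Definition _ := GRing.isZmodMorphism.Build T (fps T) fpsC fpsC_opp.
HB.instance Definition _ :=
  GRing.isMonoidMorphism.Build T (fps T) fpsC (conj fpsC_one fpsC_mul).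

Lemma fps_inv f u : f 0%N * u = 1 -> exists g, f * g = 1.
Proof.
move=> fu; have [g gE] := @strong_recursion T
  (fun n q => u * ((n == 0)%:R - \sum_(i < n) q i * f (n - i)%N)) 0
  (ltac:(by move=> n q q' qq'; congr (_ * (_ - _)); apply: eq_bigr => i _; rewrite qq')).
exists g; apply/funext => n; rewrite mulrC fps_mulE big_ord_recr /= subnn.
by rewrite mulrC gE mulrA fu mul1r addrC subrK.
Qed.

(** The order of vanishing. The default 0 at the zero series keeps [val_lt] valid without a
    nonvanishing hypothesis. *)
Definition fps_val f : nat :=
  if pselect (exists n, f n != 0) is left fn then ex_minn fn else 0.

Lemma val_neq0 f : f != 0 -> f (fps_val f) != 0.
Proof.
by move=> /fps_neq0 f0; rewrite /fps_val; case: pselect => // H; case: ex_minnP.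
Qed.

Lemma val_lt f k : (k < fps_val f)%N -> f k = 0.
Proof.
rewrite /fps_val; case: pselect => // H; case: ex_minnP => m _ m_min km.
by apply/eqP/negPn/negP => /m_min; rewrite leqNgt km.
Qed.

Lemma val_le f n : f n != 0 -> (fps_val f <= n)%N.
Proof. by move=> fn; rewrite leqNgt; apply/negP => /val_lt/eqP; apply/negP. Qed.

Lemma val_eq f n : f n != 0 -> (forall k, (k < n)%N -> f k = 0) -> fps_val f = n.
Proof.
move=> fn fk; apply/eqP; rewrite eqn_leq val_le//= leqNgt; apply/negP.
move=> /fk/eqP; apply/negP/val_neq0.
by apply: contraNneq fn => ->.
Qed.

(** Here [m] and [n] are lower bounds for the orders, not the orders themselves; the lemma is also
    applied where [f m] or [g n] may vanish. *)
Lemma fps_mul_lead f g m n : (forall k, (k < m)%N -> f k = 0) ->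
  (forall k, (k < n)%N -> g k = 0) ->
  (f * g) (m + n)%N = f m * g n /\ forall k, (k < m + n)%N -> (f * g) k = 0.
Proof.
move=> fm gn; split=> [|k kmn].
  have mmn : (m < (m + n).+1)%N by rewrite ltnS leq_addr.
  rewrite fps_mulE (bigD1 (Ordinal mmn))//= addKn big1 ?addr0// => i /eqP im.
  have [im'|] := ltnP i m; first by rewrite fm// mul0r.
  rewrite leq_eqVlt => /orP[/eqP mi|mi]; first by case: im; apply: val_inj.
  rewrite gn ?mulr0// ltn_subLR; last by rewrite -ltnS.
  by rewrite ltn_add2r.
rewrite fps_mulE big1// => i _; have [im|mi] := ltnP i m.
  by rewrite fm// mul0r.
rewrite gn ?mulr0// ltn_subLR; last by rewrite -ltnS.
by rewrite (leq_trans kmn)// leq_add2r.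
Qed.

End FormalPowerSeries.

Definition no_zero_divisor (T : comNzRingType) :=
  forall a b : T, a * b = 0 -> a = 0 \/ b = 0.

Section Domain.
Context {T : comNzRingType} (domT : no_zero_divisor T).
Implicit Types (f g h : fps T).

Lemma fps_mul_val f g : f != 0 -> g != 0 ->
  fps_val (f * g) = (fps_val f + fps_val g)%N /\
  (f * g) (fps_val f + fps_val g)%N = f (fps_val f) * g (fps_val g).
Proof.
move=> f0 g0; have [fgE fg0] := fps_mul_lead (@val_lt _ f) (@val_lt _ g).
split=> //; apply: val_eq => //; rewrite fgE; apply/eqP => /domT.
by case=> /eqP; apply/negP/val_neq0.
Qed.

Lemma fps_no_zero_divisor : no_zero_divisor (fps T).
Proof.
move=> f g fg; apply: contrapT => /not_orP[/eqP f0 /eqP g0].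
have [_ lfg] := fps_mul_val f0 g0; rewrite fg in lfg.
by case: (domT (esym lfg)) => /eqP; apply/negP/val_neq0.
Qed.

End Domain.

Definition fps_map (S T : Type) (phi : S -> T) (f : fps S) : fps T :=
  fun n => phi (f n).

Lemma fps_map_leibniz (T : comNzRingType) (delta : T -> T) :
  (forall a b, delta (a + b) = delta a + delta b) ->
  (forall a b, delta (a * b) = delta a * b + a * delta b) ->
  forall f g : fps T, fps_map delta (f * g) =
    fps_map delta f * g + f * fps_map delta g.
Proof.
move=> dD dM f g; apply/funext => n; rewrite fps_addE !fps_mulE -big_split /=.
have d0 : delta 0 = 0 by apply: (addrI (delta 0)); rewrite -dD !addr0.
rewrite /fps_map fps_mulE (big_morph delta dD d0).
by apply: eq_bigr => i _; rewrite dM.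
Qed.

Lemma fpsXn_mulE (T : comNzRingType) n (f : fps T) k :
  (fpsX ^+ n * f) k = if (k < n)%N then 0 else f (k - n)%N.
Proof.
elim: n k => [|n IH] k; first by rewrite expr0 mul1r subn0.
by rewrite exprS -mulrA fpsX_mulE; case: k => // k; rewrite IH ltnS subSS.
Qed.

Lemma fpsXn_val (T : comNzRingType) (f : fps T) :
  f = fpsX ^+ fps_val f * (fun n => f (n + fps_val f)%N).
Proof.
apply/funext => k; rewrite fpsXn_mulE; case: ltnP => [/val_lt//|vk].
by rewrite subnK.
Qed.

Definition dvd (T : comNzRingType) (a b : T) := exists c, b = c * a.

Lemma dvd_refl (T : comNzRingType) (a : T) : dvd a a.
Proof. by exists 1; rewrite mul1r. Qed.

Lemma dvdD (T : comNzRingType) (a b c : T) : dvd a b -> dvd a c -> dvd a (b + c).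
Proof. by move=> [d ->] [e ->]; exists (d + e); rewrite mulrDl. Qed.

Lemma dvdMl (T : comNzRingType) (a b c : T) : dvd a b -> dvd a (c * b).
Proof. by move=> [d ->]; exists (c * d); rewrite mulrA. Qed.

Lemma dvdB (T : comNzRingType) (a b c : T) : dvd a b -> dvd a c -> dvd a (b - c).
Proof. by move=> [d ->] [e ->]; exists (d - e); rewrite mulrBl. Qed.

Lemma dvd_sum (T : comNzRingType) (a : T) (I : Type) (r : seq I) (P : pred I)
    (F : I -> T) :
  (forall i, P i -> dvd a (F i)) -> dvd a (\sum_(i <- r | P i) F i).
Proof.
move=> aF; elim/big_ind: _ => //; last by move=> x y; exact: dvdD.
by exists 0; rewrite mul0r.
Qed.

Lemma mulfI_nzd (T : comNzRingType) (domT : no_zero_divisor T) (a b c : T) :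
  a != 0 -> a * b = a * c -> b = c.
Proof.
move=> a0 abc; apply/eqP; rewrite -subr_eq0; apply/eqP.
have /domT[/eqP|//] : a * (b - c) = 0 by rewrite mulrBr abc subrr.
by rewrite (negbTE a0).
Qed.

(** * Divisibility and irreducible factors in K[[x, y]] *)

Section TwoVariables.
Context {K : numFieldType}.
Local Notation A := (fps (fps K)).
Implicit Types (F G g h u v : A).

Let domK : no_zero_divisor K.
Proof. by move=> a b /eqP; rewrite mulf_eq0 => /orP[/eqP|/eqP]; [left|right]. Qed.

Lemma fps1_nzd : no_zero_divisor (fps K).
Proof. exact: fps_no_zero_divisor. Qed.

Lemma fps2_nzd : no_zero_divisor A.
Proof. exact: fps_no_zero_divisor fps1_nzd. Qed.

Let neq0M F G : F * G != 0 -> F != 0 /\ G != 0.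
Proof.
by move=> FG; split; apply: contraNneq FG => ->; rewrite ?mul0r ?mulr0.
Qed.

Let mul_neq0 F G : F != 0 -> G != 0 -> F * G != 0.
Proof.
by move=> F0 G0; apply/eqP => /fps2_nzd[/eqP|/eqP]; apply/negP.
Qed.

Lemma fps2_inv F : F 0%N 0%N != 0 -> exists G, F * G = 1.
Proof.
move=> F0; have [u Fu] := @fps_inv _ (F 0%N) _ (divff F0).
exact: fps_inv Fu.
Qed.

(** Not the total order: the sum of the two components of the lexicographic order (x-adic order,
    then y-adic order of the leading coefficient). On nonzero series it is additive and vanishes
    exactly at units, which is all that a measure for factorization needs. *)
Definition ord2 F : nat := fps_val F + fps_val (F (fps_val F)).

Lemma ord2M F G : F != 0 -> G != 0 -> ord2 (F * G) = (ord2 F + ord2 G)%N.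
Proof.
move=> F0 G0; rewrite /ord2.
have [-> ->] := fps_mul_val fps1_nzd F0 G0.
have [-> _] := fps_mul_val domK (val_neq0 F0) (val_neq0 G0).
by rewrite addnACA.
Qed.

Lemma ord2_eq0 F : F != 0 -> ord2 F = 0%N -> F 0%N 0%N != 0.
Proof.
move=> F0 /eqP; rewrite addn_eq0 => /andP[/eqP v0 /eqP]; rewrite v0 => v00.
by have := val_neq0 (val_neq0 F0); rewrite v0 v00.
Qed.

Lemma ord2_neq0 F : (0 < ord2 F)%N -> F 0%N 0%N = 0.
Proof.
move=> F0; apply/eqP/negPn/negP => F00; move: F0.
suff vF : fps_val F = 0%N by rewrite /ord2 vF add0n lt0n => /negP; apply; rewrite
  -leqn0 val_le.
apply/eqP; rewrite -leqn0 val_le//.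
by apply: contraNneq F00 => ->.
Qed.

(** Division in one variable with remainder of degree below n, the order of [b0]: write [b0] as y^n
    times a unit, drop the first n coefficients of [b] and multiply by the inverse of that unit. *)
Let divB (b0 : fps K) : b0 != 0 -> exists d : fps K -> fps K,
  forall b j, (fps_val b0 <= j)%N -> (b - d b * b0) j = 0.
Proof.
move=> b00; pose n := fps_val b0; pose u : fps K := fun j => b0 (j + n)%N.
have [w uw] : exists w, u * w = 1.
  by apply: (@fps_inv _ _ (u 0%N)^-1); rewrite divff// /u add0n val_neq0.
exists (fun b => w * (fun j => b (j + n)%N)) => b j nj.
rewrite {1}(fpsXn_val b0) -/n -/u fps_addE fps_oppE.
rewrite (_ : _ * _ = fpsX ^+ n * (u * w * (fun j => b (j + n)%N))); last by ring.
by rewrite uw mul1r fpsXn_mulE ltnNge nj /= subnK// subrr.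
Qed.

(** The quotient is found one power of x at a time: its coefficient of x^i is the one-variable
    quotient, by g(0, y), of what the earlier coefficients leave of [h i]. The remainder is then a
    polynomial in y over K[[x]]. *)
Lemma weierstrass_division g h : g 0%N != 0 -> exists q r : A,
  h = q * g + r /\ forall i j, (fps_val (g 0%N) <= j)%N -> r i j = 0.
Proof.
move=> /divB[d dE].
have [q qE] := @strong_recursion (fps K)
  (fun i q => d (h i - \sum_(k < i) q k * g (i - k)%N)) 0
  (ltac:(by move=> n q q' qq'; congr (d (_ - _)); apply: eq_bigr => i _; rewrite qq')).
exists q, (h - q * g); split=> [|i j nj]; first by ring.
rewrite fps_addE fps_oppE fps_mulE big_ord_recr /= subnn opprD addrA.
by rewrite qE dE.
Qed.

(* Weierstrass division by an element of minimal [y]-order plays the role of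
   Euclidean division. *)
Lemma saturated_ideal_principal (T : A -> Prop) g :
  (forall s t, T s -> T t -> T (s - t)) -> (forall s t, T t -> T (s * t)) ->
  (forall t, T (fpsX * t) -> T t) -> T g -> g 0%N != 0 ->
  exists2 d, T d & forall t, T t -> dvd d t.
Proof.
move=> TB TM TX Tg g0.
pose P n := `[< exists d, [/\ T d, d 0%N != 0 & fps_val (d 0%N) = n] >].
have exP : exists n, P n by exists (fps_val (g 0%N)); apply/asboolP; exists g.
case: (ex_minnP exP) => n /asboolP[d [Td d0 vd]] n_min; exists d => // t Tt.
have [q [r [tE rE]]] := weierstrass_division t d0.
have Tr : T r.
  have -> : r = t - q * d by rewrite tE; ring.
  by apply: TB => //; exact: TM.
suff r0 : r = 0 by exists q; rewrite tE r0 addr0.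
(* By saturation a nonzero remainder can be divided by x until it no longer vanishes on x = 0. Its
   y-order is then below that of [d], against the choice of [d]. *)
apply: contrapT => /eqP; move: Tr rE.
have [m] := ubnP (fps_val r); elim: m r {tE} => // m IH r + Tr rE r0.
have [r00 vr|r00 _] := eqVneq (r 0%N) 0; last first.
  have /n_min : P (fps_val (r 0%N)) by apply/asboolP; exists r.
  rewrite leqNgt => /negP; apply; rewrite ltnNge; apply/negP => nv.
  by have := val_neq0 r00; rewrite rE ?eqxx// vd.
have rX := shiftK r00.
apply: (IH (fps_shift r)); rewrite ?ltnS.
- have [_ s0] := neq0M (etrans (esym (congr1 (fun z => z != 0) rX)) r0).
  rewrite -ltnS (leq_trans _ vr)// ltnS.
  move: (val_neq0 r0) => vr0; case E : (fps_val r) vr0 => [|k] vr0.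
    by move: vr0; rewrite r00 eqxx.
  by rewrite ltnS; apply: val_le.
- by apply: TX; rewrite -rX.
- by move=> i j ij; rewrite /fps_shift rE.
- by have [_] := neq0M (etrans (esym (congr1 (fun z => z != 0) rX)) r0).
Qed.

Definition irreducible v := [/\ v != 0, (0 < ord2 v)%N &
  forall a b, v = a * b -> ord2 a = 0%N \/ ord2 b = 0%N].

(** A divisor of least positive [ord2] cannot split any further. *)
Lemma irreducible_divisor g : g != 0 -> (0 < ord2 g)%N ->
  exists2 v, irreducible v & dvd v g.
Proof.
move=> g0 og.
pose P n := `[< exists d, [/\ dvd d g, (0 < ord2 d)%N & ord2 d = n] >].
have exP : exists n, P n.
  by exists (ord2 g); apply/asboolP; exists g; split => //; exact: dvd_refl.
case: (ex_minnP exP) => n /asboolP[v [[e gE] ov vn]] n_min.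
have [e0 v0] : e != 0 /\ v != 0 by apply: neq0M; rewrite -gE.
exists v; [split => // a b vE|by exists e].
have [a0 b0] : a != 0 /\ b != 0 by apply: neq0M; rewrite -vE.
have [/eqP|oa] := posnP (ord2 a); first by move=> /eqP; left.
right; have /n_min : P (ord2 a).
  by apply/asboolP; exists a; split => //; exists (e * b); rewrite gE vE; ring.
by rewrite -vn vE ord2M//; lia.
Qed.

Lemma unit_dvd F G : F != 0 -> ord2 F = 0%N -> dvd F G.
Proof.
move=> F0 /(ord2_eq0 F0)/fps2_inv[H FH]; exists (G * H).
by rewrite -mulrA [H * F]mulrC FH mulr1.
Qed.

Lemma ord2X : ord2 fpsX = 1%N.
Proof.
have vX : fps_val (fpsX : A) = 1%N.
  by apply: val_eq => [|[]//]; rewrite /fpsX oner_eq0.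
rewrite /ord2 vX (_ : fps_val _ = 0%N)//; apply: val_eq => //.
by rewrite /fpsX mulr1n fps_oneE oner_eq0.
Qed.

Lemma irreducible_x v : irreducible v -> v 0%N = 0 -> dvd v fpsX.
Proof.
move=> [v0 _ vI] /shiftK vX; have [|sv] := vI _ _ vX; first by rewrite ord2X.
have [_ s0] : (fpsX : A) != 0 /\ fps_shift v != 0 by apply: neq0M; rewrite -vX.
have [s sE] := fps2_inv (ord2_eq0 s0 sv).
by exists s; rewrite vX mulrCA [s * _]mulrC sE mulr1.
Qed.

(** Up to a unit, v is x, or else x does not divide v. In the second case the u with v | s u form an
    ideal saturated with respect to x, hence generated by some d. Since v lies in it, v = f d: if f
    is a unit, d is associate to v and v | t; if d is a unit, 1 lies in the ideal and v | s. *)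
Lemma irreducible_prime v s t : irreducible v -> dvd v (s * t) ->
  dvd v s \/ dvd v t.
Proof.
move=> vI [w stE]; have [v0 ov vab] := vI.
have [v00|v00] := eqVneq (v 0%N) 0.
  have [c cE] := irreducible_x vI v00.
  have : (s * t) 0%N = 0 by rewrite stE fps_mul0E v00 mulr0.
  rewrite fps_mul0E => /fps1_nzd[s0|t0]; [left|right].
    by rewrite (shiftK s0) cE; exists (fps_shift s * c); ring.
  by rewrite (shiftK t0) cE; exists (fps_shift t * c); ring.
have [||u||//|d [e vE] dmin] := @saturated_ideal_principal
    (fun u => dvd v (s * u)) v.
- by move=> a b va vb; rewrite mulrBr; exact: dvdB.
- by move=> a b vb; rewrite mulrCA; exact: dvdMl.
(* Saturation: x divides b v and not v, hence it divides b and cancels. *)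
- move=> [b bE]; have : (b * v) 0%N = 0.
    by rewrite -bE mulrCA fpsX_mulE.
  rewrite fps_mul0E => /fps1_nzd[/shiftK b0|/eqP]; last by rewrite (negbTE v00).
  exists (fps_shift b); apply: (@fpsX_mulI _ (s * u)).
  by rewrite mulrCA bE {1}b0 -mulrA.
- exact: dvdMl (dvd_refl v).
have [f fE] := dmin v (dvdMl s (dvd_refl v)).
have [f0 d0] : f != 0 /\ d != 0 by apply: neq0M; rewrite -fE.
have [of0|od] := vab _ _ fE.
  right; have [b bE] := unit_dvd (1 : A) f0 of0.
  have [|c ->] := dmin t; first by exists w.
  by exists (c * b); rewrite fE mulrA -[c * b * f]mulrA -bE mulr1.
left; have [b bE] := unit_dvd (1 : A) d0 od.
by exists (b * e); rewrite -mulrA -vE mulrCA -bE mulr1.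
Qed.

Lemma dvd_ord2 v F : F != 0 -> dvd v F -> (ord2 v <= ord2 F)%N.
Proof.
move=> F0 [c FE]; have [c0 v0] : c != 0 /\ v != 0 by apply: neq0M; rewrite -FE.
by rewrite FE ord2M// leq_addl.
Qed.

Lemma multiplicity v g : v != 0 -> g != 0 -> (0 < ord2 v)%N ->
  exists n w, g = v ^+ n * w /\ ~ dvd v w.
Proof.
move=> v0 g0 ov; have [m] := ubnP (ord2 g); elim: m g g0 => // m IH g g0 gm.
have [[w gE]|] := pselect (dvd v g); last by exists 0%N, g; rewrite expr0 mul1r.
have [w0 _] : w != 0 /\ v != 0 by apply: neq0M; rewrite -gE.
have [|n [u [wE vu]]] := IH w w0; first by move: gm; rewrite gE ord2M//; lia.
by exists n.+1, u; split => //; rewrite gE wE exprS; ring.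
Qed.

(** Dividing a vector field by a common factor of its components keeps its first integrals, so [v]
    may be assumed not to divide both components. *)
Lemma reduce_pair v a b : v != 0 -> (0 < ord2 v)%N -> a != 0 \/ b != 0 ->
  exists d a' b', [/\ d != 0, a = d * a', b = d * b' & ~ (dvd v a' /\ dvd v b')].
Proof.
move=> v0 ov; pose o F := if F == 0 then 0%N else ord2 F.
have [m] := ubnP (o a + o b); elim: m a b => // m IH a b abm ab0.
have [[[a1 aE] [b1 bE]]|] := pselect (dvd v a /\ dvd v b); last first.
  by exists 1, a, b; rewrite !mul1r; split => //; exact: oner_neq0.
have o1 c c1 : c = c1 * v -> (o c1 <= o c)%N /\ (c != 0 -> (o c1 < o c)%N).
  rewrite /o => cE; have [c10|c0] := eqVneq c1 0.
    by rewrite cE c10 mul0r eqxx.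
  by rewrite cE (negbTE (mul_neq0 c0 v0)) ord2M//; split=> *; lia.
have [oa oa'] := o1 _ _ aE; have [ob ob'] := o1 _ _ bE.
have [||d [a' [b' [d0 a1E b1E H]]]] := IH a1 b1.
- by case: ab0 => [/oa'|/ob']; move: abm oa ob; lia.
- case: ab0 => [a0|b0]; [left|right].
    by have [] : a1 != 0 /\ v != 0 by apply: neq0M; rewrite -aE.
  by have [] : b1 != 0 /\ v != 0 by apply: neq0M; rewrite -bE.
exists (d * v), a', b'; split => //; first exact: mul_neq0.
- by rewrite aE a1E; ring.
- by rewrite bE b1E; ring.
Qed.
End TwoVariables.

(** * Linear dependence over domains and over constants *)

Lemma widen_lift n (i : 'I_n) : widen_ord (leqnSn n) i = lift ord_max i.
Proof. by apply: val_inj; rewrite /= /bump leqNgt ltn_ord. Qed.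

(** Fraction-free Gaussian elimination: a nonzero entry of the last column serves as pivot, the
    other rows are cross-multiplied to clear that column, and the coefficient of the pivot row is
    chosen at the end. *)
Lemma underdetermined_system (T : comNzRingType) (domT : no_zero_divisor T) n
    (r : 'I_n.+1 -> 'I_n -> T) :
  exists2 s : 'I_n.+1 -> T, exists i, s i != 0 &
    forall j, \sum_i s i * r i j = 0.
Proof.
elim: n r => [|n IH] r.
  by exists (fun=> 1) => [|[]//]; exists ord0; rewrite oner_neq0.
have [[p rp]|r0] := pselect (exists i, r i ord_max != 0); last first.
  have [s [i si] sE] := IH (fun i j => r (widen_ord (leqnSn _) i) (widen_ord (leqnSn _) j)).
  exists (fun i => if unlift ord_max i is Some k then s k else 0).
    by exists (lift ord_max i); rewrite liftK.
  move=> j; rewrite big_ord_recr /= unlift_none mul0r addr0.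
  have [k jE|jm] := unliftP ord_max j; last first.
    rewrite big1// => l _; rewrite (_ : r _ j = 0) ?mulr0//.
    by apply/eqP/negPn/negP => rlj; apply: r0; exists (widen_ord (leqnSn _) l); rewrite -jm.
  rewrite -[RHS](sE k); apply: eq_bigr => l _; rewrite jE !widen_lift liftK.
  by [].
have [s [i si] sE] := IH (fun i j => r p ord_max * r (lift p i) (lift ord_max j)
  - r (lift p i) ord_max * r p (lift ord_max j)).
pose t i := if unlift p i is Some k then s k * r p ord_max
            else - \sum_k s k * r (lift p k) ord_max.
have tl k : t (lift p k) = s k * r p ord_max by rewrite /t liftK.
have tp : t p = - \sum_k s k * r (lift p k) ord_max by rewrite /t unlift_none.
exists t.
  exists (lift p i); rewrite tl.
  by apply/eqP => /domT[/eqP|/eqP]; apply/negP.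
move=> j; rewrite (bigD1_ord p) //= tp.
under eq_bigr => l _ do rewrite tl.
have [k jE|->] := unliftP ord_max j; last first.
  by rewrite mulNr mulr_suml addrC -sumrB big1// => k _; ring.
rewrite -[RHS](sE k) mulNr mulr_suml addrC -sumrB; apply: eq_bigr => l _.
by rewrite jE; ring.
Qed.

(** A vanishing Wronskian gives a constant ratio. Let n be the order of f, c the ratio of the
    coefficients at n, and u = g - c f. With theta = x d/dx, which is diagonal on monomials, f
    theta(u) = u theta(f). If u has order m, leading coefficients give m = n in characteristic zero,
    whereas the coefficient of u at n vanishes by the choice of c. *)
Lemma fpsD_proportional (K : numFieldType) (f g : fps K) : f != 0 ->
  f * fpsD g = g * fpsD f -> exists c, g = fpsC c * f.
Proof.
move=> f0; set n := fps_val f => W.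
have fn := val_neq0 f0; rewrite -/n in fn.
exists (g n / f n); apply/eqP; rewrite -subr_eq0; apply/negPn/negP => u0.
set u := g - _ in u0.
have DZ : fpsD (fpsC (g n / f n) * f) = fpsC (g n / f n) * fpsD f.
  by apply/funext => k; rewrite /fpsD !fpsC_mulE mulrnAr.
have Wu : f * (fpsX * fpsD u) = u * (fpsX * fpsD f).
  have -> : fpsD u = fpsD g - fpsC (g n / f n) * fpsD f.
    by rewrite -DZ; apply/funext => k; rewrite /u /fpsD !fps_addE !fps_oppE mulrnBl.
  rewrite mulrCA mulrBr W /u; ring.
have thE (h : fps K) k : (fpsX * fpsD h) k = h k *+ k.
  by rewrite fpsX_mulE; case: k => //; rewrite mulr0n.
have un : u n = 0 by rewrite /u fps_addE fps_oppE fpsC_mulE divfK// subrr.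
have um := val_neq0 u0; set m := fps_val u in um.
have [E1 _] := @fps_mul_lead _ f (fpsX * fpsD u) n m
  ltac:(exact: val_lt) ltac:(by move=> k km; rewrite thE (val_lt km) mul0rn).
have [E2 _] := @fps_mul_lead _ u (fpsX * fpsD f) m n
  ltac:(exact: val_lt) ltac:(by move=> k km; rewrite thE (val_lt km) mul0rn).
move: E1; rewrite Wu addnC E2 !thE => /eqP.
rewrite -subr_eq0 (_ : _ - _ = (n%:R - m%:R) * (u m * f n)); last by ring.
rewrite !mulf_eq0 (negbTE um) (negbTE fn) !orbF subr_eq0 eqr_nat => /eqP nm.
by move: um; rewrite -nm un eqxx.
Qed.

(* A family in [S], independent modulo [I] and of maximal length, spans [S]
   modulo [I]. *)
Lemma span_modulo (K : fieldType) (E : lmodType K) (S I : E -> Prop) n :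
  (forall u v, I u -> I v -> I (u + v)) -> (forall c u, I u -> I (c *: u)) ->
  (forall h : 'I_n.+1 -> E, (forall i, S (h i)) ->
    exists2 c : 'I_n.+1 -> K, exists i, c i != 0 & I (\sum_i c i *: h i)) ->
  exists m (e : 'I_m -> E), (forall i, S (e i)) /\
    forall h, S h -> exists c : 'I_m -> K, I (h - \sum_i c i *: e i).
Proof.
move=> ID IZ dep.
pose indep m (e : 'I_m -> E) := (forall i, S (e i)) /\
  forall c : 'I_m -> K, I (\sum_i c i *: e i) -> forall i, c i = 0.
pose P m := `[< exists e : 'I_m -> E, indep m e >].
have exP : exists m, P m.
  by exists 0%N; apply/asboolP; exists (fun=> 0); split => [[]|? ? []].
have bP m : P m -> (m <= n)%N.
  move=> /asboolP[e [Se e_indep]]; rewrite leqNgt; apply/negP => nm.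
  have [c [i ci] Ic] := dep (fun i => e (widen_ord nm i)) (fun i => Se _).
  pose c' (j : 'I_m) := if insub (nat_of_ord j) is Some k then c k else 0.
  have c'E k : c' (widen_ord nm k) = c k.
    by rewrite /c' /= valK.
  suff /e_indep/(_ (widen_ord nm i)) : I (\sum_j c' j *: e j).
    by rewrite c'E => ci0; rewrite ci0 eqxx in ci.
  rewrite (_ : \sum_j _ = \sum_i c i *: e (widen_ord nm i))//.
  rewrite (bigID (fun j : 'I_m => (j < n.+1)%N)) /= [X in _ + X]big1 ?addr0.
    rewrite (big_ord_narrow nm).
    by apply: eq_bigr => k _; rewrite c'E.
  by move=> j jn; rewrite /c' insubN// scale0r.
case: (ex_maxnP exP bP) => m /asboolP[e [Se e_indep]] m_max.
exists m, e; split => // h Sh.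
pose e' (i : 'I_m.+1) := if unlift ord_max i is Some j then e j else h.
have Se' i : S (e' i) by rewrite /e'; case: unliftP.
have e'w j : e' (widen_ord (leqnSn m) j) = e j.
  by rewrite /e' widen_lift liftK.
have [c [i ci] Ic] : exists2 c, exists i, c i != 0 & I (\sum_i c i *: e' i).
  apply: contrapT => H; have /m_max : P m.+1; last by rewrite ltnn.
  apply/asboolP; exists e'; split => // c Ic i; apply/eqP/negPn/negP => ci.
  by apply: H; exists c => //; exists i.
move: Ic; rewrite big_ord_recr /=; under eq_bigr do rewrite e'w.
rewrite {1}/e' unlift_none; have [cm|cm] := eqVneq (c ord_max) 0.
  rewrite cm scale0r addr0 => /e_indep c0; move: ci.
  have [k ->|->] := unliftP ord_max i; last by rewrite cm eqxx.
  by rewrite -widen_lift c0 eqxx.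
move=> /(IZ (c ord_max)^-1); rewrite scalerDr scalerA mulVf// scale1r addrC.
set s := _ *: _ => Is; exists (fun i => - (c ord_max)^-1 * c (widen_ord (leqnSn m) i)).
rewrite (_ : \sum_i _ = - s) ?opprK// /s scaler_sumr -sumrN.
by apply: eq_bigr => k _; rewrite scalerA mulNr scaleNr.
Qed.

Definition fps2_scale (K : comNzRingType) (c : K) (F : fps (fps K)) :
  fps (fps K) := fpsC (fpsC c) * F.

Section Fps2Lmodule.
Context {K : comNzRingType}.

Fact fps2_scaleA (a b : K) F :
  fps2_scale a (fps2_scale b F) = fps2_scale (a * b) F.
Proof. by rewrite /fps2_scale mulrA -!rmorphM. Qed.
Fact fps2_scale1 : left_id 1 (@fps2_scale K).
Proof. by move=> F; rewrite /fps2_scale !rmorph1 mul1r. Qed.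
Fact fps2_scaleDr : right_distributive (@fps2_scale K) +%R.
Proof. by move=> a F G; rewrite /fps2_scale mulrDr. Qed.
Fact fps2_scaleDl F : {morph (fun c : K => fps2_scale c F) : a b / a + b}.
Proof. by move=> a b; rewrite /fps2_scale !rmorphD mulrDl. Qed.

HB.instance Definition _ := GRing.Zmodule_isLmodule.Build K (fps (fps K))
  fps2_scaleA fps2_scale1 fps2_scaleDr fps2_scaleDl.

End Fps2Lmodule.

(** * Numerators of formal first integrals *)

Section Derivations.
Context {K : numFieldType}.
Local Notation A := (fps (fps K)).
Implicit Types (F G g h u v a b : A).

Definition dx F : A := fpsD F.
Definition dy F : A := fps_map (@fpsD K) F.
Definition vf a b F : A := a * dx F + b * dy F.
(** The embedding of K[[x]]; the outer [fpsC] embeds K[[y]] instead. *)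
Definition fpsx (s : fps K) : A := fps_map fpsC s.

Lemma scaleE (c : K) F : c *: F = fpsx (fpsC c) * F.
Proof.
rewrite [LHS]/(fpsC (fpsC c) * F); congr (_ * _); apply/funext => i.
by rewrite /fpsx /fps_map /fpsC; case: eqP => // _; apply/funext => j; rewrite mul0rn.
Qed.

Lemma fps2_scale_coef1 (c : K) F i : (c *: F) i = fpsC c * F i.
Proof. exact: (fpsC_mulE (fpsC c) F). Qed.

Lemma fpsxM s t : fpsx (s * t) = fpsx s * fpsx t.
Proof.
apply/funext => k; rewrite /fpsx /fps_map fps_mulE fps_mulE rmorph_sum.
by apply: eq_bigr => i _; rewrite rmorphM.
Qed.

Lemma fpsxB s t : fpsx (s - t) = fpsx s - fpsx t.
Proof. by apply/funext => k; rewrite fps_addE fps_oppE -rmorphB. Qed.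

Lemma dxD F G : dx (F + G) = dx F + dx G. Proof. exact: fpsD_add. Qed.
Lemma dyD F G : dy (F + G) = dy F + dy G.
Proof. by apply/funext => i; rewrite /dy /fps_map fps_addE fpsD_add. Qed.
Lemma dxM F G : dx (F * G) = dx F * G + F * dx G. Proof. exact: fpsD_mul. Qed.
Lemma dyM F G : dy (F * G) = dy F * G + F * dy G.
Proof. by apply: fps_map_leibniz; [exact: fpsD_add|exact: fpsD_mul]. Qed.

Lemma dx_fpsx s : dx (fpsx s) = fpsx (fpsD s).
Proof. by apply/funext => k; rewrite /dx /fpsD /fpsx /fps_map rmorphMn. Qed.
Lemma dy_fpsx s : dy (fpsx s) = 0.
Proof.
by apply/funext => k; apply/funext => l; rewrite /dy /fps_map /fpsD /= mul0rn.
Qed.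

Lemma vfD a b F G : vf a b (F + G) = vf a b F + vf a b G.
Proof. by rewrite /vf dxD dyD; ring. Qed.
Lemma vfM a b F G : vf a b (F * G) = vf a b F * G + F * vf a b G.
Proof. by rewrite /vf dxM dyM; ring. Qed.
Lemma vf0 a b : vf a b 0 = 0.
Proof. by apply: (addrI (vf a b 0)); rewrite -vfD !addr0. Qed.
Lemma vfN a b F : vf a b (- F) = - vf a b F.
Proof. by apply/eqP; rewrite -addr_eq0 -vfD addNr vf0. Qed.
Lemma vf_sum a b I (r : seq I) (F : I -> A) :
  vf a b (\sum_(i <- r) F i) = \sum_(i <- r) vf a b (F i).
Proof. exact: (big_morph _ (vfD a b) (vf0 a b)). Qed.
Lemma vf_fpsx a b s : vf a b (fpsx s) = a * fpsx (fpsD s).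
Proof. by rewrite /vf dx_fpsx dy_fpsx mulr0 addr0. Qed.
Lemma vfZ a b c F : vf a b (c *: F) = c *: vf a b F.
Proof.
have D0 : fpsx (fpsD (fpsC c)) = 0.
  by apply/funext => i; apply/funext => j; rewrite /fpsx /fps_map /fpsD /fpsC /= !mul0rn.
by rewrite !scaleE vfM vf_fpsx D0 mulr0 mul0r add0r.
Qed.
Lemma vfX a b : vf a b fpsX = a.
Proof.
have xE : fpsX = fpsx fpsX.
  apply/funext => i; rewrite /fpsx /fps_map /fpsX; case: eqP => _ //.
  by rewrite mulr0n rmorph0.
have D1 : fpsD fpsX = 1 :> fps K.
  by apply/funext => -[|[|i]]; rewrite /fpsD /fpsX /= ?mul0rn.
by rewrite xE vf_fpsx D1 /fpsx (_ : fps_map _ 1 = 1) ?mulr1//;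
  apply/funext => i; rewrite /fps_map !fps_oneE; case: eqP => _; rewrite ?rmorph1 ?rmorph0.
Qed.
Lemma vf_exp a b v n : vf a b (v ^+ n.+1) = v ^+ n * vf a b v *+ n.+1.
Proof.
elim: n => [|n IH]; first by rewrite expr0 mul1r mulr1n.
by rewrite exprS vfM IH exprS; ring.
Qed.

(* For [g != 0]: [h / g] is a first integral of [a d/dx + b d/dy]. *)
Definition quotient_integral a b g h := g * vf a b h = h * vf a b g.
Local Notation V := quotient_integral.

Lemma quotient_integralD a b g h k : V a b g h -> V a b g k -> V a b g (h + k).
Proof. by move=> Vh Vk; rewrite /V vfD mulrDr Vh Vk mulrDl. Qed.

Lemma quotient_integralZ a b g c h : V a b g h -> V a b g (c *: h).
Proof. by move=> Vh; rewrite /V vfZ !scaleE mulrCA Vh mulrA. Qed.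

Lemma quotient_integral_sum a b g n (c : 'I_n -> K) (e : 'I_n -> A) :
  (forall i, V a b g (e i)) -> V a b g (\sum_i c i *: e i).
Proof.
move=> Ve; elim/big_ind: _ => [||i _]; first by rewrite /V vf0 mulr0 mul0r.
  by move=> x y; exact: quotient_integralD.
exact: quotient_integralZ.
Qed.

Lemma quotient_integralB a b g h k : V a b g h -> V a b g k -> V a b g (h - k).
Proof.
by move=> Vh Vk; rewrite -scaleN1r; apply/quotient_integralD/quotient_integralZ.
Qed.

Lemma quotient_integralM a b g h v : v != 0 ->
  V a b (g * v) (h * v) <-> V a b g h.
Proof.
move=> v0; rewrite /V !vfM.
have E k l : k * v * (vf a b l * v + l * vf a b v) =
  v * v * (k * vf a b l) + k * l * v * vf a b v by ring.
rewrite !E [h * g]mulrC; split=> [/addIr|->//]; apply: (mulfI_nzd fps2_nzd).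
by apply/eqP => /fps2_nzd[] /eqP; apply/negP.
Qed.

Lemma quotient_integral_scale d a b g h : d != 0 ->
  V (d * a) (d * b) g h <-> V a b g h.
Proof.
have E F : vf (d * a) (d * b) F = d * vf a b F by rewrite /vf; ring.
move=> d0; rewrite /V !E mulrCA [h * _]mulrCA; split=> [|->//].
exact: (mulfI_nzd fps2_nzd).
Qed.

(** Changes the denominator: a factor [v] of [g] cannot be cancelled modulo [v], whereas a numerator
    [h] prime to [v] can. *)
Lemma quotient_integral_trans a b g h k : g != 0 ->
  V a b g h -> V a b g k -> V a b h k.
Proof.
move=> g0; rewrite /V => hE kE; apply: (mulfI_nzd fps2_nzd g0).
by rewrite mulrCA kE mulrCA -hE; ring.
Qed.

(** Write g = v^(n+1) w with v not dividing w. After cancelling v^n the defining identity of h/g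
    reads (n+1) h w X(v) = 0 modulo v, and v is prime to h, to w and to the integer n+1. *)
Lemma invariant_divisor a b g h v : irreducible v -> g != 0 -> dvd v g ->
  V a b g h -> ~ dvd v h -> dvd v (vf a b v).
Proof.
move=> vI g0 vg Vh vh; have [v0 ov _] := vI.
have [[|n] [w [gE vw]]] := multiplicity v0 g0 ov.
  by move: vg; rewrite gE expr0 mul1r.
have E : v * (w * vf a b h) = v * (h * vf a b w) + h * w * vf a b v *+ n.+1.
  have vn0 : v ^+ n != 0.
    by apply: contraNneq g0 => vn0; rewrite gE exprSr vn0 !mul0r.
  apply: (mulfI_nzd fps2_nzd vn0); move: Vh.
  rewrite /V gE vfM vf_exp exprS => Vh.
  transitivity (v * v ^+ n * w * vf a b h); first by ring.
  by rewrite Vh; ring.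
have /(irreducible_prime vI)[|//] : dvd v (h * w * vf a b v).
  have -> : h * w * vf a b v =
      (n.+1%:R^-1 : K) *: (v * (w * vf a b h - h * vf a b w)).
    have S (F : A) : F *+ n.+1 = (n.+1%:R : K) *: F by rewrite scaler_nat.
    by rewrite mulrBr E addrC addKr S scalerA mulVf ?pnatr_eq0 ?scale1r.
  by rewrite scaleE mulrCA mulrC; exact: (dvdMl _ (dvd_refl v)).
by move=> /(irreducible_prime vI)[].
Qed.

End Derivations.

(** * Finiteness of numerators modulo a fixed denominator *)

Section MeromorphicIntegrals.
Context {K : numFieldType}.
Local Notation A := (fps (fps K)).
Local Notation V := quotient_integral.
Implicit Types (F G g h u v a b : A).

Lemma dvdZ v (c : K) F : dvd v F -> dvd v (c *: F).
Proof. by rewrite scaleE; exact: dvdMl. Qed.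

(** On x = 0 the y-derivative of v has order exactly one less than v, by characteristic zero. *)
Lemma dy_not_dvd v : v 0%N != 0 -> v 0%N 0%N = 0 -> ~ dvd v (dy v).
Proof.
move=> v0 v00 [c /(congr1 (fun F : A => F 0%N))].
rewrite fps_mul0E /dy /fps_map => E.
have vn := val_neq0 v0; set n := fps_val (v 0%N) in vn.
have n0 : (0 < n)%N by rewrite lt0n; apply: contraNneq vn => ->; rewrite v00.
have [_ /(_ n.-1)] := @fps_mul_lead _ (c 0%N) (v 0%N) 0 n
  (fun k => ltac:(by [])) (@val_lt _ _).
rewrite prednK// leqnn => /(_ isT)/eqP; rewrite -E /fpsD prednK//.
by rewrite mulrn_eq0 (negbTE vn) orbF; case: n n0 {vn}.
Qed.

(** Compare the lowest coefficients in x: that of s is a nonzero constant, while that of a multiple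
    of v is divisible by v(0, y), which vanishes at y = 0. *)
Lemma fpsx_not_dvd v (s : fps K) : v 0%N != 0 -> v 0%N 0%N = 0 -> s != 0 ->
  ~ dvd v (fpsx s).
Proof.
move=> v0 v00 s0 [c E].
have vv : fps_val v = 0%N by apply/eqP; rewrite -leqn0; exact: val_le.
have c0 : c != 0.
  apply: contraNneq s0 => c0; move: E; rewrite c0 mul0r => E.
  apply/eqP/funext => k; have := congr1 (fun F : A => F k 0%N) E.
  by rewrite /fpsx /fps_map /fpsC mulr1n.
have v'0 : v != 0 by apply: contraNneq v0 => ->.
have [_] := fps_mul_val (@fps1_nzd K) c0 v'0; rewrite -E vv addn0 => F0.
have sc : s (fps_val c) = 0.
  have := congr1 (fun f : fps K => f 0%N) F0.
  by rewrite fps_mul0E v00 mulr0 /fpsx /fps_map /fpsC mulr1n.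
move: F0; rewrite /fpsx /fps_map sc rmorph0 => /esym/fps1_nzd[]/eqP.
  by apply/negP/val_neq0.
exact/negP.
Qed.

(** By Weierstrass division, K[[x, y]] modulo v is spanned over K[[x]] by n powers of y, so n + 1
    elements satisfy a relation. *)
Lemma fpsx_dependent v n (h : 'I_n.+1 -> A) : v 0%N != 0 ->
  fps_val (v 0%N) = n ->
  exists2 s : 'I_n.+1 -> fps K, exists i, s i != 0 &
    dvd v (\sum_i fpsx (s i) * h i).
Proof.
move=> v0 vn.
have /choice[q /choice[r qrP]] i := weierstrass_division (h i) v0.
have [s s0 sE] := underdetermined_system (@fps1_nzd K)
  (fun (i : 'I_n.+1) (j : 'I_n) => (fun k => r i k j) : fps K).
exists s => //; exists (\sum_i fpsx (s i) * q i).
under eq_bigr do rewrite (qrP _).1 mulrDr mulrA.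
rewrite big_split /= -mulr_suml [X in _ + X](_ : _ = 0) ?addr0//.
apply/funext => k; apply/funext => j.
have [jn|nj] := ltnP j n; last first.
  rewrite fps_sumE (fps_sumE _ _ _ j : (\sum_(i < n.+1) _ : fps K) j = _).
  rewrite big1// => i _; rewrite fps_mulE fps_sumE big1// => l _.
  by rewrite fpsC_mulE (qrP i).2 ?vn ?mulr0.
have := congr1 (fun f : fps K => f k) (sE (Ordinal jn)).
rewrite !fps_sumE => E; transitivity ((0 : fps K) k); last by [].
rewrite -E; apply: eq_bigr => i _.
rewrite !fps_mulE fps_sumE; apply: eq_bigr => l _.
by rewrite fpsC_mulE.
Qed.

(* The derivation acts on the coefficients of a relation as [a d/dx], so that
   [s i] may be replaced by the Wronskian of [s 0] and [s i]. *)
Lemma wronskian_dependent a b g v hs n (h : 'I_n -> A) (s : 'I_n -> fps K) :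
  irreducible v -> v 0%N != 0 -> g != 0 -> ~ dvd v a -> dvd v (vf a b v) ->
  V a b g hs -> ~ dvd v hs -> (forall i, V a b g (h i)) ->
  (exists i, s i != 0) -> dvd v (\sum_i fpsx (s i) * h i) ->
  exists2 c : 'I_n -> K, exists i, c i != 0 & dvd v (\sum_i c i *: h i).
Proof.
move=> vI v0 g0 va vX Vhs vhs.
have v00 : v 0%N 0%N = 0 by apply: ord2_neq0; case: vI.
have vfdvd F : dvd v F -> dvd v (vf a b F).
  move=> [c ->]; rewrite vfM; apply: dvdD; last exact: dvdMl.
  by exists (vf a b c).
(* A relation may be differentiated coefficientwise. For the relation Y, hs X(Y) - X(hs) Y is
   divisible by v; since each k_i / hs is a first integral, only the derivatives of the coefficients
   survive, with factor hs a, to which v is prime. *)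
have derive m (t : 'I_m -> fps K) (k : 'I_m -> A) : (forall i, V a b g (k i)) ->
    dvd v (\sum_i fpsx (t i) * k i) -> dvd v (\sum_i fpsx (fpsD (t i)) * k i).
  move=> Vk; set Y := \sum_i _ => vY.
  have : dvd v (hs * a * (\sum_i fpsx (fpsD (t i)) * k i)).
    rewrite (_ : _ * _ = hs * vf a b Y - vf a b hs * Y).
      by apply: dvdB; apply: dvdMl => //; exact: vfdvd.
    rewrite /Y vf_sum !mulr_sumr -sumrB; apply: eq_bigr => i _.
    have Vi : hs * vf a b (k i) = k i * vf a b hs.
      exact: quotient_integral_trans g0 Vhs (Vk i).
    rewrite vfM vf_fpsx mulrDr [hs * (fpsx _ * vf _ _ _)]mulrCA Vi; ring.
  by move=> /(irreducible_prime vI)[/(irreducible_prime vI)[]|].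
elim: n h s => [|n IH] h s Vh; first by move=> [[]].
have [s00|s00] := eqVneq (s ord0) 0.
  rewrite big_ord_recl s00 (_ : fpsx 0 = 0) ?mul0r ?add0r; last first.
    by apply/funext => i; rewrite /fpsx /fps_map rmorph0.
  move=> [i si] /(IH (fun i => h (lift ord0 i)) (fun i => s (lift ord0 i)))[//||c].
    have [j iE|iE] := unliftP ord0 i; last by move: si; rewrite iE s00 eqxx.
    by exists j; rewrite -iE.
  move=> [j cj] cE; exists (fun i => if unlift ord0 i is Some k then c k else 0).
    by exists (lift ord0 j); rewrite liftK.
  rewrite big_ord_recl unlift_none scale0r add0r.
  by under eq_bigr do rewrite liftK.
move=> _ vs.
pose t i := s ord0 * fpsD (s (lift ord0 i)) - fpsD (s ord0) * s (lift ord0 i).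
have vt : dvd v (\sum_i fpsx (t i) * h (lift ord0 i)).
  rewrite (_ : \sum_i _ = fpsx (s ord0) * (\sum_i fpsx (fpsD (s i)) * h i) -
      fpsx (fpsD (s ord0)) * (\sum_i fpsx (s i) * h i)); last first.
    rewrite !big_ord_recl !mulrDr opprD addrACA.
    rewrite [X in _ = X + _](_ : _ = 0) ?add0r; last by ring.
    rewrite !mulr_sumr -sumrB; apply: eq_bigr => i _.
    by rewrite /t fpsxB !fpsxM; ring.
  by apply: dvdB; apply: dvdMl => //; exact: derive.
have [[i ti]|t0] := pselect (exists i, t i != 0).
  have [//||c [j cj] cE] := IH _ _ _ _ vt; first by exists i.
  exists (fun i => if unlift ord0 i is Some k then c k else 0).
    by exists (lift ord0 j); rewrite liftK.
  rewrite big_ord_recl unlift_none scale0r add0r.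
  by under eq_bigr do rewrite liftK.
(* All Wronskians vanish, so every coefficient is a constant times the first one; this common factor
   lies in K[[x]] and is prime to v. *)
have /choice[c cE] i : exists c, s (lift ord0 i) = fpsC c * s ord0.
  apply: fpsD_proportional => //; apply/eqP; rewrite -subr_eq0.
  apply/negPn/negP => ti; apply: t0; exists i; rewrite /t.
  by rewrite [fpsD _ * _]mulrC.
exists (fun i => if unlift ord0 i is Some k then c k else 1).
  by exists ord0; rewrite unlift_none oner_neq0.
rewrite big_ord_recl unlift_none scale1r.
under eq_bigr do rewrite liftK scaleE.
have /(irreducible_prime vI)[/(fpsx_not_dvd v0 v00 s00)//|//] :
  dvd v (fpsx (s ord0) * (h ord0 + \sum_i fpsx (fpsC (c i)) * h (lift ord0 i))).
rewrite mulrDr mulr_sumr; move: vs; rewrite big_ord_recl.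
under eq_bigr do rewrite cE fpsxM.
by congr (dvd _ (_ + _)); apply: eq_bigr => i _; ring.
Qed.

(** If every numerator is divisible by v, nothing is needed. Otherwise a numerator [hs] prime to v
    makes v invariant. When v is x up to a unit, reduction means restriction to x = 0 and [hs] alone
    spans; for any other v the number of generators is at most the y-order of v(0, y). *)
Lemma span_modulo_prime a b g v : irreducible v -> a != 0 \/ b != 0 ->
  g != 0 -> dvd v g ->
  exists m (e : 'I_m -> A), (forall i, V a b g (e i)) /\
    forall h, V a b g h -> exists c : 'I_m -> K, dvd v (h - \sum_i c i *: e i).
Proof.
move=> vI ab0 g0 vg; have [v0 ov _] := vI.
have v00 : v 0%N 0%N = 0 by apply: ord2_neq0.
have [[hs [Vhs vhs]]|nohs] := pselect (exists h, V a b g h /\ ~ dvd v h); last first.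
  exists 0%N, (fun=> 0); split=> [[]//|h Vh]; exists (fun=> 0).
  rewrite big_ord0 subr0; apply: contrapT => vh; apply: nohs.
  by exists h.
have [d [a' [b' [d0 aE bE vab]]]] := reduce_pair v0 ov ab0.
have VE h : V a b g h <-> V a' b' g h.
  by rewrite aE bE; exact: quotient_integral_scale.
suff [m [e [Ve eP]]] : exists m (e : 'I_m -> A), (forall i, V a' b' g (e i)) /\
    forall h, V a' b' g h -> exists c : 'I_m -> K, dvd v (h - \sum_i c i *: e i).
  by exists m, e; split=> [i|h /VE/eP//]; apply/VE.
move: Vhs => /VE Vhs {ab0 aE bE VE a b d d0}.
have vX := invariant_divisor vI g0 vg Vhs vhs.
have [vz|vz] := eqVneq (v 0%N) 0.
  have vx := irreducible_x vI vz.
  have dvd0 F : F 0%N = 0 -> dvd v F.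
    by move=> /shiftK ->; rewrite mulrC; exact: dvdMl.
  (* Here v is x times a unit and X(x) is the first component, so invariance of v makes x divide
     that component. On x = 0 only the derivative in y remains, with nonzero coefficient. *)
  have va : dvd v a'.
    have vE := shiftK vz.
    have : dvd v (a' * fps_shift v).
      rewrite (_ : _ * _ = vf a' b' v - vf a' b' (fps_shift v) * fpsX).
        by apply: dvdB => //; exact: dvdMl.
      by rewrite {2}vE vfM vfX; ring.
    move=> /(irreducible_prime vI)[//|].
    have sv0 : fps_shift v != 0.
      by apply: contraNneq v0 => sv0; rewrite vE sv0 mulr0.
    have x0 : (fpsX : A) != 0.
      by apply: contraNneq v0 => x0; rewrite vE x0 mul0r.
    by move=> /(dvd_ord2 sv0); rewrite {1}vE ord2M// ord2X add1n ltnn.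
  have b0 : b' 0%N != 0.
    by apply/eqP => /dvd0 vb; exact: vab.
  have hs0 : hs 0%N != 0 by apply/eqP => /dvd0.
  exists 1%N, (fun=> hs); split => // h Vh.
  have Vh' : V a' b' hs h by exact: quotient_integral_trans g0 Vhs Vh.
  have [|c cE] := @fpsD_proportional _ (hs 0%N) (h 0%N) hs0.
    have [ca caE] := va; move: (congr1 (fun F : A => F 0%N) Vh').
    rewrite !fps_mul0E /vf !fps_addE !fps_mul0E caE fps_mul0E vz mulr0 !mul0r !add0r.
    rewrite mulrCA [_ * (b' 0%N * _)]mulrCA.
    by move=> /(mulfI_nzd (@fps1_nzd K) b0).
  exists (fun=> c); apply: dvd0; rewrite big_ord1 fps_addE fps_oppE cE.
  by rewrite fps2_scale_coef1 subrr.
(* Were v to divide the first component, invariance would make it divide b' times the y-derivative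
   of v; the first factor is excluded by the reduction of the pair, the second by its order on x =
   0. *)
have va : ~ dvd v a'.
  move=> va; have : dvd v (b' * dy v).
    rewrite (_ : _ * _ = vf a' b' v - dx v * a'); last by rewrite /vf; ring.
    by apply: dvdB => //; exact: dvdMl.
  move=> /(irreducible_prime vI)[vb|]; first exact: vab.
  exact: dy_not_dvd.
apply: (@span_modulo _ A (V a' b' g) (dvd v) (fps_val (v 0%N))).
- by move=> x y; exact: dvdD.
- by move=> c x; exact: dvdZ.
move=> h Vh; have [s s0 vs] := fpsx_dependent h vz erefl.
exact: (wronskian_dependent vI vz g0 va vX Vhs vhs Vh s0 vs).
Qed.

(** Induction on [ord2] of the denominator g' = g1 v with v irreducible. A numerator over g' is
    corrected modulo v; the difference is h1 v with h1 a numerator over g1. Generators over g1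
    multiplied by v are numerators over g', so the two families together suffice. *)
Lemma span_modulo_denominator a b g : a != 0 \/ b != 0 -> g != 0 ->
  exists m (e : 'I_m -> A),
    forall h, V a b g h -> exists c : 'I_m -> K, dvd g (h - \sum_i c i *: e i).
Proof.
move=> ab0; suff H g' : g' != 0 -> exists m (e : 'I_m -> A),
    (forall i, V a b g' (e i)) /\
    forall h, V a b g' h -> exists c : 'I_m -> K, dvd g' (h - \sum_i c i *: e i).
  by move=> /H[m [e [_ eP]]]; exists m, e.
have [k] := ubnP (ord2 g'); elim: k g' => // k IH g' gk g0.
have [og|og] := posnP (ord2 g').
  exists 0%N, (fun=> 0); split=> [[]//|h Vh]; exists (fun=> 0).
  exact: unit_dvd.
have [v vI [g1 gE]] := irreducible_divisor g0 og; have [v0 ov _] := vI.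
have g10 : g1 != 0 by apply: contraNneq g0 => g10; rewrite gE g10 mul0r.
have [|//|m1 [e1 [Ve1 e1P]]] := IH g1 _; first by move: gk; rewrite gE ord2M//; lia.
have [|m2 [e2 [Ve2 e2P]]] := span_modulo_prime vI ab0 g0; first by exists g1.
exists (m2 + m1)%N,
  (fun i : 'I_(m2 + m1) => match fintype.split i with inl j => e2 j | inr j => e1 j * v end).
have sl j : fintype.split (lshift m1 j : 'I_(m2 + m1)) = inl j := unsplitK (inl j).
have sr j : fintype.split (rshift m2 j : 'I_(m2 + m1)) = inr j := unsplitK (inr j).
split.
  move=> i; case: fintype.split => j //.
  by rewrite gE; apply/quotient_integralM.
move=> h Vh; have [c2 [h1 h1E]] := e2P h Vh.
have Vh1 : V a b g1 h1.
  apply/(quotient_integralM _ _ _ _ v0); rewrite -gE -h1E.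
  by apply: quotient_integralB => //; exact: quotient_integral_sum.
have [c1 [h2 h2E]] := e1P h1 Vh1.
exists (fun i : 'I_(m2 + m1) => match fintype.split i with inl j => c2 j | inr j => c1 j end), h2.
rewrite big_split_ord /=.
under eq_bigr do rewrite sl.
under [X in _ - (_ + X)]eq_bigr do rewrite sr.
rewrite opprD addrA h1E gE mulrA -h2E mulrBl; congr (_ - _).
rewrite mulr_suml; apply: eq_bigr => i _.
by rewrite !scaleE mulrA.
Qed.

(** A field of the centralizer has two coefficients over g, and one combination must make both
    divisible: with m generators modulo g this is a kernel vector of 2m conditions on 2m + 1
    unknowns. *)
Lemma dependent_modulo a b g : a != 0 \/ b != 0 -> g != 0 ->
  exists N, forall h k : 'I_N.+1 -> A,
    (forall i, V a b g (h i)) -> (forall i, V a b g (k i)) ->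
    exists2 c : 'I_N.+1 -> K, exists i, c i != 0 &
      dvd g (\sum_i c i *: h i) /\ dvd g (\sum_i c i *: k i).
Proof.
move=> ab0 g0; have [m [e eP]] := span_modulo_denominator ab0 g0.
exists (m + m)%N => h k Vh Vk.
have /choice[ch chE] i := eP _ (Vh i); have /choice[ck ckE] i := eP _ (Vk i).
pose M := \matrix_(i < (m + m).+1) \row_(j < m + m)
  match fintype.split j with inl j => ch i j | inr j => ck i j end.
have /rowV0Pn[c cM c0] : kermx M != 0.
  rewrite kermx_eq0 /row_free neq_ltn (leq_ltn_trans (rank_leq_col _))//.
have {}cM : c *m M = 0 by apply/sub_kermxP.
exists (fun i => c 0 i).
  apply: contrapT => H; move/eqP: c0; apply; apply/rowP => i; rewrite mxE.
  by apply/eqP/negPn/negP => ci; apply: H; exists i.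
have comb (f : 'I_(m + m).+1 -> A) (cf : 'I_(m + m).+1 -> 'I_m -> K) :
    (forall i, dvd g (f i - \sum_j cf i j *: e j)) ->
    (forall j, \sum_i c 0 i * cf i j = 0) -> dvd g (\sum_i c 0 i *: f i).
  move=> fE cf0.
  have -> : \sum_i c 0 i *: f i = \sum_i c 0 i *: (f i - \sum_j cf i j *: e j).
    under [RHS]eq_bigr do rewrite scalerBr; rewrite sumrB.
    rewrite [X in _ = _ - X](_ : _ = 0) ?subr0//.
    under eq_bigr do rewrite scaler_sumr.
    rewrite exchange_big big1// => j _ /=.
    by under eq_bigr do rewrite scalerA; rewrite -scaler_suml cf0 scale0r.
  by apply: dvd_sum => i _; exact: dvdZ.
have cM0 j : \sum_i c 0 i *
    match fintype.split j with inl l => ch i l | inr l => ck i l end = 0.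
  have := congr1 (fun r : 'rV_(m + m) => r 0 j) cM; rewrite !mxE.
  by under eq_bigr do rewrite !mxE.
split; [apply: comb chE _|apply: comb ckE _] => j.
  rewrite -[RHS](cM0 (lshift m j)); apply: eq_bigr => i _.
  by rewrite (unsplitK (inl j)).
rewrite -[RHS](cM0 (rshift m j)); apply: eq_bigr => i _.
by rewrite (unsplitK (inr j)).
Qed.
End MeromorphicIntegrals.

(** * Convergent power series *)

Section Modulus.
Context {R : realType}.
Implicit Types (x y z : R[i]).

(** The norm of [R[i]] takes its values in [R[i]], which is only partially ordered; estimates are
    made with this real modulus. *)
Definition nc z : R := Normc.normc z.

Lemma norm_nc z : `|z| = (nc z)%:C%C. Proof. by []. Qed.
Lemma ncM x y : nc (x * y) = nc x * nc y. Proof. exact: Normc.normcM. Qed.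
Lemma nc0 : nc 0 = 0. Proof. exact: Normc.normc0. Qed.
Lemma nc1 : nc 1 = 1. Proof. exact: Normc.normc1. Qed.
Lemma ncN x : nc (- x) = nc x. Proof. exact: normcN. Qed.
Lemma ncV x : nc x^-1 = (nc x)^-1. Proof. exact: Normc.normcV. Qed.
Lemma ncD x y : nc (x + y) <= nc x + nc y. Proof. exact: le_normcD. Qed.
Lemma ncB x y : nc (x - y) <= nc x + nc y.
Proof. by rewrite (le_trans (ncD _ _))// ncN. Qed.
Lemma ncBC x y : nc (x - y) = nc (y - x).
Proof. by rewrite -ncN opprB. Qed.
Lemma nc_ge0 z : 0 <= nc z.
Proof. by rewrite -lecR -norm_nc normr_ge0. Qed.
Lemma nc_eq0 z : (nc z == 0) = (z == 0).
Proof.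
by apply/eqP/eqP => [|->]; [exact: Normc.eq0_normc|exact: nc0].
Qed.
Lemma nc_gt0 z : (0 < nc z) = (z != 0).
Proof. by rewrite lt_neqAle nc_ge0 andbT eq_sym nc_eq0. Qed.
Lemma ncX z n : nc (z ^+ n) = nc z ^+ n.
Proof. by elim: n => [|n IH]; rewrite ?expr0 ?nc1// !exprS ncM IH. Qed.
Lemma nc_sum I (r : seq I) (P : pred I) (F : I -> R[i]) :
  nc (\sum_(i <- r | P i) F i) <= \sum_(i <- r | P i) nc (F i).
Proof.
elim/big_rec2: _ => [|i u v _ uv]; first by rewrite nc0.
by rewrite (le_trans (ncD _ _))// lerD2l.
Qed.
Lemma nc_real (r : R) : nc r%:C%C = `|r|.
Proof. by rewrite /nc /= expr0n addr0 sqrtr_sqr. Qed.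
Lemma nc_nat n : nc n%:R = n%:R :> R.
Proof. by rewrite -(rmorph_nat (real_complex R)) nc_real normr_nat. Qed.
Lemma ncMn z n : nc (z *+ n) = nc z *+ n.
Proof. by rewrite -mulr_natl ncM nc_nat mulr_natl. Qed.
Lemma nc_Re z : `|complex.Re z| <= nc z.
Proof. by rewrite -lecR -norm_nc normc_ge_Re. Qed.
Lemma nc_Im z : `|complex.Im z| <= nc z.
Proof.
case: z => a b; rewrite /nc /= -sqrtr_sqr ler_sqrt ?addr_ge0 ?sqr_ge0//.
by rewrite lerDr sqr_ge0.
Qed.
Lemma nc_ReIm z : nc z <= `|complex.Re z| + `|complex.Im z|.
Proof.
case: z => a b; rewrite /nc /= -[leRHS]ger0_norm ?addr_ge0//.
rewrite -sqrtr_sqr ler_sqrt ?sqr_ge0// sqrrD !real_normK ?num_real//.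
by rewrite -addrA lerD2l lerDr mulrn_wge0// mulr_ge0.
Qed.
Lemma nc_eps z : (forall e : R, 0 < e -> nc z <= e) -> z = 0.
Proof.
move=> ze; apply/eqP; rewrite -nc_eq0 eq_le nc_ge0 andbT.
by apply/ler_addgt0Pl => e e0; rewrite addr0 ze.
Qed.

End Modulus.

Section Convergent.
Context {R : realType}.
Local Notation A := (fps (fps R[i])).
Implicit Types (F g h k : A).

Definition convergent F := exists M t : R, 0 < t /\
  forall i j, nc (F i j) <= M * t ^+ (i + j).

(** One number plays both constants and may be enlarged, so several series can share it. *)
Lemma convergent_ge1 F : convergent F -> exists2 t : R, 1 <= t &
  forall s, t <= s -> forall i j, nc (F i j) <= s * s ^+ (i + j).
Proof.
move=> [M [t [t0 Ft]]]; exists (1 + `|M| + t).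
  by rewrite -addrA lerDl addr_ge0// ltW.
move=> s ts i j; rewrite (le_trans (Ft i j))//.
have M0 : 0 <= `|M| by [].
rewrite (@le_trans _ _ (s * t ^+ (i + j)))//.
  apply: ler_wpM2r; first by rewrite exprn_ge0// ltW.
  by have := ler_norm M; lra.
by apply: ler_wpM2l; rewrite ?lerXn2r// ?nnegrE; lra.
Qed.

Lemma geometric_sum_le (q : R) n : 1 < q -> \sum_(m < n) q ^+ m <= q ^+ n / (q - 1).
Proof.
move=> q1; by rewrite ler_pdivlMr ?subr_gt0// mulrC -subrX1 lerBlDr lerDl.
Qed.

(** Let n be the order of g(0, y). The coefficient of h at (i, j + n) expresses k_ij through h,
    through the k_lm with l < i and m up to j + n, and through the k_im with m < j. A nested
    induction proves the bound [B]; the second index may exceed j in the first group, so p must be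
    much larger than q. *)
Lemma convergent_quotient_regular g h k : g 0%N != 0 -> convergent g ->
  convergent h -> h = k * g -> convergent k.
Proof.
move=> g0 /convergent_ge1[tg tg1 gt] /convergent_ge1[th th1 ht] hE.
pose n := fps_val (g 0%N); pose c := nc (g 0%N n).
have c0 : 0 < c by rewrite nc_gt0 val_neq0.
pose t := Num.max tg th.
have t1 : 1 <= t by rewrite le_max tg1.
have t0 : 0 < t by rewrite (lt_le_trans ltr01).
have {}gt i j : nc (g i j) <= t * t ^+ (i + j) by apply: gt; rewrite le_max lexx.
have {}ht i j : nc (h i j) <= t * t ^+ (i + j).
  by apply: ht; rewrite le_max lexx orbT.
have [D D0 cD] : exists2 D, 0 < D & c * D = t * t ^+ n.
  exists (t * t ^+ n / c); first by rewrite divr_gt0 ?mulr_gt0 ?exprn_gt0.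
  by rewrite mulrC divfK// gt_eqF.
(* The bound is the sum of three equal parts: one for h and one for each of the two sums. With q - 1
   = 3D the geometric sum over m < j costs one part, and p - 1 = q^(n+1) absorbs the shift by n in
   the sum over l < i. *)
pose q := 1 + 3 * D; pose p := 1 + q ^+ n.+1.
have q1 : 1 < q by rewrite ltrDl mulr_gt0.
have q0 : 0 < q by rewrite (lt_trans ltr01).
have p1 : 1 < p by rewrite ltrDl exprn_gt0.
have p0 : 0 < p by rewrite (lt_trans ltr01).
have pE : p - 1 = q ^+ n.+1 by rewrite /p addrAC subrr add0r.
have qE : q - 1 = 3 * D by rewrite /q addrAC subrr add0r.
pose B l m := 3 * D * (t ^+ (l + m) * (p ^+ l * q ^+ m)).
have D3 : 0 < 3 * D by rewrite mulr_gt0.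
have t'0 := ltW t0; have p'0 := ltW p0; have q'0 := ltW q0.
have c'0 := ltW c0; have D'0 := ltW D0; have D'3 := ltW D3.
have B0 l m : 0 <= B l m by rewrite !mulr_ge0 ?exprn_ge0.
suff kB i j : nc (k i j) <= B i j.
  exists (3 * D), (t * (p * q)); split=> [|i j]; first by rewrite !mulr_gt0.
  rewrite (le_trans (kB i j))// ler_pM2l ?mulr_gt0// !exprMn.
  rewrite ler_pM2l ?exprn_gt0// ler_pM ?exprn_ge0//.
    by rewrite ler_weXn2l ?ltW ?leq_addr.
  by rewrite ler_weXn2l ?ltW ?leq_addl.
elim/ltn_ind: i j => i IHi j.
elim/ltn_ind: j => j IHj.
have jn : (j < (j + n).+1)%N by rewrite ltnS leq_addr.
pose S1 := \sum_(l < i) (k l * g (i - l)%N) (j + n)%N.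
pose S2 := \sum_(m < (j + n).+1 | m != Ordinal jn) k i m * g 0%N (j + n - m)%N.
have kE : k i j * g 0%N n = h i (j + n)%N - S1 - S2.
  have -> : h i (j + n)%N = S1 + (k i * g 0%N) (j + n)%N.
    by rewrite hE fps_mulE fps_sumE big_ord_recr /= subnn.
  rewrite [(k i * g 0%N) _]fps_mulE (bigD1 (Ordinal jn))//= addKn /S2; ring.
rewrite -(ler_pM2r c0) /c -ncM kE.
rewrite (le_trans (ncB _ _))//.
pose P := p ^+ i * q ^+ j.
have P1 : 1 <= P by rewrite mulr_ege1// exprn_ege1// ltW.
have hb : nc (h i (j + n)%N) <= c * t ^+ (i + j) * D.
  by rewrite (le_trans (ht _ _))// addnA exprD mulrAC cD -mulrA [t ^+ n * _]mulrC.
have S1b : nc S1 <= c * t ^+ (i + j) * (D * P).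
  rewrite (le_trans (nc_sum _ _ _))//.
  have T l : (l < i)%N -> nc ((k l * g (i - l)%N) (j + n)%N) <=
      c * t ^+ (i + j) * (3 * D) * D * (q ^+ (j + n).+1 / (q - 1)) * p ^+ l.
    move=> li; rewrite fps_mulE (le_trans (nc_sum _ _ _))//.
    have -> : c * t ^+ (i + j) * (3 * D) * D * (q ^+ (j + n).+1 / (q - 1)) * p ^+ l
      = c * t ^+ (i + j) * (3 * D) * D * p ^+ l * (q ^+ (j + n).+1 / (q - 1)) by ring.
    rewrite (le_trans _ (ler_wpM2l _ (geometric_sum_le (j + n).+1 q1)))//; last first.
      by rewrite !mulr_ge0 ?exprn_ge0.
    rewrite mulr_sumr ler_sum// => m _; rewrite ncM.
    have mjn : (m <= j + n)%N by rewrite -ltnS.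
    rewrite (le_trans (ler_pM (nc_ge0 _) (nc_ge0 _) (IHi l li m) (gt _ _)))//.
    rewrite le_eqVlt; apply/orP; left; apply/eqP.
    have -> : c * t ^+ (i + j) * (3 * D) * D * p ^+ l * q ^+ m =
        (3 * D) * p ^+ l * q ^+ m * (c * D) * t ^+ (i + j) by ring.
    rewrite cD.
    have e1 : t ^+ n * t ^+ (i + j) = t ^+ (l + m) * t ^+ (i - l + (j + n - m)).
      rewrite -[LHS]exprD -[RHS]exprD; congr (_ ^+ _).
      by clear -li mjn; lia.
    transitivity (3 * D * p ^+ l * q ^+ m * t * (t ^+ n * t ^+ (i + j))); last by ring.
    by rewrite e1 /B; move: (t ^+ _) (t ^+ _) => a b; ring.
  apply: (@le_trans _ _ (\sum_(l < i) c * t ^+ (i + j) * (3 * D) * D *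
      (q ^+ (j + n).+1 / (q - 1)) * p ^+ l)).
    by apply: ler_sum => l _; exact: T.
  rewrite -mulr_sumr.
  rewrite (le_trans (ler_wpM2l _ (geometric_sum_le i p1)))//.
    by rewrite !mulr_ge0 ?exprn_ge0 ?invr_ge0 ?subr_ge0// ltW.
  rewrite le_eqVlt; apply/orP; left; apply/eqP.
  have -> : q ^+ (j + n).+1 = q ^+ j * q ^+ n.+1 by rewrite -exprD addnS.
  rewrite /P pE qE; have : q ^+ n.+1 != 0 by rewrite gt_eqF// exprn_gt0.
  move: (q ^+ n.+1) (p ^+ i) (q ^+ j) (t ^+ (i + j)) => a1 a2 a3 a4 a10.
  have D'' : D != 0 by rewrite gt_eqF.
  by field; rewrite a10 D''.
have S2b : nc S2 <= c * t ^+ (i + j) * (D * P).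
  rewrite (le_trans (nc_sum _ _ _))//.
  (* Indices m > j contribute nothing, since g(0, y) has order n; the others are covered by the
     inner induction. *)
  rewrite (bigID (fun m : 'I_(j + n).+1 => (m < j)%N)) /=.
  rewrite [X in _ + X]big1 ?addr0; last first.
    move=> m /andP[mj]; rewrite -leqNgt leq_eqVlt => /orP[/eqP jm|jm].
      by case/eqP: mj; apply: val_inj.
    rewrite ncM [X in _ * nc X](val_lt (f := g 0%N)) ?nc0 ?mulr0//.
    by rewrite -/n ltn_subLR ?ltn_add2r// -ltnS.
  rewrite [X in X <= _](_ : _ = \sum_(m < j) nc (k i m * g 0%N (j + n - m)%N)); last first.
    rewrite (eq_bigl (fun m : 'I_(j + n).+1 => (m < j)%N)); last first.
      move=> m /=; case: (ltnP m j) => mj; rewrite ?andbF// andbT.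
      by apply/eqP => /(congr1 (@nat_of_ord _)) /= mj'; rewrite mj' ltnn in mj.
    have jle : (j <= (j + n).+1)%N by rewrite ltnW.
    by rewrite (big_ord_narrow jle).
  have T m : (m < j)%N -> nc (k i m * g 0%N (j + n - m)%N) <=
      c * t ^+ (i + j) * (3 * D) * D * p ^+ i * q ^+ m.
    move=> mj; rewrite ncM.
    rewrite (le_trans (ler_pM (nc_ge0 _) (nc_ge0 _) (IHj m mj) (gt _ _)))//.
    rewrite le_eqVlt; apply/orP; left; apply/eqP.
    have -> : c * t ^+ (i + j) * (3 * D) * D * p ^+ i * q ^+ m =
        (3 * D) * p ^+ i * q ^+ m * (c * D) * t ^+ (i + j) by ring.
    rewrite cD.
    have e1 : t ^+ n * t ^+ (i + j) = t ^+ (i + m) * t ^+ (0 + (j + n - m)).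
      rewrite -[LHS]exprD -[RHS]exprD; congr (_ ^+ _).
      by clear -mj; lia.
    transitivity (3 * D * p ^+ i * q ^+ m * t * (t ^+ n * t ^+ (i + j))); last by ring.
    by rewrite e1 /B; move: (t ^+ _) (t ^+ _) => a b; ring.
  apply: (@le_trans _ _ (\sum_(m < j) c * t ^+ (i + j) * (3 * D) * D *
      p ^+ i * q ^+ m)).
    by apply: ler_sum => m _; exact: T.
  rewrite -mulr_sumr.
  rewrite (le_trans (ler_wpM2l _ (geometric_sum_le j q1)))//.
    by rewrite !mulr_ge0 ?exprn_ge0 ?invr_ge0 ?subr_ge0// ltW.
  rewrite le_eqVlt; apply/orP; left; apply/eqP.
  rewrite /P qE; move: (p ^+ i) (q ^+ j) (t ^+ (i + j)) => a2 a3 a4.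
  by field; rewrite gt_eqF.
have -> : B i j * nc (g 0%N n) = c * t ^+ (i + j) * (3 * (D * P)).
  by rewrite /B /c /P; ring.
have h1 : nc (h i (j + n)%N) <= c * t ^+ (i + j) * (D * P).
  rewrite (le_trans hb)// ler_wpM2l ?mulr_ge0 ?exprn_ge0//.
  by rewrite ler_peMr// ltW.
have := ncB (h i (j + n)%N) S1; lra.
Qed.

(** Powers of x are cancelled from g and h together until g(0, y) is nonzero. *)
Lemma convergent_quotient g h k : g != 0 -> convergent g -> convergent h ->
  h = k * g -> convergent k.
Proof.
have convS F : convergent F -> convergent (fps_shift F).
  move=> [M [t [t0 Ft]]]; exists (M * t), t; split => // i j.
  by rewrite -mulrA -exprS; exact: Ft.
have [n] := ubnP (fps_val g); elim: n g h => // n IH g h gn g0 cg ch hE.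
have [g00|g00] := eqVneq (g 0%N) 0; last exact: convergent_quotient_regular hE.
have gX := shiftK g00.
have s0 : fps_shift g != 0 by apply: contraNneq g0 => s0; rewrite gX s0 mulr0.
apply: (IH (fps_shift g) (fps_shift h)) => //; try exact: convS.
  move: (val_neq0 g0) gn; case: (fps_val g) => [|m]; first by rewrite g00 eqxx.
  move=> gm; rewrite !ltnS; apply: leq_ltn_trans; exact: val_le.
apply: fpsX_mulI; rewrite mulrCA -gX -hE -shiftK//.
by rewrite hE fps_mul0E g00 mulr0.
Qed.
End Convergent.

(** * Cauchy's theorem on squares *)

Section Contour.
Context {R : realType}.
Local Notation C := R[i].
Local Notation mu := (@lebesgue_measure R).
Implicit Types (u v f : C -> C) (z w : C).

Lemma gt0_complex (e : C) : 0 < e -> exists2 r : R, 0 < r & e = r%:C%C.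
Proof.
case: e => a b; rewrite ltcE /= => /andP[/eqP -> a0]; by exists a.
Qed.

Lemma nbhs_nc z (P : C -> Prop) :
  nbhs (z : C^o) P <-> exists2 d : R, 0 < d & forall w, nc (w - z) < d -> P w.
Proof.
split=> [/nbhs_normP[e /= /gt0_complex[r r0 ->] H]|[d d0 H]].
  by exists r => // w wr; apply: H; rewrite /= distrC norm_nc ltcR.
apply: (proj2 (nbhs_normP (z : C^o) P)).
exists d%:C%C; first by rewrite /= ltcR.
by move=> w /=; rewrite distrC norm_nc ltcR; exact: H.
Qed.

(* An inductive type, so that conversion never unfolds this convergence. *)
Variant contat u z : Prop :=
  Contat of (u : C^o -> C^o) w @[w --> (z : C^o)] --> (u z : C^o).

Lemma contatP u z : contat u z <-> forall e : R, 0 < e ->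
  exists2 d : R, 0 < d & forall w, nc (w - z) < d -> nc (u w - u z) < e.
Proof.
split=> [[/cvgrPdist_lt uz] e e0|H].
  have /uz : 0 < e%:C%C :> C by rewrite ltcR.
  move=> /nbhs_nc[d d0 H]; exists d => // w /H.
  by rewrite distrC norm_nc ltcR.
split; apply: (proj2 (@cvgrPdist_lt _ C^o _ (nbhs (z : C^o)) _ (u : C^o -> C^o) (u z))).
move=> _ /gt0_complex[e /H[d d0 ud] ->]; apply/nbhs_nc; exists d => // w /ud.
by rewrite distrC norm_nc ltcR.
Qed.

Lemma contat_cst c z : contat (fun=> c) z.
Proof. by split; apply: (@cvg_cst C^o); exact: nbhs_filter. Qed.
Lemma contat_id z : contat id z. Proof. by split; exact: cvg_id. Qed.
Lemma contatD u v z : contat u z -> contat v z -> contat (fun w => u w + v w) z.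
Proof. by move=> [cu] [cv]; split; exact: (@cvgD _ C^o _ _ _ _ _ _ _ cu cv). Qed.
Lemma contatB u v z : contat u z -> contat v z -> contat (fun w => u w - v w) z.
Proof. by move=> [cu] [cv]; split; exact: (@cvgB _ C^o _ _ _ _ _ _ _ cu cv). Qed.
Lemma contatM u v z : contat u z -> contat v z -> contat (fun w => u w * v w) z.
Proof. by move=> [cu] [cv]; split; exact: (@cvgM _ _ _ _ (u : C^o -> C^o) v _ _ cu cv). Qed.
Lemma contatV u z : u z != 0 -> contat u z -> contat (fun w => (u w)^-1) z.
Proof. by move=> u0 [cu]; split; exact: (@cvgV _ _ _ _ (u : C^o -> C^o) _ u0 cu). Qed.
Lemma contatX u n z : contat u z -> contat (fun w => u w ^+ n) z.
Proof.
move=> uz; elim: n => [|n IH]; first exact: contat_cst.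
rewrite (_ : (fun w => _) = fun w => u w * u w ^+ n); first exact: contatM.
by apply/funext => w; rewrite exprS.
Qed.
Lemma contat_sum n (F : 'I_n -> C -> C) z : (forall i, contat (F i) z) ->
  contat (fun w => \sum_i F i w) z.
Proof.
elim: n F => [|n IH] F cF.
  rewrite (_ : (fun w => _) = fun=> 0); first exact: contat_cst.
  by apply/funext => w; rewrite big_ord0.
rewrite (_ : (fun w => _) = fun w => F ord0 w + \sum_i F (lift ord0 i) w).
  by apply: contatD => //; apply: IH.
by apply/funext => w; rewrite big_ord_recl.
Qed.
Lemma contat_near u v z : (exists2 d : R, 0 < d &
  forall w, nc (w - z) < d -> u w = v w) -> contat u z -> contat v z.
Proof.
move=> [d d0 uv] /contatP uz; apply/contatP => e /uz[d' d'0 H].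
exists (Num.min d d'); first by rewrite lt_min d0.
move=> w; rewrite lt_min => /andP[wd wd'].
by rewrite -!uv ?subrr ?nc0//; exact: H.
Qed.

(* Caratheodory's formulation of complex differentiability. *)
Definition cdiff u z (A : C) := exists2 phi, contat phi z &
  phi z = A /\ forall w, u w - u z = phi w * (w - z).

Lemma cdiffP u z A : cdiff u z A <-> forall e : R, 0 < e ->
  exists2 d : R, 0 < d & forall w, nc (w - z) < d ->
    nc (u w - u z - A * (w - z)) <= e * nc (w - z).
Proof.
split=> [[phi /contatP cphi [phiz uE]] e /cphi[d d0 H]|H].
  exists d => // w wd; rewrite uE -phiz -mulrBl ncM ler_wpM2r ?nc_ge0//.
  exact/ltW/H.
exists (fun w => if w == z then A else (u w - u z) / (w - z)); last first.
  rewrite eqxx; split => // w; case: eqVneq => [->|wz]; first by rewrite !subrr mulr0.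
  by rewrite divfK// subr_eq0.
apply/contatP => e e0; have [|d d0 Hd] := H (e / 2); first by rewrite divr_gt0.
exists d => // w wd; rewrite eqxx; case: eqVneq => [_|wz].
  by rewrite subrr nc0.
have w0 : 0 < nc (w - z) by rewrite nc_gt0 subr_eq0.
rewrite -(ltr_pM2r w0) -ncM mulrBl divfK ?subr_eq0//.
rewrite (le_lt_trans (Hd _ wd))// ltr_pM2r//; lra.
Qed.

Lemma cdiff_contat u z A : cdiff u z A -> contat u z.
Proof.
move=> [phi cphi [_ uE]].
rewrite (_ : u = fun w => u z + phi w * (w - z)).
  apply: contatD; first exact: contat_cst.
  by apply: contatM => //; apply: contatB; [exact: contat_id|exact: contat_cst].
by apply/funext => w; rewrite -uE addrC subrK.
Qed.

Lemma cdiff_cst c z : cdiff (fun=> c) z 0.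
Proof.
by exists (fun=> 0); [exact: contat_cst|split=> // w; rewrite subrr mul0r].
Qed.
Lemma cdiff_id z : cdiff id z 1.
Proof. by exists (fun=> 1); [exact: contat_cst|split=> // w; rewrite mul1r]. Qed.
Lemma cdiffD u v z A B : cdiff u z A -> cdiff v z B ->
  cdiff (fun w => u w + v w) z (A + B).
Proof.
move=> [p cp [<- uE]] [q cq [<- vE]]; exists (fun w => p w + q w).
  exact: contatD.
by split=> // w; rewrite mulrDl -uE -vE; ring.
Qed.
Lemma cdiffM u v z A B : cdiff u z A -> cdiff v z B ->
  cdiff (fun w => u w * v w) z (A * v z + u z * B).
Proof.
move=> du; have cu := cdiff_contat du; move: du => [p cp [<- uE]] [q cq [<- vE]].
exists (fun w => p w * v z + u w * q w).
  by apply: contatD; apply: contatM => //; exact: contat_cst.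
split=> // w; rewrite mulrDl mulrAC -uE -mulrA -vE; ring.
Qed.
Lemma cdiffV u z A : u z != 0 -> cdiff u z A ->
  cdiff (fun w => (u w)^-1) z (- A / u z ^+ 2).
Proof.
move=> uz du; have cu := cdiff_contat du; move/contatP: (cu) => cu'.
have [d d0 ud] := cu' (nc (u z)) (ltac:(by rewrite nc_gt0)).
have u0 w : nc (w - z) < d -> u w != 0.
  move=> /ud uw; apply: contraTneq uw => ->.
  by rewrite sub0r ncN ltxx.
move: du => [p cp [<- uE]]; apply/cdiffP.
(* The factorization in [cdiff] is required at every w, but u may vanish far from z. Outside the
   disc the inverse is replaced by an expression that factors trivially; the epsilon form is
   insensitive to this change. *)
suff : cdiff (fun w => if nc (w - z) < d then (u w)^-1
    else (u z)^-1 - p w / (u z ^+ 2) * (w - z)) z (- p z / u z ^+ 2).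
  move=> /cdiffP H e /H[d' d'0 Hd']; exists (Num.min d d').
    by rewrite lt_min d0.
  move=> w; rewrite lt_min => /andP[wd /Hd'].
  by rewrite wd subrr nc0 d0.
exists (fun w => if nc (w - z) < d then - p w / (u w * u z) else - p w / u z ^+ 2).
  apply: (@contat_near (fun w => - p w / (u w * u z))).
    by exists d => // w ->.
  apply: contatM.
    rewrite (_ : (fun w => _) = (fun w => 0 - p w)).
      by apply: contatB => //; exact: contat_cst.
    by apply/funext => w; rewrite sub0r.
  apply: contatV; first by rewrite mulf_neq0.
  by apply: contatM => //; exact: contat_cst.
rewrite subrr nc0 d0 expr2; split => // w.
case: ifPn => wd; last by ring.
have -> : (u w)^-1 - (u z)^-1 = - (u w - u z) / (u w * u z).
  by field; rewrite uz u0.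
by rewrite uE; field; rewrite uz u0.
Qed.
End Contour.

(** * Complex integrals over real segments *)

Section ComplexIntegral.
Context {R : realType}.
Local Notation C := R[i].
Local Notation mu := (@lebesgue_measure R).
Local Notation Re := (@complex.Re R).
Local Notation Im := (@complex.Im R).
Implicit Types (u v : R -> C) (a b t : R).

Lemma ReD (z w : C) : Re (z + w) = Re z + Re w. Proof. by case: z; case: w. Qed.
Lemma ImD (z w : C) : Im (z + w) = Im z + Im w. Proof. by case: z; case: w. Qed.
Lemma ReN (z : C) : Re (- z) = - Re z. Proof. by case: z. Qed.
Lemma ImN (z : C) : Im (- z) = - Im z. Proof. by case: z. Qed.
Lemma ReM (z w : C) : Re (z * w) = Re z * Re w - Im z * Im w.
Proof. by case: z; case: w. Qed.
Lemma ImM (z w : C) : Im (z * w) = Re z * Im w + Im z * Re w.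
Proof. by case: z => a b; case: w => c d /=; rewrite [b * c]mulrC mulrC addrC. Qed.

Definition segment_cont a b u := forall t, a <= t <= b -> forall e : R, 0 < e ->
  exists2 d : R, 0 < d & forall s, `|s - t| < d -> nc (u s - u t) < e.

Definition cint a b u : C :=
  Complex (\int[mu]_(t in `[a, b]) Re (u t)) (\int[mu]_(t in `[a, b]) Im (u t)).

Let cont_within a b (f : R -> R) :
  (forall t, a <= t <= b -> forall e : R, 0 < e ->
    exists2 d : R, 0 < d & forall s, `|s - t| < d -> `|f s - f t| < e) ->
  {within `[a, b], continuous f}.
Proof.
move=> H; apply: continuous_in_subspaceT => t /set_mem /=; rewrite in_itv /= => tab.
apply/(@cvgrPdist_lt _ R^o) => e e0; have [d d0 Hd] := H t tab e e0.
apply/nbhs_normP; exists d => //= s /= ts; rewrite distrC.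
by apply: Hd; rewrite distrC.
Qed.

Lemma segment_cont_Re a b u : segment_cont a b u ->
  {within `[a, b], continuous (fun t => Re (u t))}.
Proof.
move=> cu; apply: cont_within => t tab e e0; have [d d0 H] := cu t tab e e0.
exists d => // s /H; apply: le_lt_trans.
by rewrite -ReN -ReD nc_Re.
Qed.

Lemma segment_cont_Im a b u : segment_cont a b u ->
  {within `[a, b], continuous (fun t => Im (u t))}.
Proof.
move=> cu; apply: cont_within => t tab e e0; have [d d0 H] := cu t tab e e0.
exists d => // s /H; apply: le_lt_trans.
by rewrite -ImN -ImD nc_Im.
Qed.

Let integ a b (f : R -> R) : {within `[a, b], continuous f} ->
  mu.-integrable `[a, b] (EFin \o f).
Proof. by apply: continuous_compact_integrable; exact: segment_compact. Qed.

Let mitv a b : measurable (`[a, b] : set (measurableTypeR R)).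
Proof. exact: measurable_itv. Qed.

Lemma eq_cint a b u v : (forall t, a <= t <= b -> u t = v t) ->
  cint a b u = cint a b v.
Proof.
move=> uv; rewrite /cint; congr Complex; apply: eq_Rintegral => t /set_mem/=;
  by rewrite in_itv /= => /uv ->.
Qed.

Lemma cintD a b u v : segment_cont a b u -> segment_cont a b v ->
  cint a b (fun t => u t + v t) = cint a b u + cint a b v.
Proof.
move=> cu cv; rewrite [RHS](_ : _ = Complex
  (\int[mu]_(t in `[a, b]) Re (u t) + \int[mu]_(t in `[a, b]) Re (v t))
  (\int[mu]_(t in `[a, b]) Im (u t) + \int[mu]_(t in `[a, b]) Im (v t)))//.
have iR w (cw : segment_cont a b w) := integ (segment_cont_Re cw).
have iI w (cw : segment_cont a b w) := integ (segment_cont_Im cw).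
rewrite -!RintegralD//; try exact: iR; try exact: iI.
by rewrite /cint; congr Complex; apply: eq_Rintegral => t _; rewrite ?ReD ?ImD.
Qed.

Lemma cintZ a b c u : segment_cont a b u ->
  cint a b (fun t => c * u t) = c * cint a b u.
Proof.
move=> cu; case: c => x y; rewrite [RHS](_ : _ = Complex
  (x * \int[mu]_(t in `[a, b]) Re (u t) - y * \int[mu]_(t in `[a, b]) Im (u t))
  (x * \int[mu]_(t in `[a, b]) Im (u t) + y * \int[mu]_(t in `[a, b]) Re (u t)))//.
have iR := integ (segment_cont_Re cu); have iI := integ (segment_cont_Im cu).
have iz (f : R -> R) r : mu.-integrable `[a, b] (EFin \o f) ->
    mu.-integrable `[a, b] (EFin \o (fun t => r * f t)).
  by move=> fi; have := @integrableZl _ _ _ mu _ (mitv a b) r _ fi.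
rewrite -!RintegralZl// -RintegralB ?iz// -RintegralD ?iz//.
by rewrite /cint; congr Complex; apply: eq_Rintegral => t _; rewrite ?ReM ?ImM.
Qed.

Let rint_bound a b (f : R -> R) (M : R) : a <= b -> {within `[a, b], continuous f} ->
  (forall t, a <= t <= b -> `|f t| <= M) ->
  `|\int[mu]_(t in `[a, b]) f t| <= M * (b - a).
Proof.
move=> ab cf fM; have fi := integ cf.
rewrite (le_trans (le_normr_Rintegral (mitv a b) fi))//.
have -> : M * (b - a) = \int[mu]_(t in `[a, b]) M.
  rewrite Rintegral_cst; last exact: mitv.
  have -> : fine (mu `[a, b]) = b - a; last by [].
  by rewrite lebesgue_measure_itv /= lte_fin; case: ltgtP ab => // -> _;
    rewrite subrr.
apply: le_Rintegral; first exact: mitv.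
- exact: integrable_norm fi.
- by apply: integ; apply: cst_continuous.
- by move=> t /=; rewrite in_itv /=; exact: fM.
Qed.

(** The factor 2 comes from bounding real and imaginary parts separately. *)
Lemma cint_bound a b u (M : R) : a <= b -> segment_cont a b u ->
  (forall t, a <= t <= b -> nc (u t) <= M) -> nc (cint a b u) <= 2 * M * (b - a).
Proof.
move=> ab cu uM; rewrite (le_trans (nc_ReIm _))// -mulrA mulr_natl mulr2n lerD//.
  apply: (rint_bound ab (segment_cont_Re cu)) => t /uM.
  by apply: le_trans; exact: nc_Re.
apply: (rint_bound ab (segment_cont_Im cu)) => t /uM.
by apply: le_trans; exact: nc_Im.
Qed.

Lemma cint_split a m b u : a <= m <= b -> segment_cont a b u ->
  cint a b u = cint a m u + cint m b u.
Proof.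
move=> /andP[am mb] cu.
have rs (f : R -> R) : {within `[a, b], continuous f} ->
    \int[mu]_(t in `[a, b]) f t =
    \int[mu]_(t in `[a, m]) f t + \int[mu]_(t in `[m, b]) f t.
  move=> /integ fi; rewrite -(@Rintegral_itv_obnd_cbnd _ m).
    by rewrite -(@Rintegral_itvB _ f (BLeft a) (BRight b) m) ?bnd_simp// addrC subrK.
  apply: integrableS fi => //=; try exact: measurable_itv.
  by apply: subset_itvr; rewrite bnd_simp.
by rewrite /cint !rs//; [exact: segment_cont_Im|exact: segment_cont_Re].
Qed.

Lemma cint_FTC a b u U : a < b -> segment_cont a b u ->
  (forall t, a <= t <= b -> forall e : R, 0 < e -> exists2 d : R, 0 < d &
     forall s, `|s - t| < d ->
       nc (U s - U t - (s - t)%:C%C * u t) <= e * `|s - t|) ->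
  cint a b u = U b - U a.
Proof.
move=> ab cu dU.
have ftc (f F : R -> R) : {within `[a, b], continuous f} ->
    (forall t, a <= t <= b -> forall e : R, 0 < e -> exists2 d : R, 0 < d &
       forall s, `|s - t| < d -> `|F s - F t - (s - t) * f t| <= e * `|s - t|) ->
    \int[mu]_(t in `[a, b]) f t = F b - F a.
  move=> cf dF.
  have isd t : a <= t <= b -> is_derive t (1 : R) F (f t).
    move=> tab.
    have L : (fun h : R => h^-1 *: ((F \o shift t) (h *: 1) - F t)) @ 0^' --> (f t : R^o).
      apply/(@cvgrPdist_le _ R^o) => e e0; have [d d0 H] := dF t tab e e0.
      apply/nbhs_normP; exists d => //= h /= hd h0.
      rewrite sub0r normrN in hd.
      have := H (h + t); rewrite addrK => /(_ hd) {}H.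
      have hn : 0 < `|h| by rewrite normr_gt0.
      rewrite -(ler_pM2l hn) -normrM mulrBr [`|h| * e]mulrC (le_trans _ H)//.
      rewrite [h *: 1]mulr1 [_ *: _]/(_ * _) mulrA divff// mul1r distrC.
      by rewrite [h + t]addrC.
    by split; [apply/cvg_ex; exists (f t)|exact: cvg_lim].
  have cF t : a <= t <= b -> {for t, continuous F}.
    move=> /isd d; apply: differentiable_continuous.
    by apply/derivable1_diffP; exact: ex_derive.
  have := @continuous_FTC2 R f F a b ab cf; rewrite /Rintegral => -> //.
    split=> [t||].
    - by rewrite in_itv /= => /andP[/ltW at_ /ltW tb]; have [] := isd t;
        rewrite ?at_ ?tb.
    - by apply: cvg_at_right_filter; apply: cF; rewrite lexx ltW.
    - by apply: cvg_at_left_filter; apply: cF; rewrite lexx ltW.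
  move=> t; rewrite in_itv /= => /andP[/ltW at_ /ltW tb].
  by rewrite derive1E; have [_ ->] := isd t (ltac:(by rewrite at_ tb)).
rewrite /cint (ftc (fun t => Re (u t)) (fun t => Re (U t))); last 2 first.
- exact: segment_cont_Re.
- move=> t tab e e0; have [d d0 H] := dU t tab e e0; exists d => // s /H.
  apply: le_trans; apply: le_trans (nc_Re _).
  by rewrite !ReD !ReN ReM /= mul0r subr0.
rewrite (ftc (fun t => Im (u t)) (fun t => Im (U t))); last 2 first.
- exact: segment_cont_Im.
- move=> t tab e e0; have [d d0 H] := dU t tab e e0; exists d => // s /H.
  apply: le_trans; apply: le_trans (nc_Im _).
  by rewrite !ImD !ImN ImM /= mul0r addr0.
by rewrite -!ReN -!ImN -ReD -ImD; case: (U b - U a).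
Qed.
End ComplexIntegral.

(** * Integrals over boundaries of rectangles *)

Section Goursat.
Context {R : realType}.
Local Notation C := R[i].
Local Notation Re := (@complex.Re R).
Local Notation Im := (@complex.Im R).
Implicit Types (u v : C -> C) (a b c d x y s t : R) (z w : C).

Definition on_rect a b c d z :=
  [/\ a <= Re z <= b, c <= Im z <= d &
      [\/ Re z = a, Re z = b, Im z = c | Im z = d]].

Definition hor u y a b := cint a b (fun t => u (Complex t y)).
Definition ver u x c d := cint c d (fun t => u (Complex x t)).

(** The boundary is run counterclockwise; the factor i is dz = i dt on the vertical sides. *)
Definition rect_int u a b c d : C :=
  hor u c a b - hor u d a b + Complex 0 1 * (ver u b c d - ver u a c d).

Let hor_sub y s t : Complex s y - Complex t y = (s - t)%:C%C.
Proof. by apply/eqP; rewrite eq_complex /= subrr !eqxx. Qed.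

Let ver_sub x s t : Complex x s - Complex x t = Complex 0 1 * (s - t)%:C%C.
Proof.
by apply/eqP; rewrite eq_complex /=; apply/andP; split; apply/eqP; ring.
Qed.

Let nc_i : nc (Complex 0 1 : C) = 1.
Proof. by rewrite /nc /= expr0n expr1n add0r sqrtr1. Qed.

Lemma segment_cont_hor u a b y :
  (forall t, a <= t <= b -> contat u (Complex t y)) ->
  segment_cont a b (fun t => u (Complex t y)).
Proof.
move=> cu t tab e e0; have /contatP/(_ e e0)[d d0 H] := cu t tab.
exists d => // r rd; apply: H.
by rewrite hor_sub nc_real.
Qed.

Lemma segment_cont_ver u c d x :
  (forall t, c <= t <= d -> contat u (Complex x t)) ->
  segment_cont c d (fun t => u (Complex x t)).
Proof.
move=> cu t tab e e0; have /contatP/(_ e e0)[r r0 H] := cu t tab.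
exists r => // q qr; apply: H.
by rewrite ver_sub ncM nc_real nc_i mul1r.
Qed.

Section Sides.
Variables a b c d : R.
Hypotheses (ab : a <= b) (cd : c <= d).

Definition rect_cont u := forall z, on_rect a b c d z -> contat u z.

Let on_c t : a <= t <= b -> on_rect a b c d (Complex t c).
Proof. by move=> tab; split; rewrite /= ?lexx//; constructor 3. Qed.
Let on_d t : a <= t <= b -> on_rect a b c d (Complex t d).
Proof. by move=> tab; split; rewrite /= ?lexx ?cd//; constructor 4. Qed.
Let on_a t : c <= t <= d -> on_rect a b c d (Complex a t).
Proof. by move=> tab; split; rewrite /= ?lexx//; constructor 1. Qed.
Let on_b t : c <= t <= d -> on_rect a b c d (Complex b t).
Proof. by move=> tab; split; rewrite /= ?lexx ?ab//; constructor 2. Qed.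

Lemma eq_rect_int u v : (forall z, on_rect a b c d z -> u z = v z) ->
  rect_int u a b c d = rect_int v a b c d.
Proof.
move=> uv; rewrite /rect_int /hor /ver.
congr (_ - _ + _ * (_ - _)); apply: eq_cint => t.
- by move=> /on_c/uv.
- by move=> /on_d/uv.
- by move=> /on_b/uv.
- by move=> /on_a/uv.
Qed.

Lemma rect_intD u v : rect_cont u -> rect_cont v ->
  rect_int (fun z => u z + v z) a b c d = rect_int u a b c d + rect_int v a b c d.
Proof.
move=> cu cv; rewrite /rect_int /hor /ver.
rewrite !cintD; first ring.
all: by (apply: segment_cont_hor || apply: segment_cont_ver) => t tab;
  (apply: cu || apply: cv); (exact: on_a || exact: on_b || exact: on_c || exact: on_d).
Qed.

Lemma rect_intZ k u : rect_cont u ->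
  rect_int (fun z => k * u z) a b c d = k * rect_int u a b c d.
Proof.
move=> cu; rewrite /rect_int /hor /ver.
rewrite !cintZ; first ring.
all: by (apply: segment_cont_hor || apply: segment_cont_ver) => t tab;
  apply: cu; (exact: on_a || exact: on_b || exact: on_c || exact: on_d).
Qed.

Lemma rect_int_bound u (M : R) : rect_cont u ->
  (forall z, on_rect a b c d z -> nc (u z) <= M) ->
  nc (rect_int u a b c d) <= 4 * M * ((b - a) + (d - c)).
Proof.
move=> cu uM; rewrite /rect_int (le_trans (ncD _ _))// ncM nc_i.
have Hc : nc (hor u c a b) <= 2 * M * (b - a).
  by apply: cint_bound => // [|t /on_c/uM//]; apply: segment_cont_hor => t /on_c/cu.
have Hd : nc (hor u d a b) <= 2 * M * (b - a).
  by apply: cint_bound => // [|t /on_d/uM//]; apply: segment_cont_hor => t /on_d/cu.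
have Ha : nc (ver u a c d) <= 2 * M * (d - c).
  by apply: cint_bound => // [|t /on_a/uM//]; apply: segment_cont_ver => t /on_a/cu.
have Hb : nc (ver u b c d) <= 2 * M * (d - c).
  by apply: cint_bound => // [|t /on_b/uM//]; apply: segment_cont_ver => t /on_b/cu.
have := ncB (hor u c a b) (hor u d a b).
have := ncB (ver u b c d) (ver u a c d).
lra.
Qed.

Lemma rect_int_primitive u v : a < b -> c < d -> rect_cont u ->
  (forall z, on_rect a b c d z -> cdiff v z (u z)) -> rect_int u a b c d = 0.
Proof.
move=> ab' cd' cu dv.
have H y : (forall t, a <= t <= b -> on_rect a b c d (Complex t y)) ->
    hor u y a b = v (Complex b y) - v (Complex a y).
  move=> ony; apply: (@cint_FTC _ _ _ _ (fun t => v (Complex t y))) => //.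
    by apply: segment_cont_hor => t /ony/cu.
  move=> t /ony/dv/cdiffP dvt e /dvt[r r0 {}H]; exists r => // q qr.
  by have := H (Complex q y); rewrite hor_sub nc_real => /(_ qr); rewrite mulrC.
have V x : (forall t, c <= t <= d -> on_rect a b c d (Complex x t)) ->
    Complex 0 1 * ver u x c d = v (Complex x d) - v (Complex x c).
  move=> onx; rewrite -cintZ; last by apply: segment_cont_ver => t /onx/cu.
  apply: (@cint_FTC _ _ _ _ (fun t => v (Complex x t))) => //.
    have /segment_cont_ver : forall t, c <= t <= d ->
        contat (fun z => Complex 0 1 * u z) (Complex x t).
      by move=> t /onx/cu; apply: contatM; exact: contat_cst.
    exact.
  move=> t /onx/dv/cdiffP dvt e /dvt[r r0 {}H]; exists r => // q qr.
  have := H (Complex x q); rewrite ver_sub ncM nc_real nc_i mul1r => /(_ qr).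
  by rewrite [u _ * _]mulrC -mulrA mulrCA.
rewrite /rect_int mulrBr V; last exact: on_b.
rewrite V; last exact: on_a.
rewrite H; last exact: on_c.
rewrite H; last exact: on_d.
ring.
Qed.

End Sides.

Lemma rect_int_split a m b c n d u : a <= m <= b -> c <= n <= d ->
  (forall x y, a <= x <= b -> c <= y <= d -> contat u (Complex x y)) ->
  rect_int u a b c d = rect_int u a m c n + rect_int u m b c n +
    (rect_int u a m n d + rect_int u m b n d).
Proof.
move=> amb cnd cu; have /andP[am mb] := amb; have /andP[cn nd] := cnd.
have H y : c <= y <= d -> hor u y a b = hor u y a m + hor u y m b.
  move=> yy; apply: cint_split => //; apply: segment_cont_hor => t tt.
  exact: cu.
have V x : a <= x <= b -> ver u x c d = ver u x c n + ver u x n d.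
  move=> xx; apply: cint_split => //; apply: segment_cont_ver => t tt.
  exact: cu.
have ca : a <= a <= b by rewrite lexx (le_trans am).
have cb : a <= b <= b by rewrite lexx (le_trans am).
have cc : c <= c <= d by rewrite lexx (le_trans cn).
have cd : c <= d <= d by rewrite lexx (le_trans cn).
by rewrite /rect_int (H c)// (H d)// (V a)// (V b)//; ring.
Qed.
End Goursat.

(** * Goursat's theorem by subdivision *)

Section GoursatTheorem.
Context {R : realType}.
Local Notation C := R[i].
Local Notation Re := (@complex.Re R).
Local Notation Im := (@complex.Im R).
Implicit Types (u v : C -> C) (a b c d x y s t : R) (z w : C).

Definition square_int u x y s := rect_int u x (x + s) y (y + s).
Definition on_square x y s z := x <= Re z <= x + s /\ y <= Im z <= y + s.

Lemma on_rect_square x y s z : on_rect x (x + s) y (y + s) z -> on_square x y s z.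
Proof. by case. Qed.

Lemma square_int_split u x y s : 0 <= s ->
  (forall z, on_square x y s z -> contat u z) ->
  let h := s / 2 in
  square_int u x y s = square_int u x y h + square_int u (x + h) y h +
    (square_int u x (y + h) h + square_int u (x + h) (y + h) h).
Proof.
move=> s0 cu h; have hE : h = s / 2 by [].
rewrite /square_int (@rect_int_split _ x (x + h) (x + s) y (y + h) (y + s)); last first.
- by move=> x' y' xx yy; apply: cu.
- by apply/andP; lra.
- by apply/andP; lra.
have -> : x + h + h = x + s by lra.
by have -> : y + h + h = y + s by lra.
Qed.

(* The fraction of the direction circle at [a] that points into [x, x + s]:
   unlike an indicator function, it is additive under subdivision. *)
Definition weight x s a : R := (Num.sg (x + s - a) - Num.sg (x - a)) / 2.

Lemma weight_ge0 x s a : 0 <= s -> 0 <= weight x s a.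
Proof.
move=> s0; rewrite /weight divr_ge0// subr_ge0.
case: (sgrP (x + s - a)) => [E|E|E]; case: (sgrP (x - a)) => [F|F|F] //;
  rewrite ?lerN10 ?lexx ?ler01//; lra.
Qed.

Lemma weight_ge x s a : 0 < s -> x <= a <= x + s -> 1 / 2 <= weight x s a.
Proof.
move=> s0 /andP[xa axs]; rewrite /weight ler_pM2r ?invr_gt0//.
case: (sgrP (x + s - a)) => [E|E|E]; case: (sgrP (x - a)) => [F|F|F]; lra.
Qed.

Lemma weight_split x s a :
  weight x s a = weight x (s / 2) a + weight (x + s / 2) (s / 2) a.
Proof.
rewrite /weight (_ : x + s / 2 + s / 2 = x + s); last by lra.
by lra.
Qed.

Lemma nested_intervals (x s : nat -> R) : (forall n, x n <= x n.+1) ->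
  (forall n, x n.+1 + s n.+1 <= x n + s n) -> (forall n, 0 <= s n) ->
  exists p, forall n, x n <= p <= x n + s n.
Proof.
move=> x1 xs1 s0.
have xmono m n : (m <= n)%N -> x m <= x n.
  by move=> /subnK <-; elim: (n - m)%N => // k IH; rewrite addSn (le_trans IH).
have xsmono m n : (m <= n)%N -> x n + s n <= x m + s m.
  by move=> /subnK <-; elim: (n - m)%N => // k IH; rewrite addSn (le_trans _ IH).
have ub m n : x m <= x n + s n.
  have [mn|/ltnW nm] := leqP m n.
    by rewrite (le_trans (xmono _ _ mn))// lerDl.
  by rewrite (le_trans _ (xsmono _ _ nm))// lerDl.
have hs : has_sup (range x).
  by split; [exists (x 0%N), 0%N|exists (x 0%N + s 0%N) => _ [m _ <-]].
exists (sup (range x)) => n; apply/andP; split.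
  by apply: sup_upper_bound => //; exists n.
by apply: ge_sup => [|_ [m _ <-]//]; case: hs.
Qed.

Lemma half_pow_lt (s e : R) : 0 <= s -> 0 < e -> exists n, s / 2 ^+ n < e.
Proof.
move=> s0 e0; exists (Num.trunc (s / e)).+1; rewrite ltr_pdivrMr ?exprn_gt0//.
rewrite mulrC -ltr_pdivrMr//.
rewrite (lt_le_trans (truncnS_gt _))//.
by rewrite -natrX ler_nat ltnW// ltn_expl.
Qed.

(* The point [z0] costs only a bounded oscillation because its share of [gauge]
   does not shrink with the square. *)
Definition gauge z0 x y s : R := s ^+ 2 + weight x s (Re z0) * weight y s (Im z0).

(** An integral exceeding e times the gauge passes to one of the four quarters, since both are
    additive; the nested squares shrink to a point p. If p differs from z0, differentiability
    contradicts the term s^2 of the gauge; if p = z0, continuity suffices, since the weights keep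
    the gauge above 1/4. The exceptional point is there for difference quotients. *)
Lemma goursat u z0 x y s : 0 < s ->
  (forall z, on_square x y s z -> contat u z) ->
  (forall z, on_square x y s z -> z != z0 -> exists A, cdiff u z A) ->
  square_int u x y s = 0.
Proof.
move=> s0 cu du.
suff H e : 0 < e -> nc (square_int u x y s) <= e * gauge z0 x y s.
  have g0 : 0 < gauge z0 x y s.
    by rewrite ltr_pwDl ?exprn_gt0// mulr_ge0 ?weight_ge0 ?ltW.
  apply: nc_eps => e e0; rewrite -[e](divfK (lt0r_neq0 g0)).
  by apply: H; rewrite divr_gt0.
move=> e0; rewrite leNgt; apply/negP => bad0.
pose r n := s / 2 ^+ n.
have r0 n : 0 < r n by rewrite divr_gt0 ?exprn_gt0.
have rS n : r n.+1 = r n / 2 by rewrite /r exprSr invfM mulrA.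
pose bad n (p : R * R) := [/\ x <= p.1, p.1 + r n <= x + s, y <= p.2,
  p.2 + r n <= y + s & e * gauge z0 p.1 p.2 (r n) < nc (square_int u p.1 p.2 (r n))].
have in0 n p z : bad n p -> on_square p.1 p.2 (r n) z -> on_square x y s z.
  by move=> [? ? ? ? _] [/andP[? ?] /andP[? ?]]; split; apply/andP; lra.
have step n p : exists p', bad n p -> bad n.+1 p' /\
    [/\ p.1 <= p'.1, p'.1 + r n.+1 <= p.1 + r n, p.2 <= p'.2 &
        p'.2 + r n.+1 <= p.2 + r n].
  have [badn|] := pselect (bad n p); last by exists p.
  have h0 := r0 n; have hS := rS n.
  suff [p' [H1 H2 H3 H4 H5]] : exists p' : R * R,
      [/\ p.1 <= p'.1, p'.1 + r n.+1 <= p.1 + r n, p.2 <= p'.2,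
        p'.2 + r n.+1 <= p.2 + r n & e * gauge z0 p'.1 p'.2 (r n.+1) <
        nc (square_int u p'.1 p'.2 (r n.+1))].
    by exists p' => _; move: badn => [? ? ? ? _]; do !split => //; lra.
  apply: contrapT => no.
  have good a b : (a = 0 \/ a = r n / 2) -> (b = 0 \/ b = r n / 2) ->
      nc (square_int u (p.1 + a) (p.2 + b) (r n / 2)) <=
      e * gauge z0 (p.1 + a) (p.2 + b) (r n / 2).
    move=> aE bE; rewrite leNgt; apply/negP => bad1; apply: no.
    exists (p.1 + a, p.2 + b); rewrite /= hS.
    by case: aE bE bad1 => -> [] -> ?; split => //; lra.
  have [_ _ _ _ blt] := badn; suff : nc (square_int u p.1 p.2 (r n)) <=
      e * gauge z0 p.1 p.2 (r n) by rewrite leNgt blt.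
  rewrite (square_int_split (ltW h0)); last by move=> z /(in0 _ _ _ badn)/cu.
  have g00 := good 0 0 (or_introl erefl) (or_introl erefl).
  have g10 := good (r n / 2) 0 (or_intror erefl) (or_introl erefl).
  have g01 := good 0 (r n / 2) (or_introl erefl) (or_intror erefl).
  have g11 := good (r n / 2) (r n / 2) (or_intror erefl) (or_intror erefl).
  rewrite !addr0 in g00 g10 g01 g11.
  have gE : gauge z0 p.1 p.2 (r n) =
      gauge z0 p.1 p.2 (r n / 2) + gauge z0 (p.1 + r n / 2) p.2 (r n / 2) +
      (gauge z0 p.1 (p.2 + r n / 2) (r n / 2) +
       gauge z0 (p.1 + r n / 2) (p.2 + r n / 2) (r n / 2)).
    rewrite /gauge (weight_split p.1) (weight_split p.2).
    move: (weight _ _ _) (weight _ _ _) (weight _ _ _) (weight _ _ _) => w1 w2 w3 w4.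
    by field.
  have le4 (z1 z2 z3 z4 : C) (M1 M2 M3 M4 : R) : nc z1 <= e * M1 ->
      nc z2 <= e * M2 -> nc z3 <= e * M3 -> nc z4 <= e * M4 ->
      nc (z1 + z2 + (z3 + z4)) <= e * (M1 + M2 + (M3 + M4)).
    have := ncD (z1 + z2) (z3 + z4); have := ncD z1 z2; have := ncD z3 z4; lra.
  rewrite gE; exact: (le4 _ _ _ _ _ _ _ _ g00 g10 g01 g11).
have /choice[f fP] : forall np : nat * (R * R), exists p', bad np.1 np.2 ->
    bad np.1.+1 p' /\ [/\ np.2.1 <= p'.1, p'.1 + r np.1.+1 <= np.2.1 + r np.1,
     np.2.2 <= p'.2 & p'.2 + r np.1.+1 <= np.2.2 + r np.1].
  by move=> [n p]; exact: step.
pose P := fix P n := if n is m.+1 then f (m, P m) else (x, y).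
have badP n : bad n (P n).
  elim: n => [|n IH]; last by have [] := fP (n, P n) IH.
  by split; rewrite /= /r ?expr0 ?divr1 ?lexx.
have PP n : [/\ (P n).1 <= (P n.+1).1, (P n.+1).1 + r n.+1 <= (P n).1 + r n,
     (P n).2 <= (P n.+1).2 & (P n.+1).2 + r n.+1 <= (P n).2 + r n].
  by have [] := fP (n, P n) (badP n).
have [px pxP] := @nested_intervals (fun n => (P n).1) r
  (fun n => let: And4 h _ _ _ := PP n in h)
  (fun n => let: And4 _ h _ _ := PP n in h) (fun n => ltW (r0 n)).
have [py pyP] := @nested_intervals (fun n => (P n).2) r
  (fun n => let: And4 _ _ h _ := PP n in h)
  (fun n => let: And4 _ _ _ h := PP n in h) (fun n => ltW (r0 n)).
pose p : C := Complex px py.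
have pin n : on_square (P n).1 (P n).2 (r n) p by split; [exact: pxP|exact: pyP].
have cont_n n z : on_square (P n).1 (P n).2 (r n) z -> contat u z.
  by move=> /(in0 _ _ _ (badP n))/cu.
have dist n z : on_square (P n).1 (P n).2 (r n) z -> nc (z - p) <= 2 * r n.
  have /andP[? ?] := pxP n; have /andP[? ?] := pyP n.
  move=> [/andP[? ?] /andP[? ?]]; rewrite (le_trans (nc_ReIm _))//.
  rewrite mulr_natl mulr2n !ReD !ImD !ReN !ImN.
  have -> : Re p = px by []. have -> : Im p = py by [].
  by rewrite lerD// ler_norml; apply/andP; split; lra.
have ctr n : (P n).1 <= (P n).1 + r n by rewrite lerDl ltW.
have ctr2 n : (P n).2 <= (P n).2 + r n by rewrite lerDl ltW.
have sm n : r n = ((P n).1 + r n) - (P n).1 by rewrite addrC addKr.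
have [pz|pz] := eqVneq p z0.
  have /contatP/(_ 1 ltr01)[d d0 Hd] : contat u p by exact: cont_n (pin 0%N).
  (* Points of the n-th square are within 2 r_n of p, so u - u(p) is below 1 there and its integral
     is at most 8 r_n, less than e/8, while e times the gauge is at least e/4. *)
  have m0 : 0 < Num.min (d / 2) (e / 64) by rewrite lt_min !divr_gt0.
  have [n] := half_pow_lt (ltW s0) m0; rewrite -/(r n) lt_min => /andP[nd ne].
  have [_ _ _ _ blt] := badP n; suff : nc (square_int u (P n).1 (P n).2 (r n)) <=
      e * gauge z0 (P n).1 (P n).2 (r n) by rewrite leNgt blt.
  have Z : rect_int (fun=> - u p) (P n).1 ((P n).1 + r n) (P n).2 ((P n).2 + r n) = 0.
    apply: (@rect_int_primitive _ _ _ _ _ (ctr n) (ctr2 n) _ (fun z => - u p * z));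
      rewrite ?ltrDl//; first by move=> z _; exact: contat_cst.
    move=> z _; have := cdiffM (cdiff_cst (- u p) z) (cdiff_id z).
    by rewrite mul0r add0r mulr1.
  rewrite /square_int -[rect_int _ _ _ _ _]addr0 -Z -rect_intD//; last 2 first.
  - by move=> z /on_rect_square; exact: cont_n.
  - by move=> z _; exact: contat_cst.
  apply: (@le_trans _ _ (4 * 1 * (r n + r n))).
    rewrite {3 4}[r n](_ : _ = (P n).1 + r n - (P n).1)//.
    rewrite [X in _ <= _ * (_ + X)](_ : _ = (P n).2 + r n - (P n).2); last by lra.
    apply: rect_int_bound => //.
      move=> z /on_rect_square oz; apply: contatD; last exact: contat_cst.
      exact: cont_n oz.
    move=> z /on_rect_square/dist zp; apply/ltW/Hd; apply: le_lt_trans zp _.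
    lra.
  have wx := @weight_ge (P n).1 (r n) px (r0 n) (pxP n).
  have wy := @weight_ge (P n).2 (r n) py (r0 n) (pyP n).
  apply: (@le_trans _ _ (e * (1 / 2 * (1 / 2)))); first lra.
  apply: ler_wpM2l; first exact: ltW.
  rewrite /gauge -pz.
  apply: (@le_trans _ _ (weight (P n).1 (r n) px * weight (P n).2 (r n) py)).
    by apply: ler_pM => //; lra.
  by rewrite lerDr exprn_ge0// ltW.
have [A /cdiffP dA] : exists A, cdiff u p A.
  by apply: du => //; exact: in0 (badP 0%N) (pin 0%N).
(* With this slope the bound becomes 4 (e/32) (2 r_n) (2 r_n), half of e r_n^2. *)
have e'0 : 0 < e / 32 by rewrite divr_gt0.
have [d d0 Hd] := dA (e / 32) e'0.
have d2 : 0 < d / 2 by rewrite divr_gt0.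
have [n] := half_pow_lt (ltW s0) d2; rewrite -/(r n) => nd.
have [_ _ _ _ blt] := badP n; suff : nc (square_int u (P n).1 (P n).2 (r n)) <=
    e * gauge z0 (P n).1 (P n).2 (r n) by rewrite leNgt blt.
(* Minus the affine approximation of u at p: it has a primitive, so adding it leaves the integral
   unchanged. *)
pose aff z := - u p - A * (z - p).
have caff z : contat aff z.
  apply: contatB; first exact: contat_cst.
  apply: contatM; first exact: contat_cst.
  by apply: contatB; [exact: contat_id|exact: contat_cst].
have Z : rect_int aff (P n).1 ((P n).1 + r n) (P n).2 ((P n).2 + r n) = 0.
  apply: (@rect_int_primitive _ _ _ _ _ (ctr n) (ctr2 n) _
    (fun z => z * (- u p) + (- A / 2) * ((z - p) * (z - p)))); rewrite ?ltrDl//.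
  move=> z _; have dp : cdiff (fun z => z - p) z (1 + 0).
    by apply: cdiffD; [exact: cdiff_id|exact: cdiff_cst].
  have := cdiffD (cdiffM (cdiff_id z) (cdiff_cst (- u p) z))
    (cdiffM (cdiff_cst (- A / 2) z) (cdiffM dp dp)).
  congr cdiff; rewrite /aff.
  have two : (2 : C) != 0 by rewrite pnatr_eq0.
  by field.
rewrite /square_int -[rect_int _ _ _ _ _]addr0 -Z -rect_intD//; last first.
  by move=> z /on_rect_square; exact: cont_n.
apply: (@le_trans _ _ (4 * (e / 32 * (2 * r n)) * (r n + r n))).
  rewrite {4 5}[r n](_ : _ = (P n).1 + r n - (P n).1)//.
  rewrite [X in _ <= _ * (_ + X)](_ : _ = (P n).2 + r n - (P n).2); last by lra.
  apply: rect_int_bound => //.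
    by move=> z /on_rect_square oz; apply: contatD => //; exact: cont_n oz.
  move=> z /on_rect_square/dist zp; rewrite /aff addrA.
  apply: le_trans (Hd _ _) _; first by apply: le_lt_trans zp _; lra.
  by rewrite ler_wpM2l// ltW.
have gw : 0 <= e * (weight (P n).1 (r n) (Re z0) * weight (P n).2 (r n) (Im z0)).
  by apply: mulr_ge0; [exact: ltW|apply: mulr_ge0; exact/weight_ge0/ltW/r0].
rewrite /gauge [leRHS]mulrDr expr2.
have : 0 <= e * (r n * r n) by rewrite !mulr_ge0// ltW.
by move: gw; lra.
Qed.
End GoursatTheorem.

(** * Cauchy coefficients and Taylor remainder in one variable *)

Section CauchyExpansion.
Context {R : realType}.
Local Notation C := R[i].
Local Notation mu := (@lebesgue_measure R).
Local Notation Re := (@complex.Re R).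
Local Notation Im := (@complex.Im R).
Implicit Types (u v f : C -> C) (z w : C).

Lemma cdiff_near u v z A : (exists2 d : R, 0 < d &
  forall w, nc (w - z) < d -> u w = v w) -> cdiff u z A -> cdiff v z A.
Proof.
move=> [d d0 uv] /cdiffP du; apply/cdiffP => e /du[d' d'0 H].
exists (Num.min d d'); first by rewrite lt_min d0.
move=> w; rewrite lt_min => /andP[wd wd'].
by rewrite -!uv ?subrr ?nc0//; exact: H.
Qed.

Lemma cdiff_invX z n : z != 0 ->
  cdiff (fun w : C => w^-1 ^+ n) z (- n%:R * z^-1 ^+ n.+1).
Proof.
move=> z0; elim: n => [|n IH].
  by rewrite oppr0 mul0r; exact: cdiff_cst.
have := cdiffM (cdiffV z0 (cdiff_id z)) IH.
rewrite (_ : (fun w => _ * _) = fun w => w^-1 ^+ n.+1); last first.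
  by apply/funext => w; rewrite exprS.
by congr cdiff; rewrite !exprS -[n.+1]add1n natrD; field.
Qed.

Definition contour u : C := rect_int u (-1) 1 (-1) 1.
Definition on_contour z := on_rect (-1 : R) 1 (-1) 1 z.
Definition in_square z := `|Re z| <= 1 /\ `|Im z| <= 1.
Definition cont_on_contour u := forall z, on_contour z -> contat u z.

Lemma on_contour_in_square z : on_contour z -> in_square z.
Proof. by move=> [rz iz _]; split; rewrite ler_norml. Qed.

Lemma on_contour_ge1 z : on_contour z -> 1 <= nc z.
Proof.
move=> [_ _ [] zE].
- by apply: le_trans (nc_Re z); rewrite zE normrN1.
- by apply: le_trans (nc_Re z); rewrite zE normr1.
- by apply: le_trans (nc_Im z); rewrite zE normrN1.
- by apply: le_trans (nc_Im z); rewrite zE normr1.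
Qed.

Lemma in_square_le2 z : in_square z -> nc z <= 2.
Proof.
move=> [rz iz]; rewrite (le_trans (nc_ReIm z))//.
by rewrite [2]mulr2n lerD.
Qed.

Let le11 : (-1 : R) <= 1. Proof. lra. Qed.
Let lt11 : (-1 : R) < 1. Proof. lra. Qed.

Lemma contour_bound u (M : R) : cont_on_contour u ->
  (forall z, on_contour z -> nc (u z) <= M) -> nc (contour u) <= 16 * M.
Proof.
move=> cu uM; have := rect_int_bound le11 le11 cu uM.
by rewrite /contour; lra.
Qed.

Lemma contour_power n : (0 < n)%N -> contour (fun z => z^-1 ^+ n.+1) = 0.
Proof.
move=> n0; apply: (@rect_int_primitive _ _ _ _ _ le11 le11 _
  (fun z => (- n%:R)^-1 * z^-1 ^+ n)) => // z /on_contour_ge1 z1.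
  apply/contatX/contatV; last exact: contat_id.
  by rewrite -nc_gt0 (lt_le_trans ltr01).
have z0 : z != 0 by rewrite -nc_gt0 (lt_le_trans ltr01).
have := cdiffM (cdiff_cst (- n%:R)^-1 z) (cdiff_invX n z0).
rewrite mul0r add0r mulrA mulVf ?mul1r// oppr_eq0 pnatr_eq0.
by rewrite -lt0n.
Qed.

Definition winding : C := contour (fun z => z^-1).

Let nc_i : nc (Complex 0 1 : C) = 1.
Proof. by rewrite /nc /= expr0n expr1n add0r sqrtr1. Qed.

(** Opposite sides combine to the same integral of 2i / (t^2 + 1) over [-1, 1]. On that interval 2 /
    (t^2 + 1) lies in [1, 2], within 1/2 of 3/2, so each integral differs from 3i by at most 2. *)
Lemma winding_neq0 : winding != 0.
Proof.
pose G t : C := Complex 0 (2 / (t ^+ 2 + 1)).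
have t1 (t : R) : t ^+ 2 + 1 != 0 :> R by rewrite gt_eqF// ltr_wpDl ?sqr_ge0.
have scont (u v : R -> C) : segment_cont (-1) 1 u -> segment_cont (-1) 1 v ->
    segment_cont (-1) 1 (fun t => u t + v t).
  move=> cu cv t tt e e0; have e2 : 0 < e / 2 by rewrite divr_gt0.
  have [d d0 Hd] := cu t tt _ e2; have [d' d'0 Hd'] := cv t tt _ e2.
  exists (Num.min d d') => [|s]; first by rewrite lt_min d0.
  rewrite lt_min => /andP[/Hd us /Hd' vs].
  rewrite (_ : _ - _ = (u s - u t) + (v s - v t)); last by ring.
  by apply: le_lt_trans (ncD _ _) _; lra.
have invc z : z != 0 -> contat (fun w => w^-1) z.
  by move=> z0; apply: contatV z0 _; exact: contat_id.
have neqi (t y : R) : y != 0 -> Complex t y != 0.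
  by move=> y0; rewrite eq_complex /= (negbTE y0) andbF.
have neq1 (t x : R) : x != 0 -> Complex x t != 0.
  by move=> x0; rewrite eq_complex /= (negbTE x0).
have N1 : -1 != 0 :> R by rewrite oppr_eq0 oner_neq0.
have ch (y : R) : y != 0 -> segment_cont (-1) 1 (fun t => (Complex t y)^-1).
  move=> y0; have := @segment_cont_hor _ (fun z : C => z^-1) (-1) 1 y.
    by apply => t _; exact/invc/neqi.
have cv (x : R) : x != 0 -> segment_cont (-1) 1 (fun t => (Complex x t)^-1).
  move=> x0; have := @segment_cont_ver _ (fun z : C => z^-1) (-1) 1 x.
    by apply => t _; exact/invc/neq1.
have scontN (u : R -> C) : segment_cont (-1) 1 u ->
    segment_cont (-1) 1 (fun t => -1 * u t).
  move=> cu t tt e /(cu t tt)[d d0 H]; exists d => // s /H.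
  by rewrite -mulrBr ncM ncN nc1 mul1r.
have hG : hor (fun z => z^-1) (-1) (-1) 1 - hor (fun z => z^-1) 1 (-1) 1 = cint (-1) 1 G.
  rewrite /hor -[X in _ + X = _]mulN1r -cintZ; last by apply: ch; exact: oner_neq0.
  rewrite -cintD; last 2 first.
  - exact: ch.
  - by apply/scontN/ch; exact: oner_neq0.
  apply: eq_cint => t _; apply/eqP; rewrite eq_complex /= sqrrN expr1n.
  by apply/andP; split; apply/eqP; field.
have cG : segment_cont (-1) 1 G.
  have : segment_cont (-1 : R) 1 (fun t : R => (Complex t (-1))^-1 + -1 * (Complex t 1)^-1 : C).
    by apply: scont; [exact: ch|apply/scontN/ch; exact: oner_neq0].
  congr segment_cont; apply/funext => t; apply/eqP; rewrite eq_complex /= sqrrN expr1n.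
  by apply/andP; split; apply/eqP; field.
have vG : Complex 0 1 * (ver (fun z => z^-1) 1 (-1) 1 - ver (fun z => z^-1) (-1) (-1) 1) =
    cint (-1) 1 G.
  rewrite /ver -[X in _ * (_ + X)]mulN1r -cintZ; last exact: cv.
  rewrite -cintD; last 2 first.
  - by apply: cv; exact: oner_neq0.
  - by apply/scontN/cv.
  rewrite -cintZ; last first.
    by apply: scont; [apply: cv; exact: oner_neq0|apply/scontN/cv].
  apply: eq_cint => t _; have := t1 t; rewrite addrC => t1'.
  apply/eqP; rewrite eq_complex /= sqrrN expr1n.
  by apply/andP; split; apply/eqP; field; rewrite ?t1 ?t1'.
have constE : cint (-1) 1 (fun=> Complex 0 (3 / 2)) = Complex 0 3 :> C.
  rewrite (@cint_FTC _ _ _ _ (fun t => Complex 0 (3 / 2 * t)) lt11).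
  - by apply/eqP; rewrite eq_complex /=; apply/andP; split; apply/eqP; lra.
  - by move=> t _ e e0; exists 1 => // s _; rewrite subrr nc0.
  - move=> t _ e e0; exists 1 => // s _.
    rewrite (_ : _ - _ = 0); first by rewrite nc0 mulr_ge0 ?(ltW e0).
    by apply/eqP; rewrite eq_complex /=; apply/andP; split; apply/eqP; lra.
have cc (c : C) : segment_cont (-1) 1 (fun=> c).
  by move=> t _ e e0; exists 1 => // s _; rewrite subrr nc0.
have EG : nc (cint (-1) 1 G - Complex 0 3) <= 2.
  rewrite -constE -[X in nc (_ + X)]mulN1r -cintZ; last exact: cc.
  rewrite -cintD; [|exact: cG|exact/scontN/cc].
  have H : 2 * (1 / 2) * (1 - (-1)) = 2 :> R by lra.
  rewrite -[leRHS]H; apply: cint_bound => //.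
    by apply: scont => //; exact: scontN.
  move=> t /andP[ta tb].
  rewrite (_ : _ + _ = Complex 0 1 * (2 / (t ^+ 2 + 1) - 3 / 2)%:C%C); last first.
    by apply/eqP; rewrite eq_complex /=; apply/andP; split; apply/eqP; lra.
  rewrite ncM nc_i mul1r nc_real ler_norml.
  have t2 : 0 <= t ^+ 2 <= 1.
    rewrite sqr_ge0 expr2; have : 0 <= (1 - t) * (t + 1) by apply: mulr_ge0; lra.
    lra.
  have tp : 0 < t ^+ 2 + 1 by lra.
  by rewrite lerBlDr lerBrDr ler_pdivrMr// ler_pdivlMr//; apply/andP; split; lra.
apply/eqP; rewrite /winding /contour /rect_int hG vG => /eqP.
rewrite -mulr2n mulrn_eq0 /= => /eqP G0; move: EG.
rewrite G0 sub0r ncN (_ : Complex 0 3 = Complex 0 1 * (3 : R)%:C%C :> C).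
  by rewrite ncM nc_i mul1r nc_real ger0_norm //; lra.
by apply/eqP; rewrite eq_complex /=; apply/andP; split; apply/eqP; lra.
Qed.

(** The finite geometric series of 1 / (z - z0) in powers of z0 / z, with its exact remainder; no
    passage to the limit is involved. *)
Lemma contour_geometric u z0 N : cont_on_contour u -> nc z0 < 1 ->
  contour (fun z => u z * (z - z0)^-1) =
  \sum_(n < N) contour (fun z => u z * z^-1 ^+ n.+1) * z0 ^+ n +
  contour (fun z => u z * (z^-1 ^+ N * (z - z0)^-1)) * z0 ^+ N.
Proof.
move=> cu z01.
have z_neq0 z : on_contour z -> z != 0.
  by move=> /on_contour_ge1 z1; rewrite -nc_gt0 (lt_le_trans ltr01).
have z_neqz0 z : on_contour z -> z - z0 != 0.
  move=> /on_contour_ge1 z1; rewrite subr_eq0; apply: contraTneq z1 => ->.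
  by rewrite -ltNge.
have cX k : cont_on_contour (fun z => u z * z^-1 ^+ k).
  move=> z oz; apply: contatM; first exact: cu.
  by apply/contatX/contatV; [exact: z_neq0|exact: contat_id].
have cV k : cont_on_contour (fun z => u z * (z^-1 ^+ k * (z - z0)^-1)).
  move=> z oz; apply: contatM; first exact: cu.
  apply: contatM; first by apply/contatX/contatV; [exact: z_neq0|exact: contat_id].
  apply: contatV; first exact: z_neqz0.
  by apply: contatB; [exact: contat_id|exact: contat_cst].
elim: N => [|N ->].
  rewrite big_ord0 add0r expr0 mulr1; congr contour; apply/funext => z.
  by rewrite expr0 mul1r.
rewrite big_ord_recr /= -addrA; congr (_ + _).
rewrite exprS mulrA -mulrDl; congr (_ * _).
rewrite [X in _ = _ + X]mulrC -[X in _ = _ + X](rect_intZ le11 le11 _ (cV N.+1)).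
rewrite -(rect_intD le11 le11 (cX N.+1)); last first.
  by move=> z oz; apply: contatM; [exact: contat_cst|exact: cV].
apply: (eq_rect_int le11 le11) => z oz.
rewrite exprS; field; rewrite z_neqz0 ?z_neq0//.
Qed.

Definition cauchy_coef (n : nat) u : C :=
  winding^-1 * contour (fun z => u z * z^-1 ^+ n.+1).

(** The 64 is the bound for the two remainder integrals in [cauchy_remainder], 16 * 2 each; the
    added 1 makes the constant at least 1. *)
Definition cauchy_cst : R := 64 / nc winding + 1.

Let w0 : 0 < nc winding. Proof. by rewrite nc_gt0 winding_neq0. Qed.

Lemma cauchy_cst_ge1 : 1 <= cauchy_cst.
Proof. by rewrite lerDr divr_ge0// ltW. Qed.

Let cX u k : cont_on_contour u -> cont_on_contour (fun z => u z * z^-1 ^+ k).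
Proof.
move=> cu z oz; apply: contatM; first exact: cu.
apply/contatX/contatV; last exact: contat_id.
by rewrite -nc_gt0 (lt_le_trans ltr01)// on_contour_ge1.
Qed.

Lemma cauchy_coefD n u v : cont_on_contour u -> cont_on_contour v ->
  cauchy_coef n (fun z => u z + v z) = cauchy_coef n u + cauchy_coef n v.
Proof.
move=> cu cv; rewrite /cauchy_coef -mulrDr; congr (_ * _).
rewrite /contour -(rect_intD le11 le11 (cX _ cu) (cX _ cv)).
by apply: (eq_rect_int le11 le11) => z _; rewrite mulrDl.
Qed.

Lemma cauchy_coefZ n k u : cont_on_contour u ->
  cauchy_coef n (fun z => k * u z) = k * cauchy_coef n u.
Proof.
move=> cu; rewrite /cauchy_coef mulrCA; congr (_ * _).
rewrite /contour -(rect_intZ le11 le11 k (cX _ cu)).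
by apply: (eq_rect_int le11 le11) => z _; rewrite mulrA.
Qed.

Lemma eq_cauchy_coef n u v : (forall z, on_contour z -> u z = v z) ->
  cauchy_coef n u = cauchy_coef n v.
Proof.
move=> uv; congr (_ * _); apply: (eq_rect_int le11 le11) => z oz.
by rewrite uv.
Qed.

Lemma cauchy_coef_sum n m (F : 'I_m -> C -> C) :
  (forall i, cont_on_contour (F i)) ->
  cauchy_coef n (fun z => \sum_i F i z) = \sum_i cauchy_coef n (F i).
Proof.
elim: m F => [|m IH] F cF.
  rewrite big_ord0 -[RHS](mul0r (cauchy_coef n (fun=> 0))) -cauchy_coefZ.
    by apply: eq_cauchy_coef => z _; rewrite big_ord0 mul0r.
  by move=> z _; exact: contat_cst.
rewrite big_ord_recl -IH// -cauchy_coefD//.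
  by apply: eq_cauchy_coef => z _; rewrite big_ord_recl.
by move=> z oz; apply: contat_sum => i; exact: cF.
Qed.

Lemma cauchy_coef_bound n u (M : R) : 0 <= M -> cont_on_contour u ->
  (forall z, on_contour z -> nc (u z) <= M) -> nc (cauchy_coef n u) <= cauchy_cst * M.
Proof.
move=> M0 cu uM; rewrite /cauchy_coef ncM ncV.
apply: (@le_trans _ _ ((nc winding)^-1 * (16 * M))).
  rewrite ler_pM2l ?invr_gt0//; apply: contour_bound; first exact: cX.
  move=> z oz; rewrite ncM ncX ncV -[leRHS]mulr1 ler_pM ?exprn_ge0 ?invr_ge0 ?nc_ge0//.
    exact: uM.
  by rewrite exprn_ile1 ?invr_ge0 ?nc_ge0// invf_le1 ?on_contour_ge1//
    (lt_le_trans ltr01)// on_contour_ge1.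
have : 0 <= M * (nc winding)^-1 by rewrite mulr_ge0// invr_ge0 ltW.
by rewrite /cauchy_cst; lra.
Qed.

(** Goursat applied to the difference quotient at z0 gives the integral of f / (z - z0) as f(z0)
    times that of 1 / (z - z0). Both are expanded by the finite geometric series; for the constant 1
    all terms but the first integrate to 0, leaving [winding] and a remainder. *)
Lemma cauchy_remainder f (M : R) z0 N :
  (forall z, in_square z -> exists A, cdiff f z A) ->
  (forall z, in_square z -> nc (f z) <= M) -> nc z0 <= 1 / 2 ->
  nc (f z0 - \sum_(n < N) cauchy_coef n f * z0 ^+ n) <= cauchy_cst * M * nc z0 ^+ N.
Proof.
move=> df fM z0h; have z01 : nc z0 < 1 by lra.
have sz0 : in_square z0.
  by split; [have := nc_Re z0|have := nc_Im z0]; lra.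
have M0 : 0 <= M by apply: le_trans (nc_ge0 _) (fM _ sz0).
(* The expansion is compared through its term n = 0, so N = 0 is treated apart; there the bound only
   says that the constant is at least 1. *)
case: N => [|N].
  rewrite big_ord0 subr0 expr0 mulr1 (le_trans (fM _ sz0))//.
  by rewrite ler_peMl// cauchy_cst_ge1.
have cf : cont_on_contour f.
  by move=> z /on_contour_in_square/df[A]; exact: cdiff_contat.
have [A [phi cphi [_ phiE]]] := df _ sz0.
have phiE' z : z != z0 -> phi z = (f z - f z0) * (z - z0)^-1.
  by move=> zz0; rewrite phiE mulfK// subr_eq0.
have phi_near z : z != z0 -> exists2 d : R, 0 < d &
    forall w, nc (w - z) < d -> (f w - f z0) * (w - z0)^-1 = phi w.
  move=> zz0; exists (nc (z - z0)); first by rewrite nc_gt0 subr_eq0.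
  move=> w wz; rewrite phiE'//; apply: contraTneq wz => ->.
  by rewrite ncBC ltxx.
have dq z : z != z0 -> cdiff (fun w => w - z0) z (1 + 0).
  by move=> _; apply: cdiffD; [exact: cdiff_id|exact: cdiff_cst].
have dphi z : in_square z -> z != z0 -> exists B, cdiff phi z B.
  move=> sz zz0; have [B dB] := df _ sz; eexists.
  apply: cdiff_near (phi_near z zz0) _; apply: cdiffM.
    by apply: cdiffD; [exact: dB|exact: cdiff_cst].
  by apply: cdiffV; [rewrite subr_eq0|exact: dq].
have E2 : -1 + 2 = 1 :> R by lra.
have sq z : on_square (-1) (-1) 2 z -> in_square z.
  by rewrite /on_square E2 => -[rz iz]; split; rewrite ler_norml.
have phi0 : contour phi = 0.
  have := @goursat _ phi z0 (-1) (-1) 2; rewrite /square_int E2; apply => //.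
    move=> z /sq sz; have [->//|zz0] := eqVneq z z0.
    by have [B] := dphi z sz zz0; exact: cdiff_contat.
  by move=> z /sq sz; exact: dphi.
have z_neqz0 z : on_contour z -> z - z0 != 0.
  move=> /on_contour_ge1 z1; rewrite subr_eq0; apply: contraTneq z1 => ->.
  by rewrite -ltNge.
have cq : cont_on_contour (fun z => (z - z0)^-1).
  move=> z oz; apply: contatV; first exact: z_neqz0.
  by apply: contatB; [exact: contat_id|exact: contat_cst].
have key : contour (fun z => f z * (z - z0)^-1) =
    f z0 * contour (fun z => 1 * (z - z0)^-1).
  have phiC : contour phi =
      contour (fun z => f z * (z - z0)^-1 + - f z0 * (1 * (z - z0)^-1)).
    apply: (eq_rect_int le11 le11) => z oz; rewrite phiE'; last first.
      by rewrite -subr_eq0 z_neqz0.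
    by ring.
  move: phi0; rewrite phiC /contour rect_intD//; last 2 first.
  - by move=> z oz; apply: contatM; [exact: cf|exact: cq].
  - move=> z oz; apply: contatM; first exact: contat_cst.
    by apply: contatM; [exact: contat_cst|exact: cq].
  rewrite rect_intZ//; last first.
    by move=> z oz; apply: contatM; [exact: contat_cst|exact: cq].
  by rewrite mulNr => /eqP; rewrite subr_eq0 => /eqP.
have c1 : cont_on_contour (fun=> 1) by move=> z _; exact: contat_cst.
have qb z k : on_contour z -> nc (z^-1 ^+ k * (z - z0)^-1) <= 2.
  move=> oz; have z1 := on_contour_ge1 oz; rewrite ncM ncX !ncV -[leRHS]mul1r.
  apply: ler_pM; rewrite ?exprn_ge0 ?invr_ge0 ?nc_ge0//.
    by rewrite exprn_ile1 ?invr_ge0 ?nc_ge0// invf_le1// (lt_le_trans ltr01).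
  have h : 1 / 2 <= nc (z - z0).
    by have := ncD (z - z0) z0; rewrite subrK; lra.
  have h0 : 0 < nc (z - z0) by lra.
  by rewrite -[2]invrK lef_pV2 ?posrE ?invr_gt0//; lra.
have cE u : cont_on_contour u ->
    cont_on_contour (fun z => u z * (z^-1 ^+ N.+1 * (z - z0)^-1)).
  move=> cu z oz; apply: contatM; first exact: cu.
  apply: contatM; last exact: cq.
  apply/contatX/contatV; last exact: contat_id.
  by rewrite -nc_gt0 (lt_le_trans ltr01)// on_contour_ge1.
move: key; rewrite (contour_geometric N.+1 cf z01) (contour_geometric N.+1 c1 z01).
set Ef := contour (fun z => f z * (z^-1 ^+ N.+1 * _)).
set E1 := contour (fun z => 1 * (z^-1 ^+ N.+1 * _)).
have bEf : nc Ef <= 16 * (M * 2).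
  apply: contour_bound; first exact: cE.
  move=> z oz; rewrite ncM ler_pM ?nc_ge0 ?qb//.
  exact/fM/on_contour_in_square.
have bE1 : nc E1 <= 16 * 2.
  apply: contour_bound; first exact: cE.
  by move=> z oz; rewrite mul1r qb.
rewrite [X in _ = _ * (X + _)]big_ord_recl expr0 mulr1.
rewrite [X in _ = _ * (_ + X + _)]big1 ?addr0; last first.
  move=> i _; rewrite (_ : contour _ = 0) ?mul0r//.
  rewrite -(@contour_power i.+1 isT); apply: (eq_rect_int le11 le11) => z _.
  by rewrite mul1r.
have -> : contour (fun z => 1 * z^-1 ^+ (@ord0 N).+1) = winding.
  by apply: (eq_rect_int le11 le11) => z _; rewrite mul1r expr1.
move=> key.
have w'0 := winding_neq0.
have -> : f z0 - \sum_(n < N.+1) cauchy_coef n f * z0 ^+ n =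
    winding^-1 * (Ef - f z0 * E1) * z0 ^+ N.+1.
  apply: (mulfI w'0); rewrite mulrBr mulr_sumr.
  under eq_bigr do rewrite /cauchy_coef mulrA mulrA divff// mul1r.
  rewrite !mulrA divff// mul1r.
  have -> : winding * f z0 = f z0 * (winding + E1 * z0 ^+ N.+1) -
    f z0 * E1 * z0 ^+ N.+1 by ring.
  by rewrite -key; ring.
rewrite ncM ncX ler_wpM2r ?exprn_ge0 ?nc_ge0// ncM ncV.
have bt : nc (Ef - f z0 * E1) <= 64 * M.
  apply: le_trans (ncB _ _) _; rewrite ncM.
  have : nc (f z0) * nc E1 <= M * (16 * 2).
    by rewrite ler_pM ?nc_ge0// fM.
  by lra.
apply: (@le_trans _ _ ((nc winding)^-1 * (64 * M))).
  by rewrite ler_wpM2l// invr_ge0 ltW.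
have : 0 <= M * (nc winding)^-1 by rewrite mulr_ge0// invr_ge0 ltW.
by rewrite /cauchy_cst; lra.
Qed.
End CauchyExpansion.

(** * Holomorphic functions of two variables *)

Section TwoVariableExpansion.
Context {R : realType}.
Local Notation C := R[i].
Implicit Types (F : fps (fps C)) (f : C -> C -> C) (x y z w : C).

Definition homog F d x y := \sum_(i < d.+1) F i (d - i)%N * x ^+ i * y ^+ (d - i).
Definition partial_sum F N x y := \sum_(d < N) homog F d x y.

Lemma partial_sum_triangle F N x y : partial_sum F N x y =
  \sum_(i < N) (\sum_(j < N - i) F i j * y ^+ j) * x ^+ i.
Proof.
rewrite /partial_sum; elim: N => [|N IH]; first by rewrite !big_ord0.
rewrite big_ord_recr /= IH [RHS]big_ord_recr /= subSn// subnn big_ord1.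
rewrite /homog big_ord_recr /= subnn addrA; congr (_ + _); last by ring.
rewrite -big_split; apply: eq_bigr => i _ /=.
by rewrite subSn 1?ltnW// big_ord_recr /= mulrDl; congr (_ + _); ring.
Qed.

(** One pair of constants serves all orders and all radii: for t rho < 1 the partial sums converge
    to f geometrically, and the same constants give [convergent]. *)
Definition expands f F := exists M t : R, 0 < t /\
  (forall i j, nc (F i j) <= M * t ^+ (i + j)) /\
  forall x y (rho : R) N, nc x <= rho -> nc y <= rho -> t * rho <= 1 ->
    nc (f x y - partial_sum F N x y) <= M * (t * rho) ^+ N.

Lemma succ_le_exp2 n : n.+1%:R <= 2 ^+ n :> R.
Proof. by rewrite -natrX ler_nat ltn_expl. Qed.

Let cst_ge1 := @cauchy_cst_ge1 R.
Let cst0 : 0 <= @cauchy_cst R. Proof. exact: le_trans ler01 _. Qed.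

(** The remainder estimate of order 1, used once at h and once at 0, where it identifies the
    constant coefficient with u(0). *)
Lemma cauchy_lipschitz (u : C -> C) (M : R) h :
  (forall z, in_square z -> exists A, cdiff u z A) ->
  (forall z, in_square z -> nc (u z) <= M) -> nc h <= 1 / 2 ->
  nc (u h - u 0) <= @cauchy_cst R * M * nc h.
Proof.
move=> du uM hh.
have := cauchy_remainder 1 du uM hh; rewrite expr1 big_ord1 expr0 mulr1.
have z0 : nc (0 : C) <= 1 / 2 by rewrite nc0; lra.
have := cauchy_remainder 1 du uM z0; rewrite nc0 expr1 mulr0 big_ord1 expr0 mulr1.
move=> u0 H; apply: le_trans H; rewrite le_eqVlt; apply/orP; left; apply/eqP.
congr nc; congr (_ - _); apply/eqP; rewrite -subr_eq0 -nc_eq0.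
by rewrite eq_le u0 nc_ge0.
Qed.

Lemma cdiff_shift (u : C -> C) a z A :
  cdiff u (a + z) A -> cdiff (fun w => u (a + w)) z A.
Proof.
move=> /cdiffP H; apply/cdiffP => e /H[d d0 {}H]; exists d => // w wd.
have E : (a + w) - (a + z) = w - z by ring.
by have := H (a + w); rewrite E => /(_ wd).
Qed.

Section Polydisc.
Variables (f : C -> C -> C) (M : R).
(** The contour lies in the disc of radius 2; radius 5 leaves room for x + v with both terms of
    modulus at most 2. *)
Hypothesis f_dx : forall x y, nc x < 5 -> nc y < 5 ->
  exists A, cdiff (fun x' => f x' y) x A.
Hypothesis f_dy : forall x y, nc x < 5 -> nc y < 5 -> exists A, cdiff (f x) y A.
Hypothesis f_bound : forall x y, nc x < 5 -> nc y < 5 -> nc (f x y) <= M.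

Let M0 : 0 <= M.
Proof. by apply: le_trans (nc_ge0 (f 0 0)) (f_bound _ _); rewrite nc0. Qed.

Let KM0 : 0 <= @cauchy_cst R * M. Proof. exact: mulr_ge0. Qed.

Let lt5 z : in_square z -> nc z < 5.
Proof. by move=> /in_square_le2; lra. Qed.

Let d m x := cauchy_coef m (f x).

Let cont_f x : nc x < 5 -> cont_on_contour (f x).
Proof.
move=> x5 z /on_contour_in_square/lt5 z5; have [A] := f_dy x5 z5.
exact: cdiff_contat.
Qed.

(** Joint continuity of f is not assumed. Boundedness makes f Lipschitz in x, uniformly for y on the
    contour, so its coefficients in y are continuous and can be integrated in turn. *)
Let d_cont m x : nc x <= 2 -> contat (d m) x.
Proof.
move=> x2; apply/contatP => e e0.
pose L := @cauchy_cst R * (@cauchy_cst R * M) + 1.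
have L0 : 0 < L by rewrite ltr_wpDl// mulr_ge0.
exists (Num.min (1 / 2) (e / L)); first by rewrite lt_min !divr_gt0.
move=> w; rewrite lt_min => /andP[wx]; rewrite ltr_pdivlMr// => we.
have w5 : nc w < 5.
  by have := ncD (w - x) x; rewrite subrK; lra.
have x5 : nc x < 5 by lra.
have -> : d m w - d m x = cauchy_coef m (fun z => f w z + -1 * f x z).
  rewrite cauchy_coefD ?cauchy_coefZ ?mulN1r//; try exact: cont_f.
  move=> z oz; apply: contatM; first exact: contat_cst.
  exact: cont_f.
have B z : on_contour z -> nc (f w z + -1 * f x z) <= @cauchy_cst R * M * nc (w - x).
  move=> /on_contour_in_square/lt5 z5; rewrite mulN1r.
  have H v : in_square v -> nc (x + v) < 5.
    by move=> /in_square_le2; have := ncD x v; lra.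
  have := @cauchy_lipschitz (fun v => f (x + v) z) M (w - x) _ _ (ltW wx).
  have E : x + (w - x) = w by ring.
  rewrite addr0 E; apply.
    by move=> v /H v5; have [A dA] := f_dx v5 z5; exists A; apply: (cdiff_shift dA).
  by move=> v /H v5; exact: f_bound.
apply: le_lt_trans (cauchy_coef_bound m _ _ B) _.
- by rewrite mulr_ge0 ?nc_ge0.
- move=> z oz; apply: contatD; first exact: cont_f.
  by apply: contatM; [exact: contat_cst|exact: cont_f].
apply: le_lt_trans we; rewrite mulrA [leRHS]mulrC ler_wpM2r ?nc_ge0//.
by rewrite /L mulrA lerDl.
Qed.

Let d_cont_contour m : cont_on_contour (d m).
Proof. by move=> z /on_contour_in_square/in_square_le2; exact: d_cont. Qed.

Definition cauchy_coef2 : fps (fps C) := fun n m => cauchy_coef n (d m).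

Lemma cauchy_coef2_bound n m :
  nc (cauchy_coef2 n m) <= @cauchy_cst R * (@cauchy_cst R * M).
Proof.
apply: cauchy_coef_bound => // z /on_contour_in_square/lt5 z5.
apply: cauchy_coef_bound => //; first exact: cont_f.
by move=> w /on_contour_in_square/lt5 w5; exact: f_bound.
Qed.

(** Expand in x to order N, then the n-th coefficient in y to order N - n. There are N + 1 errors,
    each a constant times rho^N, and N + 1 is at most 2^N, whence the factor 2 rho. *)
Lemma cauchy_remainder2 x y (rho : R) N :
  nc x <= rho -> nc y <= rho -> rho <= 1 / 2 ->
  nc (f x y - partial_sum cauchy_coef2 N x y) <=
    @cauchy_cst R * (@cauchy_cst R * M) * (2 * rho) ^+ N.
Proof.
move=> xr yr r2; have x2 := le_trans xr r2; have y2 := le_trans yr r2.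
have rho0 : 0 <= rho by apply: le_trans (nc_ge0 x) xr.
have y5 : nc y < 5 by lra.
have x5 : nc x < 5 by lra.
pose K := @cauchy_cst R.
have cfy : cont_on_contour (fun x' => f x' y).
  move=> z /on_contour_in_square/lt5 z5; have [A] := f_dx z5 y5.
  exact: cdiff_contat.
rewrite partial_sum_triangle.
pose a n := cauchy_coef n (fun x' => f x' y).
have H1 : nc (f x y - \sum_(n < N) a n * x ^+ n) <= K * M * rho ^+ N.
  apply: (@le_trans _ _ (K * M * nc x ^+ N)).
    apply: (@cauchy_remainder _ (fun x' => f x' y)) => // z /lt5 z5.
      exact: f_dx.
    exact: f_bound.
  by rewrite ler_wpM2l// lerXn2r// nnegrE ?nc_ge0.
have H2 (n : 'I_N) : nc ((a n - \sum_(j < N - n) cauchy_coef2 n j * y ^+ j) * x ^+ n) <=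
    K * (K * M) * rho ^+ N.
  have nN : (n <= N)%N by exact: ltnW.
  have -> : a n - \sum_(j < N - n) cauchy_coef2 n j * y ^+ j =
      cauchy_coef n (fun x' => f x' y + \sum_(j < N - n) - (y ^+ j) * d j x').
    rewrite cauchy_coefD//; last first.
      move=> z oz; apply: contat_sum => j; apply: contatM; first exact: contat_cst.
      exact: d_cont_contour.
    rewrite cauchy_coef_sum; last first.
      move=> j z oz; apply: contatM; first exact: contat_cst.
      exact: d_cont_contour.
    congr (_ + _); rewrite -sumrN; apply: eq_bigr => j _.
    by rewrite cauchy_coefZ ?mulNr 1?mulrC//; exact: d_cont_contour.
  rewrite ncM -[N in rho ^+ N](subnK nN) exprD mulrA.
  apply: ler_pM; rewrite ?nc_ge0//; last first.
    by rewrite ncX lerXn2r// nnegrE nc_ge0.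
  rewrite -mulrA; apply: cauchy_coef_bound.
  - by rewrite mulr_ge0// exprn_ge0.
  - move=> z oz; apply: contatD; first exact: cfy.
    apply: contat_sum => j; apply: contatM; first exact: contat_cst.
    exact: d_cont_contour.
  move=> z /on_contour_in_square/lt5 z5.
  have -> : f z y + \sum_(j < N - n) - y ^+ j * d j z =
      f z y - \sum_(j < N - n) d j z * y ^+ j.
    by rewrite -sumrN; congr (_ + _); apply: eq_bigr => j _; rewrite mulNr mulrC.
  apply: (@le_trans _ _ (K * M * nc y ^+ (N - n))).
    apply: (@cauchy_remainder _ (f z)) => // w /lt5 w5; first exact: f_dy.
    exact: f_bound.
  by rewrite ler_wpM2l// lerXn2r// nnegrE ?nc_ge0.
rewrite (_ : _ - _ = (f x y - \sum_(n < N) a n * x ^+ n) +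
  \sum_(n < N) (a n - \sum_(j < N - n) cauchy_coef2 n j * y ^+ j) * x ^+ n); last first.
  under [X in _ = _ + X]eq_bigr do rewrite mulrBl.
  by rewrite sumrB; ring.
apply: le_trans (ncD _ _) _.
apply: (@le_trans _ _ (K * (K * M) * rho ^+ N + \sum_(n < N) K * (K * M) * rho ^+ N)).
  apply: lerD; last by apply: le_trans (nc_sum _ _ _) _; exact: ler_sum.
  apply: le_trans H1 _; rewrite ler_wpM2r ?exprn_ge0//.
  by rewrite ler_peMl// mulr_ge0.
rewrite sumr_const card_ord -mulrS.
have -> : (K * (K * M) * rho ^+ N) *+ N.+1 = K * (K * M) * (N.+1%:R * rho ^+ N) by ring.
apply: ler_wpM2l; first by rewrite !mulr_ge0.
by rewrite exprMn ler_wpM2r ?exprn_ge0// succ_le_exp2.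
Qed.

End Polydisc.

Lemma expansion_exists f (M r : R) : 0 < r ->
  (forall x y, nc x < r -> nc y < r -> exists A, cdiff (fun x' => f x' y) x A) ->
  (forall x y, nc x < r -> nc y < r -> exists A, cdiff (f x) y A) ->
  (forall x y, nc x < r -> nc y < r -> nc (f x y) <= M) ->
  exists F, expands f F.
Proof.
move=> r0 fx fy fM; have [l l0 l5] : exists2 l : R, 0 < l & r = l * 5.
  by exists (r / 5); [rewrite divr_gt0|rewrite divfK].
pose lc : C := l%:C%C.
have nlc : nc lc = l by rewrite nc_real gtr0_norm.
have lc0 : lc != 0 by rewrite -nc_gt0 nlc.
pose g x y := f (lc * x) (lc * y).
have lr x : nc x < 5 -> nc (lc * x) < r.
  by rewrite ncM nlc l5 ltr_pM2l.
have dscale (u : C -> C) z A : cdiff u (lc * z) A -> cdiff (fun w => u (lc * w)) z (lc * A).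
  move=> [phi cphi [<- uE]]; exists (fun w => lc * phi (lc * w)).
    apply: contatM; first exact: contat_cst.
    move/contatP: cphi => H; apply/contatP => e /H[d d0 {}H].
    exists (d / l) => [|w]; first by rewrite divr_gt0.
    rewrite ltr_pdivlMr// => wd; apply: H.
    by rewrite -mulrBr ncM nlc mulrC.
  by split=> // w; rewrite uE -mulrBr; ring.
have gx x y : nc x < 5 -> nc y < 5 -> exists A, cdiff (fun x' => g x' y) x A.
  move=> /lr x5 /lr y5; have [A dA] := fx _ _ x5 y5; exists (lc * A).
  exact: (dscale (fun x' => f x' (lc * y))).
have gy x y : nc x < 5 -> nc y < 5 -> exists A, cdiff (g x) y A.
  move=> /lr x5 /lr y5; have [A dA] := fy _ _ x5 y5; exists (lc * A).
  exact: dscale.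
have gM x y : nc x < 5 -> nc y < 5 -> nc (g x y) <= M.
  by move=> /lr x5 /lr y5; exact: fM.
pose c := cauchy_coef2 g; pose K := @cauchy_cst R * (@cauchy_cst R * M).
exists (fun i j => c i j / lc ^+ (i + j)), K, (2 / l).
have M0 : 0 <= M by apply: le_trans (nc_ge0 (f 0 0)) (fM _ _ _ _); rewrite nc0.
have K0 : 0 <= K by rewrite !mulr_ge0.
split; first by rewrite divr_gt0.
split=> [i j|x y rho N xr yr trho].
  rewrite ncM ncV ncX nlc expr_div_n mulrA.
  apply: ler_wpM2r; first by rewrite invr_ge0 exprn_ge0// ltW.
  rewrite (le_trans (cauchy_coef2_bound gx gy gM i j))//.
  by rewrite ler_peMr// exprn_ege1// ler1n.
have E : f x y = g (x / lc) (y / lc).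
  by rewrite /g ![lc * _]mulrC !divfK.
have -> : partial_sum (fun i j => c i j / lc ^+ (i + j)) N x y =
    partial_sum c N (x / lc) (y / lc).
  apply: eq_bigr => d _; apply: eq_bigr => i _.
  rewrite subnKC; last by rewrite -ltnS.
  rewrite !expr_div_n.
  have -> : lc ^+ d = lc ^+ i * lc ^+ (d - i).
    by rewrite -exprD subnKC// -ltnS.
  by field; rewrite !expf_neq0.
rewrite E (_ : 2 / l * rho = 2 * (rho / l)); last by ring.
apply: cauchy_remainder2 => //.
- by rewrite ncM ncV nlc ler_pM2r ?invr_gt0.
- by rewrite ncM ncV nlc ler_pM2r ?invr_gt0.
by move: trho; rewrite mulrAC -mulrA; lra.
Qed.
End TwoVariableExpansion.

(** * Polynomial approximation and uniqueness of expansions *)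

Section AsymptoticExpansion.
Context {R : realType}.
Local Notation C := R[i].
Implicit Types (F G : fps (fps C)) (f g : C -> C -> C) (x y z w : C).
Implicit Types (P Q : {poly {poly C}}).

Definition eval2 P x y : C := (P.[x%:P]).[y].

Lemma eval2_bound P : exists2 B : R, 0 <= B &
  forall x y, nc x <= 1 -> nc y <= 1 -> nc (eval2 P x y) <= B.
Proof.
have H (p : {poly C}) : exists2 B : R, 0 <= B & forall y, nc y <= 1 -> nc p.[y] <= B.
  elim/poly_ind: p => [|p c [B B0 pB]].
    by exists 0 => // y _; rewrite horner0 nc0.
  exists (B + nc c) => [|y y1]; first by rewrite addr_ge0 ?nc_ge0.
  rewrite hornerMXaddC (le_trans (ncD _ _))// lerD2r ncM.
  by rewrite -[leRHS]mulr1 ler_pM ?nc_ge0 ?pB.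
elim/poly_ind: P => [|P p [B B0 PB]].
  by exists 0 => // x y _ _; rewrite /eval2 !horner0 nc0.
have [B' B'0 pB] := H p; exists (B + B') => [|x y x1 y1]; first exact: addr_ge0.
rewrite /eval2 hornerMXaddC hornerD hornerM hornerC (le_trans (ncD _ _))// lerD//.
  by rewrite ncM -[leRHS]mulr1 ler_pM ?nc_ge0 ?PB.
exact: pB.
Qed.

Definition agrees P F N := forall i j, (i + j < N)%N -> P`_i`_j = F i j.

(* Weaker than [expands] but visibly compatible with products; the two agree for
   holomorphic [f], by [asym_expands]. *)
Definition asym f F := forall N, exists2 P, agrees P F N &
  exists K d : R, [/\ 0 <= K, 0 < d & forall x y (rho : R),
    nc x <= rho -> nc y <= rho -> rho <= d ->
    nc (f x y - eval2 P x y) <= K * rho ^+ N].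

Lemma asym_near f g F : (exists2 r : R, 0 < r &
  forall x y, nc x < r -> nc y < r -> f x y = g x y) -> asym f F -> asym g F.
Proof.
move=> [r r0 fg] fF N; have [P PF [K [d [K0 d0 H]]]] := fF N.
exists P => //; exists K, (Num.min d (r / 2)).
split=> // [|x y rho xr yr]; first by rewrite lt_min d0 divr_gt0.
rewrite le_min => /andP[rd rr]; rewrite -fg; first exact: H.
  by apply: le_lt_trans xr _; lra.
by apply: le_lt_trans yr _; lra.
Qed.

Lemma asymD f g F G : asym f F -> asym g G ->
  asym (fun x y => f x y + g x y) (F + G).
Proof.
move=> fF gG N; have [P PF [K [d [K0 d0 HP]]]] := fF N.
have [Q QG [L [e [L0 e0 HQ]]]] := gG N.
exists (P + Q) => [i j ij|]; first by rewrite !coefD PF// QG.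
exists (K + L), (Num.min d e); split; [exact: addr_ge0|by rewrite lt_min d0|].
move=> x y rho xr yr; rewrite le_min => /andP[rd re].
rewrite /eval2 !hornerD -/(eval2 P x y) -/(eval2 Q x y).
rewrite (_ : _ - _ = (f x y - eval2 P x y) + (g x y - eval2 Q x y)); last by ring.
by rewrite (le_trans (ncD _ _))// mulrDl lerD// ?HP ?HQ.
Qed.

Lemma asymM f g F G : asym f F -> asym g G ->
  asym (fun x y => f x y * g x y) (F * G).
Proof.
move=> fF gG N; have [P PF [K [d [K0 d0 HP]]]] := fF N.
have [Q QG [L [e [L0 e0 HQ]]]] := gG N.
have [B B0 PB] := eval2_bound P; have [B' B'0 QB] := eval2_bound Q.
exists (P * Q) => [i j ij|].
  rewrite coefM coef_sum fps_mulE fps_sumE; apply: eq_bigr => k _.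
  rewrite coefM fps_mulE; apply: eq_bigr => l _.
  have ki := ltn_ord k; have lj := ltn_ord l.
  by rewrite PF ?QG//; move: ij ki lj; clear; move: (nat_of_ord k) (nat_of_ord l); lia.
exists (K * (L + B') + B * L), (Num.min (Num.min d e) 1); split.
- by rewrite addr_ge0 ?mulr_ge0 ?addr_ge0.
- by rewrite !lt_min d0 e0 ltr01.
move=> x y rho xr yr; rewrite !le_min => /andP[/andP[rd re] r1].
have rho0 : 0 <= rho by apply: le_trans (nc_ge0 x) xr.
rewrite /eval2 !hornerM -/(eval2 P x y) -/(eval2 Q x y).
have x1 := le_trans xr r1; have y1 := le_trans yr r1.
have hP := HP x y rho xr yr rd; have hQ := HQ x y rho xr yr re.
have gb : nc (g x y) <= L + B'.
  rewrite -(subrK (eval2 Q x y) (g x y)) (le_trans (ncD _ _))// lerD//; last exact: QB.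
  by apply: le_trans hQ _; rewrite ler_piMr// exprn_ile1.
rewrite (_ : _ - _ = (f x y - eval2 P x y) * g x y +
  eval2 P x y * (g x y - eval2 Q x y)); last by ring.
rewrite (le_trans (ncD _ _))// !ncM mulrDl; apply: lerD.
  rewrite mulrAC; apply: ler_pM; rewrite ?nc_ge0//.
by rewrite -mulrA; apply: ler_pM; rewrite ?nc_ge0// PB.
Qed.

Lemma asym_cst (c : C) : asym (fun _ _ => c) (fpsC (fpsC c)).
Proof.
move=> N; exists c%:P%:P => [i j _|].
  by rewrite coefC /fpsC; case: eqP => _; rewrite ?coef0// mulr1n coefC; case: eqP.
exists 0, 1; split=> // x y rho _ _ _.
by rewrite /eval2 !hornerC subrr nc0 mul0r.
Qed.

Lemma asymZ (c : C) f F : asym f F -> asym (fun x y => c * f x y) (c *: F).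
Proof. by move=> fF; exact: asymM (asym_cst c) fF. Qed.

Lemma asym0 : asym (fun _ _ => 0) 0.
Proof.
have := asym_cst 0; congr asym.
by apply/funext => i; apply/funext => j; rewrite /fpsC; case: i; case: j.
Qed.

Lemma asymN f F : asym f F -> asym (fun x y => - f x y) (- F).
Proof.
move=> /(asymZ (-1)); rewrite scaleN1r; congr asym.
by apply/funext => x; apply/funext => y; rewrite mulN1r.
Qed.

Lemma asymB f g F G : asym f F -> asym g G ->
  asym (fun x y => f x y - g x y) (F - G).
Proof. by move=> fF gG; exact: asymD fF (asymN gG). Qed.

Lemma poly_small (p : {poly C}) N (K d : R) : 0 < d -> 0 <= K ->
  (forall t, nc t <= d -> nc p.[t] <= K * nc t ^+ N) ->
  forall k, (k < N)%N -> p`_k = 0.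
Proof.
move=> d0 K0 pK; elim/ltn_ind => k IH kN.
pose q := drop_poly k.+1 p.
have pE t : p.[t] = (p`_k + q.[t] * t) * t ^+ k.
  rewrite -(poly_take_drop k.+1 p) hornerD hornerM hornerXn -/q.
  rewrite (_ : take_poly k.+1 p = p`_k *: 'X^k).
    by rewrite hornerZ hornerXn coefD coefZ coefXn eqxx mulr1 coefMXn ltnSn addr0 exprS; ring.
  apply/polyP => l; rewrite coef_take_poly coefZ coefXn.
  case: (ltngtP l k) => [lk|kl|->]; rewrite ?mulr0 ?mulr1.
  - by rewrite ltnS ltnW// IH// (ltn_trans lk).
  - by rewrite ltnNge kl.
  - by rewrite ltnSn.
have [B B0 qB] : exists2 B : R, 0 <= B & forall y, nc y <= 1 -> nc q.[y] <= B.
  have [B B0 H] := eval2_bound q%:P; exists B => // y y1.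
  by have := H 0 y; rewrite /eval2 hornerC nc0; apply.
apply: nc_eps => e e0.
have KB : 0 < K + B + 1 by rewrite ltr_wpDl// addr_ge0.
pose s := Num.min (Num.min d 1) (e / (K + B + 1)).
have s0 : 0 < s by rewrite !lt_min d0 ltr01 divr_gt0.
have [sd s1 se] : [/\ s <= d, s <= 1 & s <= e / (K + B + 1)].
  by split; rewrite /s; rewrite !ge_min lexx ?orbT.
have ns : nc (s%:C%C : C) = s by rewrite nc_real gtr0_norm.
have := pK s%:C%C; rewrite pE ncM ncX ns => /(_ sd).
rewrite -(subnKC (ltnW kN)) exprD mulrCA [leRHS]mulrC ler_pM2r ?exprn_gt0// => H.
have H1 : K * s ^+ (N - k) <= K * s.
  rewrite ler_wpM2l// -(subnKC (_ : 0 < N - k)%N) ?subn_gt0// exprD expr1.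
  by rewrite ler_piMr ?(ltW s0)// exprn_ile1// ltW.
have H2 : nc (q.[s%:C%C] * s%:C%C) <= B * s.
  by rewrite ncM ns ler_wpM2r ?(ltW s0)// qB// ns.
have : nc p`_k <= (K + B) * s.
  have := ncB (p`_k + q.[s%:C%C] * s%:C%C) (q.[s%:C%C] * s%:C%C).
  rewrite addrK; move: H H1 H2; lra.
move=> H3; apply: le_trans H3 _.
apply: (@le_trans _ _ ((K + B + 1) * s)); first by rewrite ler_wpM2r ?(ltW s0)//; lra.
by rewrite mulrC -ler_pdivlMr.
Qed.

(** On the line (s t, t) the polynomial is small in t, so its coefficient of t^(i0 + j0) vanishes.
    As a function of s this coefficient is the polynomial [q], zero for |s| <= 1, hence zero. *)
Lemma eval2_small P N (K d : R) : 0 < d -> 0 <= K ->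
  (forall x y (rho : R), nc x <= rho -> nc y <= rho -> rho <= d ->
    nc (eval2 P x y) <= K * rho ^+ N) ->
  forall i j, (i + j < N)%N -> P`_i`_j = 0.
Proof.
move=> d0 K0 PK i0 j0 ijN.
pose n := (size P + \sum_(i < size P) size (P`_i)%R + i0 + j0).+1.
have sP : (size P <= n)%N by rewrite /n; lia.
have sPi i : (size (P`_i)%R <= n)%N.
  have [iP|Pi] := ltnP i (size P); last by rewrite nth_default ?size_poly0.
  rewrite /n (bigD1 (Ordinal iP)) //=; by rewrite leqW// -!addnA addnCA leq_addr.
have evE x y : eval2 P x y = \sum_(i < n) \sum_(j < n) P`_i`_j * y ^+ j * x ^+ i.
  rewrite /eval2 (horner_coef_wide _ sP) horner_sum; apply: eq_bigr => i _.
  rewrite hornerM -rmorphXn hornerC (horner_coef_wide _ (sPi i)) mulr_suml.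
  by apply: eq_bigr.
pose r s : {poly C} := \sum_(i < n) \sum_(j < n) (P`_i`_j * s ^+ i) *: 'X^(i + j).
pose q : {poly C} := \sum_(i < n) \sum_(j < n) (P`_i`_j *+ (i + j == i0 + j0)%N) *: 'X^i.
have qs s : nc s <= 1 -> q.[s] = 0.
  move=> s1; have : (r s)`_(i0 + j0) = 0.
    apply: (@poly_small (r s) N K d) => // t td.
    have -> : (r s).[t] = eval2 P (s * t) t.
      rewrite evE /r horner_sum; apply: eq_bigr => i _.
      rewrite horner_sum; apply: eq_bigr => j _.
      by rewrite hornerZ hornerXn exprD exprMn; ring.
    by apply: PK => //; rewrite ncM ler_piMl ?nc_ge0.
  move=> <-; rewrite /q /r horner_sum coef_sum; apply: eq_bigr => i _.
  rewrite horner_sum coef_sum; apply: eq_bigr => j _.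
  rewrite hornerZ hornerXn coefZ coefXn eq_sym.
  by case: eqP => _; rewrite ?mulr1n ?mulr1 ?mulr0n ?mulr0 ?mul0r.
have : q`_i0 = 0.
  apply: (@poly_small q i0.+1 0 1) => // t /qs ->.
  by rewrite nc0 mul0r.
have i0n : (i0 < n)%N by rewrite /n; lia.
have j0n : (j0 < n)%N by rewrite /n; lia.
rewrite /q coef_sum (bigD1 (Ordinal i0n))//= [X in _ + X]big1 ?addr0; last first.
  move=> i ii0; rewrite coef_sum big1// => j _; rewrite coefZ coefXn.
  have -> : (i0 == i :> nat) = false by apply/negbTE; rewrite eq_sym; exact: ii0.
  by rewrite mulr0.
rewrite coef_sum (bigD1 (Ordinal j0n))//= [X in _ + X]big1 ?addr0; last first.
  move=> j jj0; rewrite eqn_add2l.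
  have -> : (nat_of_ord j == j0) = false by apply/negbTE; exact: jj0.
  by rewrite mulr0n scale0r coef0.
by rewrite eqxx mulr1n coefZ coefXn eqxx mulr1.
Qed.

Lemma asym_eq0 f F : (exists2 r : R, 0 < r &
  forall x y, nc x < r -> nc y < r -> f x y = 0) -> asym f F -> F = 0.
Proof.
move=> [r r0 f0] fF; apply/funext => i; apply/funext => j.
have [P PF [K [d [K0 d0 H]]]] := fF (i + j).+1.
rewrite -PF//; apply: (@eval2_small P (i + j).+1 K (Num.min d (r / 2))) => //.
  by rewrite lt_min d0 divr_gt0.
move=> x y rho xr yr; rewrite le_min => /andP[rd rr].
rewrite -ncN -sub0r -(f0 x y); first exact: H.
  by apply: le_lt_trans xr _; lra.
by apply: le_lt_trans yr _; lra.
Qed.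

Lemma expands_asym f F : expands f F -> asym f F.
Proof.
move=> [M [t [t0 [Fb H]]]] N.
exists (\poly_(i < N) \poly_(j < N - i) F i j) => [i j ij|].
  rewrite coef_poly (leq_ltn_trans (leq_addr j i) ij) coef_poly.
  by rewrite ltn_subRL ij.
have M0 : 0 <= M.
  by have := Fb 0%N 0%N; rewrite expr0 mulr1; apply: le_trans (nc_ge0 _).
exists (M * t ^+ N), t^-1; split.
- by rewrite mulr_ge0// exprn_ge0// ltW.
- by rewrite invr_gt0.
move=> x y rho xr yr rt.
have -> : eval2 (\poly_(i < N) \poly_(j < N - i) F i j) x y = partial_sum F N x y.
  rewrite partial_sum_triangle /eval2 horner_poly horner_sum; apply: eq_bigr => i _.
  by rewrite hornerM -rmorphXn hornerC horner_poly.
rewrite -mulrA -exprMn; apply: H => //.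
by rewrite mulrC -ler_pdivlMr// mul1r.
Qed.

Lemma expands_eq f g F : expands f F -> expands g F ->
  exists2 r : R, 0 < r & forall x y, nc x < r -> nc y < r -> f x y = g x y.
Proof.
move=> [M [t [t0 [_ Hf]]]] [M' [t' [t'0 [_ Hg]]]].
pose s := t + t'; have s0 : 0 < s by rewrite addr_gt0.
pose r := (2 * s)^-1; have r0 : 0 < r by rewrite invr_gt0 mulr_gt0.
have sr : s * r = 1 / 2 by rewrite /r; field; rewrite gt_eqF.
exists r => // x y xr yr; apply/eqP; rewrite -subr_eq0; apply/eqP.
apply: nc_eps => e e0.
have tr : t * r <= 1 / 2 by rewrite -sr ler_wpM2r ?(ltW r0)//= lerDl ltW.
have t'r : t' * r <= 1 / 2 by rewrite -sr ler_wpM2r ?(ltW r0)//= lerDr ltW.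
have MM : 0 <= `|M| + `|M'| by rewrite addr_ge0.
have [n ne] := half_pow_lt MM e0.
have := Hf x y r n (ltW xr) (ltW yr) (ltac:(lra)).
have := Hg x y r n (ltW xr) (ltW yr) (ltac:(lra)).
have hp : (1 / 2) ^+ n = (2 ^+ n)^-1 :> R by rewrite mul1r exprVn.
have tr0 : 0 <= t * r by rewrite mulr_ge0// ltW.
have t'r0 : 0 <= t' * r by rewrite mulr_ge0// ltW.
have b1 : M * (t * r) ^+ n <= `|M| / 2 ^+ n.
  apply: (@le_trans _ _ (`|M| * (t * r) ^+ n)).
    by rewrite ler_wpM2r ?ler_norm// exprn_ge0.
  by rewrite ler_wpM2l// -hp lerXn2r// nnegrE; lra.
have b2 : M' * (t' * r) ^+ n <= `|M'| / 2 ^+ n.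
  apply: (@le_trans _ _ (`|M'| * (t' * r) ^+ n)).
    by rewrite ler_wpM2r ?ler_norm// exprn_ge0.
  by rewrite ler_wpM2l// -hp lerXn2r// nnegrE; lra.
have -> : f x y - g x y = (f x y - partial_sum F n x y) - (g x y - partial_sum F n x y).
  by ring.
have := ncB (f x y - partial_sum F n x y) (g x y - partial_sum F n x y).
move: ne; rewrite mulrDl => ne.
lra.
Qed.
End AsymptoticExpansion.

(** * Sums of convergent series and termwise differentiation *)

Section ConvergentSum.
Context {R : realType}.
Local Notation C := R[i].
Implicit Types (F G : fps (fps C)) (f g : C -> C -> C) (x y z w : C).

Lemma complex_limit (S : nat -> C) (M : R) :
  (forall n, nc (S n.+1 - S n) <= M / 2 ^+ n) ->
  exists l, forall n, nc (l - S n) <= 8 * M / 2 ^+ n.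
Proof.
move=> SM.
have real_limit (s : nat -> R) : (forall n, `|s n.+1 - s n| <= M / 2 ^+ n) ->
    exists l, forall n, `|l - s n| <= 4 * M / 2 ^+ n.
  move=> sM; pose e n := M / 2 ^+ n.
  have e0 n : 0 <= e n by apply: le_trans (sM n).
  have eS n : e n.+1 = e n / 2 by rewrite /e exprSr invfM mulrA.
  (* The intervals of radius 2 e_n about s_n are nested, because e_(n+1) = e_n / 2 and consecutive
     terms differ by at most e_n. *)
  have [|||p pP] := @nested_intervals _ (fun n => s n - 2 * e n) (fun n => 4 * e n).
  - by move=> n; have := sM n; rewrite -/(e n) ler_norml eS => /andP[]; lra.
  - by move=> n; have := sM n; rewrite -/(e n) ler_norml eS => /andP[]; lra.
  - by move=> n; rewrite mulr_ge0.
  exists p => n; have /andP[] := pP n; rewrite -mulrA -/(e n) ler_norml => a b.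
  by have en := e0 n; apply/andP; split; lra.
have [a aP] := real_limit (fun n => complex.Re (S n))
  (fun n => ltac:(by apply: le_trans (SM n); rewrite -ReN -ReD; exact: nc_Re)).
have [b bP] := real_limit (fun n => complex.Im (S n))
  (fun n => ltac:(by apply: le_trans (SM n); rewrite -ImN -ImD; exact: nc_Im)).
exists (Complex a b) => n; apply: le_trans (nc_ReIm _) _.
rewrite !ReD !ImD !ReN !ImN /=; have := aP n; have := bP n.
by rewrite -!mulrA; lra.
Qed.

Lemma homog_bound F (M t : R) d x y (rho : R) : 0 < t ->
  (forall i j, nc (F i j) <= M * t ^+ (i + j)) -> nc x <= rho -> nc y <= rho ->
  nc (homog F d x y) <= M * (2 * t * rho) ^+ d.
Proof.
move=> t0 Fb xr yr; have rho0 : 0 <= rho by apply: le_trans (nc_ge0 x) xr.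
have M0 : 0 <= M.
  by have := Fb 0%N 0%N; rewrite expr0 mulr1; apply: le_trans (nc_ge0 _).
have B (i : 'I_d.+1) : nc (F i (d - i)%N * x ^+ i * y ^+ (d - i)) <= M * (t * rho) ^+ d.
  have id : (i <= d)%N by rewrite -ltnS.
  have Fid := Fb i (d - i)%N; rewrite subnKC// in Fid.
  rewrite -mulrA ncM exprMn mulrA; apply: ler_pM; rewrite ?nc_ge0//.
  rewrite ncM !ncX -[in leRHS](subnKC id) exprD.
  by apply: ler_pM; rewrite ?exprn_ge0 ?nc_ge0// lerXn2r// nnegrE ?nc_ge0.
apply: le_trans (nc_sum _ _ _) _.
apply: (@le_trans _ _ (\sum_(i < d.+1) M * (t * rho) ^+ d)); first exact: ler_sum.
rewrite sumr_const card_ord.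
have -> : (M * (t * rho) ^+ d) *+ d.+1 = M * (d.+1%:R * (t * rho) ^+ d) by ring.
rewrite ler_wpM2l// -[2 * t * rho]mulrA [leRHS]exprMn ler_wpM2r ?succ_le_exp2// exprn_ge0//.
by rewrite mulr_ge0// ltW.
Qed.

Lemma convergent_expands F : convergent F -> exists f, expands f F.
Proof.
move=> [M [t [t0 Fb]]].
have M0 : 0 <= M.
  by have := Fb 0%N 0%N; rewrite expr0 mulr1; apply: le_trans (nc_ge0 _).
have step x y rho d : nc x <= rho -> nc y <= rho ->
    nc (partial_sum F d.+1 x y - partial_sum F d x y) <= M * (2 * t * rho) ^+ d.
  by move=> xr yr; rewrite /partial_sum big_ord_recr /= addrAC subrr add0r; exact: homog_bound.
have /choice[f fP] : forall xy : C * C, exists l, forall (rho : R),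
    nc xy.1 <= rho -> nc xy.2 <= rho -> 4 * t * rho <= 1 ->
    forall n, nc (l - partial_sum F n xy.1 xy.2) <= 8 * M / 2 ^+ n.
  move=> [x y] /=; have [[rho [xr yr tr]]|no] :=
    pselect (exists rho : R, [/\ nc x <= rho, nc y <= rho & 4 * t * rho <= 1]).
    have rho0 : 0 <= rho by apply: le_trans (nc_ge0 x) xr.
    have [|l lP] := @complex_limit (fun n => partial_sum F n x y) M.
      move=> n; apply: le_trans (step x y rho n xr yr) _.
      rewrite ler_wpM2l// -exprVn lerXn2r// ?nnegrE ?invr_ge0//; last by lra.
      by rewrite !mulr_ge0// ltW.
    by exists l.
  by exists 0 => rho xr yr tr; exfalso; apply: no; exists rho.
exists (fun x y => f (x, y)), (2 * M), (4 * t).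
split; first by rewrite mulr_gt0.
split=> [i j|x y rho N xr yr tr].
  apply: (@le_trans _ _ (M * t ^+ (i + j))) => //.
  apply: ler_pM => //; first by rewrite exprn_ge0// ltW.
    by lra.
  by rewrite lerXn2r ?nnegrE//; lra.
have rho0 : 0 <= rho by apply: le_trans (nc_ge0 x) xr.
pose q := 2 * t * rho.
have q0 : 0 <= q by rewrite !mulr_ge0// ltW.
have q2 : q <= 1 / 2 by rewrite /q; lra.
have tail k : nc (partial_sum F (N + k) x y - partial_sum F N x y) <=
    2 * M * q ^+ N * (1 - 2^-1 ^+ k).
  elim: k => [|k IH]; first by rewrite addn0 subrr nc0 expr0 subrr mulr0.
  rewrite addnS.
  have -> : partial_sum F (N + k).+1 x y - partial_sum F N x y =
    (partial_sum F (N + k).+1 x y - partial_sum F (N + k) x y) +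
    (partial_sum F (N + k) x y - partial_sum F N x y) by ring.
  apply: le_trans (ncD _ _) _.
  have s1 : nc (partial_sum F (N + k).+1 x y - partial_sum F (N + k) x y) <=
      M * q ^+ N * 2^-1 ^+ k.
    apply: le_trans (step x y rho _ xr yr) _.
    rewrite -/q exprD mulrA ler_wpM2l ?mulr_ge0 ?exprn_ge0//.
    by rewrite lerXn2r ?nnegrE//; lra.
  move: IH s1; rewrite exprS; move: (2^-1 ^+ k) => a; lra.
(* The limit is known only up to 8M / 2^n, with no power of rho. It is therefore used at N + k with
   k large, and the geometric tail supplies q^N. *)
have B : nc (f (x, y) - partial_sum F N x y) <= 2 * M * q ^+ N.
  apply/ler_addgt0Pl => e e0.
  have M8 : 0 <= 8 * M by rewrite mulr_ge0.
  have [k ke] := half_pow_lt M8 e0.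
  have H := fP (x, y) rho xr yr tr (N + k)%N; rewrite /= in H.
  have H2 : 8 * M / 2 ^+ (N + k) <= e.
    apply: le_trans (ltW ke); rewrite ler_wpM2l// lef_pV2 ?posrE ?exprn_gt0//.
    by rewrite ler_weXn2l ?ler1n// leq_addl.
  have H3 : 2 * M * q ^+ N * (1 - 2^-1 ^+ k) <= 2 * M * q ^+ N.
    rewrite ler_piMr// ?mulr_ge0 ?exprn_ge0// lerBlDr lerDl exprn_ge0//.
  have -> : f (x, y) - partial_sum F N x y =
    (f (x, y) - partial_sum F (N + k) x y) +
    (partial_sum F (N + k) x y - partial_sum F N x y) by ring.
  apply: le_trans (ncD _ _) _; have := tail k; lra.
apply: le_trans B _; rewrite ler_wpM2l ?mulr_ge0// lerXn2r ?nnegrE//.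
  by rewrite !mulr_ge0// ltW.
by rewrite /q !ler_wpM2r ?(ltW t0)//; lra.
Qed.

Definition frechet f x y (A B : C) := forall e : R, 0 < e ->
  exists2 d : R, 0 < d & forall h k, nc h < d -> nc k < d ->
    nc (f (x + h) (y + k) - f x y - (A * h + B * k)) <= e * (nc h + nc k).

Section MonomialDifference.
Variables (x y h k : C) (rho eta : R).
Hypotheses (eta0 : 0 <= eta) (xr : nc x <= rho) (yr : nc y <= rho).
Hypotheses (xhr : nc (x + h) <= rho) (ykr : nc (y + k) <= rho).
Hypotheses (hr : nc h <= rho * eta) (kr : nc k <= rho * eta).

Let rho0 : 0 <= rho. Proof. exact: le_trans (nc_ge0 x) xr. Qed.

(** An invariant of products of n factors of size rho, each perturbed by at most rho eta: size,
    first difference, and error of the linear part [D]. One more factor is absorbed because n^2 + n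
    <= (n + 1)^2. *)
Let near_linear n (m m' D : C) := [/\ nc m <= rho ^+ n,
  nc (m' - m) <= n%:R * rho ^+ n * eta &
  nc (m' - m - D) <= n%:R ^+ 2 * rho ^+ n * eta ^+ 2].

Let near_linearM n m m' D z s : nc z <= rho -> nc (z + s) <= rho ->
  nc s <= rho * eta -> near_linear n m m' D ->
  near_linear n.+1 (z * m) ((z + s) * m') (z * D + s * m).
Proof.
move=> zr zsr sr [H1 H2 H3]; have n0 : 0 <= n%:R :> R by [].
have r0 : 0 <= rho ^+ n by rewrite exprn_ge0.
split.
- by rewrite ncM exprS ler_pM ?nc_ge0.
- rewrite (_ : _ - _ = (z + s) * (m' - m) + s * m); last by ring.
  apply: le_trans (ncD _ _) _; rewrite !ncM exprS -natr1.
  rewrite [leRHS](_ : _ = rho * (n%:R * rho ^+ n * eta) + rho * eta * rho ^+ n); last by ring.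
  by apply: lerD; apply: ler_pM; rewrite ?nc_ge0.
rewrite (_ : _ - _ = z * (m' - m - D) + s * (m' - m)); last by ring.
apply: le_trans (ncD _ _) _; rewrite !ncM.
apply: (@le_trans _ _ (rho * (n%:R ^+ 2 * rho ^+ n * eta ^+ 2) +
    rho * eta * (n%:R * rho ^+ n * eta))).
  by apply: lerD; apply: ler_pM; rewrite ?nc_ge0.
rewrite [rho ^+ n.+1]exprS -natr1 -subr_ge0.
rewrite [X in 0 <= X](_ : _ = (n%:R + 1) * (rho * rho ^+ n * eta ^+ 2)); last by ring.
by rewrite !mulr_ge0 ?addr_ge0 ?exprn_ge0.
Qed.

Lemma monomial_difference i j :
  nc ((x + h) ^+ i * (y + k) ^+ j - x ^+ i * y ^+ j -
    (x ^+ i.-1 *+ i * y ^+ j * h + x ^+ i * (y ^+ j.-1 *+ j) * k)) <=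
  (i + j)%:R ^+ 2 * rho ^+ (i + j) * eta ^+ 2.
Proof.
suff : near_linear (i + j) (x ^+ i * y ^+ j) ((x + h) ^+ i * (y + k) ^+ j)
    (x ^+ i.-1 *+ i * y ^+ j * h + x ^+ i * (y ^+ j.-1 *+ j) * k) by case.
elim: i => [|i IH].
  elim: j => [|j IH].
    have -> : x ^+ 0.-1 *+ 0 * y ^+ 0 * h + x ^+ 0 * (y ^+ 0.-1 *+ 0) * k = 0.
      by rewrite !mulr0n; ring.
    split; rewrite !expr0 ?mulr1 ?subrr ?subr0 ?nc1 ?nc0// mulr0n ?expr0n.
      by rewrite !mul0r.
    by rewrite !mul0r.
  have := near_linearM yr ykr kr IH; rewrite !add0n; congr near_linear.
  - by rewrite exprS; ring.
  - by rewrite exprS; ring.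
  - case: j {IH} => [|j]; first by rewrite !expr0; ring.
    by rewrite /= !exprS -[j.+2]add1n; ring.
have := near_linearM xr xhr hr IH; rewrite addSn; congr near_linear.
- by rewrite exprS; ring.
- by rewrite exprS; ring.
case: i {IH} => [|i]; first by rewrite !expr0 /=; ring.
by rewrite /= !exprS -[i.+2]add1n; ring.
Qed.

End MonomialDifference.
End ConvergentSum.

Section TermwiseDerivative.
Context {R : realType}.
Local Notation C := R[i].
Implicit Types (F G : fps (fps C)) (f g : C -> C -> C) (x y z w : C).

Lemma dx_coef F i j : dx F i j = F i.+1 j *+ i.+1.
Proof.
rewrite /dx /fpsD; elim: i.+1 {1 3}(i.+1) => [|n IH] m; first by rewrite !mulr0n.
by rewrite !mulrS fps_addE IH.
Qed.

Lemma convergent_dx F : convergent F -> convergent (dx F).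
Proof.
move=> [M [t [t0 Fb]]]; exists (M * t), (2 * t).
split=> [|i j]; first by rewrite mulr_gt0.
have M0 : 0 <= M.
  by have := Fb 0%N 0%N; rewrite expr0 mulr1; apply: le_trans (nc_ge0 _).
rewrite dx_coef ncMn -[_ *+ i.+1]mulr_natl exprMn.
have := Fb i.+1 j; rewrite addSn exprS => H.
apply: (@le_trans _ _ (2 ^+ (i + j) * (M * (t * t ^+ (i + j))))); last first.
  by rewrite le_eqVlt; apply/orP; left; apply/eqP; ring.
apply: ler_pM => //; first exact: nc_ge0.
by rewrite (le_trans (succ_le_exp2 i))// ler_weXn2l ?ler1n// leq_addr.
Qed.

Lemma convergent_dy F : convergent F -> convergent (dy F).
Proof.
move=> [M [t [t0 Fb]]]; exists (M * t), (2 * t).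
split=> [|i j]; first by rewrite mulr_gt0.
have M0 : 0 <= M.
  by have := Fb 0%N 0%N; rewrite expr0 mulr1; apply: le_trans (nc_ge0 _).
have -> : dy F i j = F i j.+1 *+ j.+1 by [].
rewrite ncMn -[_ *+ j.+1]mulr_natl exprMn.
have := Fb i j.+1; rewrite addnS exprS => H.
apply: (@le_trans _ _ (2 ^+ (i + j) * (M * (t * t ^+ (i + j))))); last first.
  by rewrite le_eqVlt; apply/orP; left; apply/eqP; ring.
apply: ler_pM => //; first exact: nc_ge0.
by rewrite (le_trans (succ_le_exp2 j))// ler_weXn2l ?ler1n// leq_addl.
Qed.

Lemma partial_sum_derivative F N x y h k :
  \sum_(d < N.+1) \sum_(i < d.+1) F i (d - i)%N *
    (x ^+ i.-1 *+ i * y ^+ (d - i) * h +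
     x ^+ i * (y ^+ (d - i).-1 *+ (d - i)) * k) =
  partial_sum (dx F) N x y * h + partial_sum (dy F) N x y * k.
Proof.
rewrite big_ord_recl big_ord1 /= subnn !mulr0n.
rewrite (_ : F 0%N 0%N * _ = 0) ?add0r; last by ring.
rewrite /partial_sum !mulr_suml -big_split; apply: eq_bigr => d _ /=.
rewrite /homog !mulr_suml.
transitivity (\sum_(i < d.+2) F i (d.+1 - i)%N * (x ^+ i.-1 *+ i * y ^+ (d.+1 - i) * h) +
  \sum_(i < d.+2) F i (d.+1 - i)%N * (x ^+ i * (y ^+ (d.+1 - i).-1 *+ (d.+1 - i)) * k)).
  by rewrite -big_split; apply: eq_bigr => i _; rewrite /= mulrDr.
congr (_ + _).
  rewrite big_ord_recl /= mulr0n !mul0r mulr0 add0r; apply: eq_bigr => i _.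
  by rewrite dx_coef subSS /= /bump leq0n add1n add0n; ring.
rewrite big_ord_recr /= subnn mulr0n mulr0 mul0r mulr0 addr0; apply: eq_bigr => i _.
have id : (i <= d)%N by rewrite -ltnS.
by rewrite subSn// (_ : dy F i (d - i)%N = F i (d - i).+1 *+ (d - i).+1)//=; ring.
Qed.

Lemma expands_rate f F : expands f F -> exists M t : R, [/\ 0 <= M, 0 < t &
  forall x y (rho : R) N, nc x <= rho -> nc y <= rho -> t * rho <= 1 / 2 ->
    nc (f x y - partial_sum F N x y) <= M / 2 ^+ N].
Proof.
move=> [M [t [t0 [Fb H]]]]; exists M, t.
have M0 : 0 <= M.
  by have := Fb 0%N 0%N; rewrite expr0 mulr1; apply: le_trans (nc_ge0 _).
split=> // x y rho N xr yr tr.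
have rho0 : 0 <= rho by apply: le_trans (nc_ge0 x) xr.
have tr0 : 0 <= t * rho by rewrite mulr_ge0// ltW.
apply: le_trans (H x y rho N xr yr _) _; first lra.
by rewrite ler_wpM2l// -exprVn lerXn2r// ?nnegrE ?invr_ge0//; lra.
Qed.

(** A second-order error independent of N. In degree d the monomials cost (d + 1) d^2, at most 8^d;
    with 8 t rho <= 1/2 the degrees sum to the factor 2. *)
Lemma partial_sum_difference F (M t rho eta : R) N x y h k :
  0 < t -> (forall i j, nc (F i j) <= M * t ^+ (i + j)) ->
  0 <= eta -> nc x <= rho -> nc y <= rho ->
  nc (x + h) <= rho -> nc (y + k) <= rho ->
  nc h <= rho * eta -> nc k <= rho * eta -> 8 * t * rho <= 1 / 2 ->
  nc (partial_sum F N.+1 (x + h) (y + k) - partial_sum F N.+1 x y -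
    (partial_sum (dx F) N x y * h + partial_sum (dy F) N x y * k)) <=
  2 * M * eta ^+ 2.
Proof.
move=> t0 Fb eta0 xr yr xhr ykr hr kr t8.
have rho0 : 0 <= rho by apply: le_trans (nc_ge0 x) xr.
have M0 : 0 <= M.
  by have := Fb 0%N 0%N; rewrite expr0 mulr1; apply: le_trans (nc_ge0 _).
have e20 : 0 <= eta ^+ 2 by rewrite exprn_ge0.
have tr0 : 0 <= t * rho by rewrite mulr_ge0// ltW.
rewrite -partial_sum_derivative /partial_sum /homog -!sumrB.
apply: le_trans (nc_sum _ _ _) _.
apply: (@le_trans _ _ (\sum_(d < N.+1) M * eta ^+ 2 * 2^-1 ^+ d)); last first.
  have E n : \sum_(d < n) 2^-1 ^+ d = 2 - 2 * 2^-1 ^+ n :> R.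
    elim: n => [|n IH]; first by rewrite big_ord0 expr0; lra.
    by rewrite big_ord_recr /= IH exprS; lra.
  rewrite -mulr_sumr E.
  have : 0 <= M * eta ^+ 2 * 2^-1 ^+ N.+1 by rewrite !mulr_ge0// exprn_ge0.
  lra.
apply: ler_sum => d _; rewrite -!sumrB; apply: le_trans (nc_sum _ _ _) _.
apply: (@le_trans _ _ (\sum_(i < d.+1) M * t ^+ d * (d%:R ^+ 2 * rho ^+ d * eta ^+ 2))).
  apply: ler_sum => i _; have id : (i <= d)%N by rewrite -ltnS.
  have := monomial_difference eta0 xr yr xhr ykr hr kr i (d - i).
  rewrite subnKC//; set D := _ - _ - _ => Db.
  rewrite [X in nc X](_ : _ = F i (d - i)%N * D); last by rewrite /D; ring.
  rewrite ncM; apply: ler_pM => //; first exact: nc_ge0; first exact: nc_ge0.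
  by have := Fb i (d - i)%N; rewrite subnKC.
rewrite sumr_const card_ord.
have -> : M * t ^+ d * (d%:R ^+ 2 * rho ^+ d * eta ^+ 2) *+ d.+1 =
    M * eta ^+ 2 * ((d.+1%:R * d%:R ^+ 2) * (t * rho) ^+ d).
  by rewrite exprMn; ring.
apply: ler_wpM2l; first exact: mulr_ge0.
apply: (@le_trans _ _ ((8 * t * rho) ^+ d)); last first.
  by rewrite lerXn2r// ?nnegrE ?invr_ge0// -?mulrA ?mulr_ge0//; lra.
rewrite -[8 * t * rho]mulrA [leRHS]exprMn; apply: ler_wpM2r; first exact: exprn_ge0.
have -> : 8 ^+ d = 2 ^+ d * (2 ^+ d) ^+ 2 :> R.
  rewrite -exprS -exprM mulnC exprM; congr (_ ^+ _).
  by rewrite !exprS expr0; lra.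
apply: ler_pM => //; first exact: succ_le_exp2.
rewrite lerXn2r// ?nnegrE ?exprn_ge0// (le_trans _ (succ_le_exp2 d))//.
by rewrite ler_nat.
Qed.

(** The difference quotient of a partial sum is controlled uniformly in the truncation order;
    letting that order grow for fixed h and k gives the estimate for f itself. *)
Lemma convergent_derivative F : convergent F ->
  exists f g g', [/\ expands f F, expands g (dx F), expands g' (dy F) &
    exists2 r : R, 0 < r & forall x y, nc x < r -> nc y < r ->
      frechet f x y (g x y) (g' x y)].
Proof.
move=> cF; have [f fF] := convergent_expands cF.
have [g gF] := convergent_expands (convergent_dx cF).
have [g' g'F] := convergent_expands (convergent_dy cF).
exists f, g, g'; split=> //; move: cF => [M [t [t0 Fb]]].
have M0 : 0 <= M.
  by have := Fb 0%N 0%N; rewrite expr0 mulr1; apply: le_trans (nc_ge0 _).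
have [M1 [t1 [M10 t10 H1]]] := expands_rate fF.
have [M2 [t2 [M20 t20 H2]]] := expands_rate gF.
have [M3 [t3 [M30 t30 H3]]] := expands_rate g'F.
pose T := t + t1 + t2 + t3; have T0 : 0 < T by rewrite !addr_gt0.
have [rho rho0 Tr] : exists2 rho : R, 0 < rho & 16 * (T * rho) = 1.
  exists (16 * T)^-1; first by rewrite invr_gt0 mulr_gt0.
  by rewrite mulrA divff// gt_eqF// mulr_gt0.
have tle s : 0 < s -> s <= T -> 16 * (s * rho) <= 1.
  move=> s0 sT; apply: (@le_trans _ _ (16 * (T * rho))); last by rewrite Tr.
  by rewrite ler_wpM2l// ler_wpM2r// ltW.
have tt : 16 * (t * rho) <= 1 by apply: tle => //; rewrite /T; lra.
have tt1 : 16 * (t1 * rho) <= 1 by apply: tle => //; rewrite /T; lra.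
have tt2 : 16 * (t2 * rho) <= 1 by apply: tle => //; rewrite /T; lra.
have tt3 : 16 * (t3 * rho) <= 1 by apply: tle => //; rewrite /T; lra.
exists (rho / 2) => [|x y xr yr e e0]; first by rewrite divr_gt0.
have rho20 : 0 < rho ^+ 2 by rewrite exprn_gt0.
(* With s = |h| + |k| and eta = s / rho, the last bound gives s (2M + 1) <= e rho^2, hence 2M eta^2
   <= e s. *)
pose d0 := Num.min (Num.min (rho / 2) 1) (e * rho ^+ 2 / (2 * (2 * M + 1))).
exists d0 => [|h k].
  by rewrite !lt_min divr_gt0// ltr01 divr_gt0 ?mulr_gt0// ltr_wpDl ?mulr_ge0.
rewrite !lt_min => /andP[/andP[hr h1] hd] /andP[/andP[kr k1] kd].
pose s := nc h + nc k; have s0 : 0 <= s by rewrite addr_ge0 ?nc_ge0.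
pose eta := s / rho.
have eta0 : 0 <= eta by rewrite divr_ge0// ltW.
have re : rho * eta = s by rewrite /eta mulrC divfK// gt_eqF.
have [h0 k0] : 0 <= nc h /\ 0 <= nc k by rewrite !nc_ge0.
have xhr : nc (x + h) <= rho by have := ncD x h; clear -xr hr; lra.
have ykr : nc (y + k) <= rho by have := ncD y k; clear -yr kr; lra.
have xr' : nc x <= rho by clear -xr rho0; lra.
have yr' : nc y <= rho by clear -yr rho0; lra.
apply: (@le_trans _ _ (2 * M * eta ^+ 2)); last first.
  have sd : s * (2 * M + 1) <= e * rho ^+ 2.
    rewrite -ler_pdivlMr; last by rewrite ltr_wpDl ?mulr_ge0.
    have E : e * rho ^+ 2 / (2 * M + 1) = 2 * (e * rho ^+ 2 / (2 * (2 * M + 1))).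
      by field; rewrite gt_eqF// ltr_wpDl ?mulr_ge0.
    by rewrite E /s; clear -hd kd; lra.
  rewrite /eta expr_div_n mulrA ler_pdivrMr//.
  have ss : 0 <= s * s by rewrite mulr_ge0.
  have ssd := ler_wpM2l s0 sd; rewrite -/s.
  rewrite [2 * M * _](_ : _ = s * (s * (2 * M + 1)) - s * s); last by ring.
  rewrite [leRHS](_ : _ = s * (e * rho ^+ 2)); last by ring.
  by clear -ss ssd; lra.
apply/ler_addgt0Pl => e' e'0.
have MM : 0 <= 2 * M1 + M2 + M3 by rewrite !addr_ge0// mulr_ge0.
have [n ne] := half_pow_lt MM e'0.
have c1 : t1 * rho <= 1 / 2 by clear -tt1; lra.
have c2 : t2 * rho <= 1 / 2 by clear -tt2; lra.
have c3 : t3 * rho <= 1 / 2 by clear -tt3; lra.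
have A1 := H1 _ _ rho n.+1 xhr ykr c1.
have A2 := H1 _ _ rho n.+1 xr' yr' c1.
have A3 := H2 _ _ rho n xr' yr' c2.
have A4 := H3 _ _ rho n xr' yr' c3.
have hr' : nc h <= rho * eta by rewrite re lerDl.
have kr' : nc k <= rho * eta by rewrite re lerDr.
have t8 : 8 * t * rho <= 1 / 2 by clear -tt; lra.
have D := @partial_sum_difference F M t rho eta n x y h k t0 Fb eta0 xr' yr' xhr ykr hr' kr' t8.
set S' := partial_sum F n.+1 (x + h) (y + k) in A1 D.
set S := partial_sum F n.+1 x y in A2 D.
set Sx := partial_sum (dx F) n x y in A3 D.
set Sy := partial_sum (dy F) n x y in A4 D.
rewrite (_ : _ - _ = (S' - S - (Sx * h + Sy * k)) + ((f (x + h) (y + k) - S') -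
  (f x y - S) - ((g x y - Sx) * h + (g' x y - Sy) * k))); last by ring.
apply: le_trans (ncD _ _) _; rewrite addrC; apply: lerD => //.
apply: le_trans (ncB _ _) _.
have B1 := ncB (f (x + h) (y + k) - S') (f x y - S).
have B2 := ncD ((g x y - Sx) * h) ((g' x y - Sy) * k).
have B3 : nc ((g x y - Sx) * h) <= M2 / 2 ^+ n.
  by rewrite ncM -[leRHS]mulr1; apply: ler_pM; rewrite ?nc_ge0// ltW.
have B4 : nc ((g' x y - Sy) * k) <= M3 / 2 ^+ n.
  by rewrite ncM -[leRHS]mulr1; apply: ler_pM; rewrite ?nc_ge0// ltW.
have B5 : M1 / 2 ^+ n.+1 <= M1 / 2 ^+ n.
  rewrite ler_wpM2l// lef_pV2 ?posrE ?exprn_gt0//.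
  by rewrite ler_weXn2l ?ler1n.
rewrite !mulrDl in ne; clear -A1 A2 B1 B2 B3 B4 B5 ne; lra.
Qed.
End TermwiseDerivative.

(** * Germs of functions and vector fields *)

Section GermBridge.
Context {R : realType}.
Local Notation C := R[i].
Implicit Types (x y z w : C).

Lemma near0_nc (P : CC2 R -> Prop) : (\forall p \near (0 : CC2 R), P p) <->
  exists2 r : R, 0 < r & forall x y, nc x < r -> nc y < r -> P (x, y).
Proof.
split=> [/nbhs_normP[e /= /gt0_complex[r r0 ->] H]|[d d0 H]].
  exists r => // x y xr yr; apply: H; rewrite /= sub0r normrN prod_normE /=.
  by rewrite !norm_nc comparable_gt_max ?ltcR ?xr// /Order.comparable !lecR le_total.
apply: (proj2 (nbhs_normP _ _)); exists d%:C%C; first by rewrite /= ltcR.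
move=> [x y] /=; rewrite sub0r normrN prod_normE /= !norm_nc.
rewrite comparable_gt_max ?ltcR; last by rewrite /Order.comparable !lecR le_total.
by move=> /andP[]; exact: H.
Qed.

Let norm_le_sum x y : `|(x, y) : CC2 R| <= (nc x + nc y)%:C%C.
Proof.
rewrite prod_normE /= !norm_nc comparable_ge_max; last by rewrite /Order.comparable !lecR le_total.
by rewrite !lecR lerDl lerDr !nc_ge0.
Qed.

Let norm_ge_sum x y : (nc x + nc y)%:C%C <= 2 * `|(x, y) : CC2 R|.
Proof.
rewrite prod_normE /= !norm_nc mulr_natl mulr2n rmorphD.
have cmp : ((nc x)%:C%C : C) >=< (nc y)%:C%C by rewrite /Order.comparable !lecR le_total.
by apply: lerD; rewrite comparable_le_max// lexx ?orbT.
Qed.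

Lemma differentiable_expansion (W : normedModType C) (f : CC2 R -> W) (p : CC2 R) :
  differentiable f p -> exists A B : W,
  (forall v : CC2 R, 'D_v f p = v.1 *: A + v.2 *: B) /\
  forall e : R, 0 < e -> exists2 d : R, 0 < d & forall h k, nc h < d -> nc k < d ->
    `|f (p.1 + h, p.2 + k) - f p - (h *: A + k *: B)| <= (e * (nc h + nc k))%:C%C.
Proof.
move=> df; exists ('d f p (1, 0)), ('d f p (0, 1)).
have lin v : 'd f p v = v.1 *: 'd f p (1, 0) + v.2 *: 'd f p (0, 1).
  rewrite -!linearZ -linearD; congr ('d f p _); case: v => h k.
  transitivity ((h * 1 + k * 0, h * 0 + k * 1) : CC2 R); last by [].
  by rewrite !mulr1 !mulr0 addr0 add0r.
split=> [v|e e0]; first by rewrite deriveE// lin.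
have /eqaddoP/(_ e%:C%C) := diff_locally df.
rewrite ltcR => /(_ e0)/near0_nc[d d0 H]; exists d => // h k hd kd.
have := H h k hd kd; rewrite /= => {}H.
rewrite rmorphM; apply: (@le_trans _ _ (e%:C%C * `|(h, k) : CC2 R|)); last first.
  by apply: ler_wpM2l; [rewrite ler0c ltW|exact: norm_le_sum].
move: H; congr (`|_| <= _).
rewrite -[h *: _ + k *: _](lin (h, k)) opprD addrA; congr (_ - _); congr (f _ - _).
by rewrite addrC; case: p {df lin}.
Qed.

Definition linear_form (A B : CC R) (v : CC2 R) : CC R := v.1 *: A + v.2 *: B.

Fact linear_form_linear A B : linear (linear_form A B).
Proof.
move=> c u v; rewrite /linear_form /= !scalerDl !scalerDr !scalerA.
by rewrite addrACA.
Qed.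

HB.instance Definition _ A B :=
  GRing.isLinear.Build C (CC2 R) (CC R) *:%R (linear_form A B)
    (linear_form_linear A B).

Lemma frechet_differentiable (f : CC2 R -> CC R) (p : CC2 R) (A B : C) :
  frechet (fun x y => f (x, y)) p.1 p.2 A B ->
  differentiable f p /\ forall v : CC2 R, 'D_v f p = v.1 * A + v.2 * B.
Proof.
move=> fr.
have cl : continuous (linear_form A B).
  move=> v; rewrite /linear_form; apply: cvgD.
    by apply: cvgZr_tmp; exact: cvg_fst.
  by apply: cvgZr_tmp; exact: cvg_snd.
have L (e : C) : 0 < e -> \forall v \near (0 : CC2 R),
    `|f (v + p) - (f p + linear_form A B v)| <= e * `|v|.
  (* Half of the tolerance pays for replacing |h| + |k| by the maximum norm. *)
  move=> /gt0_complex[r r0 ->]; have r20 : 0 < r / 2 by rewrite divr_gt0.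
  have [d d0 H] := fr _ r20; apply/near0_nc; exists d => // h k hd kd.
  have {}H := H h k hd kd; have := norm_ge_sum h k.
  have rc : 0 < (r / 2)%:C%C :> C by rewrite ltcR.
  rewrite -(ler_pM2l rc) => N.
  rewrite (_ : r%:C%C * _ = (r / 2)%:C%C * (2 * `|(h, k) : CC2 R|)); last first.
    by rewrite mulrA; congr (_ * _); rewrite -(rmorph_nat (real_complex R)) -rmorphM divfK.
  apply: le_trans N; rewrite -rmorphM norm_nc lecR; apply: le_trans H.
  have -> : (h, k) + p = (p.1 + h, p.2 + k) :> CC2 R.
    by case: (p) => x y; rewrite /= [x + h]addrC [y + k]addrC.
  have -> : f p = f (p.1, p.2) by case: (p).
  have -> : linear_form A B (h, k) = A * h + B * k.
    by rewrite [A * h]mulrC [B * k]mulrC.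
  by rewrite opprD addrA.
have dE : 'd f p = linear_form A B :> (CC2 R -> CC R).
  apply: (@diff_unique C (CC2 R : normedModType C) (CC R : normedModType C)
    f (linear_form A B) p cl).
  by apply/eqaddoP => e e0; exact: L.
have df : differentiable f p.
  apply: (proj2 (@diff_locallyP C (CC2 R : normedModType C) (CC R : normedModType C) p f)).
  by rewrite dE; split => //; apply/eqaddoP => e e0; exact: L.
by split=> // v; rewrite deriveE// dE.
Qed.
End GermBridge.

(** * Calculus of expansions of holomorphic functions *)

Section HolomorphicGerms.
Context {R : realType}.
Local Notation C := R[i].
Implicit Types (F G : fps (fps C)) (f g : C -> C -> C) (x y z w : C).

(* By [expansion_exists], separate differentiability together with boundedness
   is enough for analyticity. *)
Definition hol f := exists r M : R, 0 < r /\ forall x y, nc x < r -> nc y < r ->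
  [/\ exists A, cdiff (fun x' => f x' y) x A, exists A, cdiff (f x) y A &
      nc (f x y) <= M].

Lemma expands_convergent f F : expands f F -> convergent F.
Proof. by move=> [M [t [t0 [Fb _]]]]; exists M, t. Qed.

Lemma hol_expands f : hol f -> exists F, expands f F.
Proof.
move=> [r [M [r0 H]]]; apply: (@expansion_exists _ f M r r0) => x y xr yr;
  by have [] := H x y xr yr.
Qed.

Lemma asym_unique f F G : asym f F -> asym f G -> F = G.
Proof.
move=> fF fG; apply/eqP; rewrite -subr_eq0; apply/eqP.
apply: asym_eq0 (asymB fF fG); exists 1 => // x y _ _; exact: subrr.
Qed.

(** Cauchy's theorem provides some expansion, and uniqueness identifies it with F. Rules for sums
    and products are thus proved for the weak notion and transferred, with no estimate of a Cauchy
    product. *)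
Lemma asym_expands f F : hol f -> asym f F -> expands f F.
Proof.
by move=> /hol_expands[G fG] /(asym_unique (expands_asym fG)) <-.
Qed.

Lemma cdiff_unique (u : C -> C) z A B : cdiff u z A -> cdiff u z B -> A = B.
Proof.
move=> /cdiffP uA /cdiffP uB; apply/eqP; rewrite -subr_eq0; apply/eqP.
apply: nc_eps => e e0; have e20 : 0 < e / 2 by rewrite divr_gt0.
have [d d0 HA] := uA _ e20; have [d' d'0 HB] := uB _ e20.
pose s := Num.min d d' / 2.
have m0 : 0 < Num.min d d' by rewrite lt_min d0.
have s0 : 0 < s by rewrite divr_gt0.
have sm : s < Num.min d d' by rewrite /s; lra.
have zs : z + s%:C%C - z = s%:C%C by rewrite addrC addKr.
have ns : nc (s%:C%C : C) = s by rewrite nc_real gtr0_norm.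
have [sd sd'] : s < d /\ s < d' by apply/andP; rewrite -lt_min.
have := HA (z + s%:C%C); have := HB (z + s%:C%C).
rewrite zs ns => /(_ sd') B1 /(_ sd) A1.
rewrite -(ler_pM2r s0) -{1}ns -ncM.
set D := u _ - u _ in A1 B1.
have -> : (A - B) * s%:C%C = (D - B * s%:C%C) - (D - A * s%:C%C) by ring.
by have := ncB (D - B * s%:C%C) (D - A * s%:C%C); lra.
Qed.

Lemma frechet_cdiff f x y A B : frechet f x y A B ->
  cdiff (fun x' => f x' y) x A /\ cdiff (f x) y B.
Proof.
move=> H; split; apply/cdiffP => e /H[d d0 {}H]; exists d => // w wd.
  have := H (w - x) 0; rewrite nc0 => /(_ wd d0).
  have -> : x + (w - x) = w by ring.
  by rewrite !addr0 mulr0 addr0.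
have := H 0 (w - y); rewrite nc0 => /(_ d0 wd).
have -> : y + (w - y) = w by ring.
by rewrite addr0 mulr0 !add0r.
Qed.

Lemma frechet_near f g (r : R) x y A B : nc x < r -> nc y < r ->
  (forall x y, nc x < r -> nc y < r -> f x y = g x y) ->
  frechet f x y A B -> frechet g x y A B.
Proof.
move=> xr yr fg H e /H[d d0 {}H].
have rx0 : 0 < r - nc x by rewrite subr_gt0.
have ry0 : 0 < r - nc y by rewrite subr_gt0.
exists (Num.min d (Num.min (r - nc x) (r - nc y))).
  by rewrite !lt_min d0 rx0.
move=> h k; rewrite !lt_min => /andP[hd /andP[hx _]] /andP[kd /andP[_ ky]].
have xh : nc (x + h) < r by apply: le_lt_trans (ncD _ _) _; rewrite -ltrBrDl.
have yk : nc (y + k) < r by apply: le_lt_trans (ncD _ _) _; rewrite -ltrBrDl.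
by rewrite -!fg//; exact: H.
Qed.

Lemma expands_near f g F : (exists2 r : R, 0 < r &
  forall x y, nc x < r -> nc y < r -> f x y = g x y) -> expands f F -> expands g F.
Proof.
(* Adding 2 / r to t forces rho < r whenever the new product with rho is at most 1. *)
move=> [r r0 fg] [M [t [t0 [Fb H]]]]; exists M, (t + 2 / r).
have M0 : 0 <= M.
  by have := Fb 0%N 0%N; rewrite expr0 mulr1; apply: le_trans (nc_ge0 _).
have r20 : 0 < 2 / r by rewrite divr_gt0.
split; first by rewrite addr_gt0.
split=> [i j|x y rho N xr yr].
  apply: le_trans (Fb i j) _; rewrite ler_wpM2l// lerXn2r ?nnegrE//; lra.
have rho0 : 0 <= rho by apply: le_trans (nc_ge0 x) xr.
rewrite mulrDl => tr.
have t1 : 0 <= t * rho by rewrite mulr_ge0// ltW.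
have t2 : 0 <= 2 / r * rho by rewrite mulr_ge0// ltW.
have rr : rho < r.
  have : 2 / r * rho <= 1 by lra.
  by rewrite mulrAC ler_pdivrMr// mul1r; lra.
rewrite -fg ?(le_lt_trans xr)// ?(le_lt_trans yr)//.
apply: le_trans (H x y rho N xr yr _) _; first lra.
by rewrite ler_wpM2l// lerXn2r ?nnegrE//; lra.
Qed.

Lemma frechet_hol f (A B : C -> C -> C) (r : R) : 0 < r ->
  (forall x y, nc x < r -> nc y < r -> frechet f x y (A x y) (B x y)) -> hol f.
Proof.
move=> r0 H; have z0 : nc (0 : C) < r by rewrite nc0.
(* Differentiability at the origin alone, with tolerance 1, bounds f near 0. *)
have [d d0 Hd] := H 0 0 z0 z0 1 ltr01.
exists (Num.min r (Num.min d 1)), (nc (f 0 0) + nc (A 0 0) + nc (B 0 0) + 2).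
split; first by rewrite !lt_min r0 d0 ltr01.
move=> x y; rewrite !lt_min => /andP[xr /andP[xd x1]] /andP[yr /andP[yd y1]].
have [dx' dy'] := frechet_cdiff (H x y xr yr).
split; [by exists (A x y)|by exists (B x y)|].
have := Hd x y xd yd; rewrite !add0r mul1r => D.
have E : f x y = (f x y - f 0 0 - (A 0 0 * x + B 0 0 * y)) + f 0 0 +
  (A 0 0 * x + B 0 0 * y) by ring.
have Ax : nc (A 0 0 * x) <= nc (A 0 0).
  by rewrite ncM ler_piMr ?nc_ge0// ltW.
have By : nc (B 0 0 * y) <= nc (B 0 0).
  by rewrite ncM ler_piMr ?nc_ge0// ltW.
have := ncD (A 0 0 * x) (B 0 0 * y).
have := ncD ((f x y - f 0 0 - (A 0 0 * x + B 0 0 * y)) + f 0 0) (A 0 0 * x + B 0 0 * y).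
have := ncD (f x y - f 0 0 - (A 0 0 * x + B 0 0 * y)) (f 0 0).
rewrite -E; lra.
Qed.

Lemma expands_frechet f F : expands f F -> exists g g',
  [/\ expands g (dx F), expands g' (dy F) &
    exists2 r : R, 0 < r & forall x y, nc x < r -> nc y < r ->
      frechet f x y (g x y) (g' x y)].
Proof.
move=> fF; have [f' [g [g' [f'F gF g'F [r r0 H]]]]] :=
  convergent_derivative (expands_convergent fF).
have [r' r'0 E] := expands_eq f'F fF.
exists g, g'; split => //; exists (Num.min r r'); first by rewrite lt_min r0.
move=> x y; rewrite !lt_min => /andP[xr xr'] /andP[yr yr'].
by apply: (frechet_near xr' yr' E); exact: H.
Qed.

Lemma expands_hol f F : expands f F -> hol f.
Proof. by move=> /expands_frechet[g [g' [_ _ [r r0 H]]]]; exact: frechet_hol H. Qed.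

(** The given partial derivatives, so far mere values at points, agree near 0 with the termwise
    derivatives by uniqueness in each variable; so they are analytic too. *)
Lemma expands_derivative f F (A B : C -> C -> C) (r : R) : 0 < r ->
  (forall x y, nc x < r -> nc y < r -> frechet f x y (A x y) (B x y)) ->
  expands f F -> expands A (dx F) /\ expands B (dy F).
Proof.
move=> r0 H /expands_frechet[g [g' [gF g'F [r' r'0 H']]]].
have m0 : 0 < Num.min r r' by rewrite lt_min r0.
split; [apply: expands_near gF|apply: expands_near g'F];
  exists (Num.min r r') => // x y; rewrite !lt_min => /andP[xr xr'] /andP[yr yr'];
  have [c1 c2] := frechet_cdiff (H x y xr yr);
  have [c1' c2'] := frechet_cdiff (H' x y xr' yr').
  exact: cdiff_unique c1' c1.
exact: cdiff_unique c2' c2.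
Qed.

Lemma hol_cst (c : C) : hol (fun _ _ => c).
Proof.
by exists 1, (nc c); split=> // x y _ _; split=> //; exists 0; exact: cdiff_cst.
Qed.

Lemma holD f g : hol f -> hol g -> hol (fun x y => f x y + g x y).
Proof.
move=> [r [M [r0 Hf]]] [r' [M' [r'0 Hg]]]; exists (Num.min r r'), (M + M').
split=> [|x y]; first by rewrite lt_min r0.
rewrite !lt_min => /andP[xr xr'] /andP[yr yr'].
have [[A dA] [B dB] fM] := Hf x y xr yr; have [[A' dA'] [B' dB'] gM] := Hg x y xr' yr'.
split; [by exists (A + A'); exact: cdiffD dA dA'|by exists (B + B'); exact: cdiffD|].
by apply: le_trans (ncD _ _) _; exact: lerD.
Qed.

Lemma holM f g : hol f -> hol g -> hol (fun x y => f x y * g x y).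
Proof.
move=> [r [M [r0 Hf]]] [r' [M' [r'0 Hg]]]; exists (Num.min r r'), (M * M').
split=> [|x y]; first by rewrite lt_min r0.
rewrite !lt_min => /andP[xr xr'] /andP[yr yr'].
have [[A dA] [B dB] fM] := Hf x y xr yr; have [[A' dA'] [B' dB'] gM] := Hg x y xr' yr'.
split; [by eexists; exact: cdiffM dA dA'|by eexists; exact: cdiffM dB dB'|].
by rewrite ncM; apply: ler_pM; rewrite ?nc_ge0.
Qed.

Lemma expandsD f g F G : expands f F -> expands g G ->
  expands (fun x y => f x y + g x y) (F + G).
Proof.
move=> fF gG; apply: asym_expands; first exact: holD (expands_hol fF) (expands_hol gG).
exact: asymD (expands_asym fF) (expands_asym gG).
Qed.

Lemma expandsM f g F G : expands f F -> expands g G ->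
  expands (fun x y => f x y * g x y) (F * G).
Proof.
move=> fF gG; apply: asym_expands; first exact: holM (expands_hol fF) (expands_hol gG).
exact: asymM (expands_asym fF) (expands_asym gG).
Qed.

Lemma expandsZ (c : C) f F : expands f F -> expands (fun x y => c * f x y) (c *: F).
Proof.
move=> fF; apply: asym_expands; first exact: holM (hol_cst c) (expands_hol fF).
exact: asymZ (expands_asym fF).
Qed.

Lemma expands0 : expands (fun _ _ => 0 : C) 0.
Proof. by apply: asym_expands; [exact: hol_cst|exact: asym0]. Qed.

Lemma expandsB f g F G : expands f F -> expands g G ->
  expands (fun x y => f x y - g x y) (F - G).
Proof.
move=> fF /(expandsZ (-1)); rewrite scaleN1r => /(expandsD fF).
by congr expands; apply/funext => x; apply/funext => y; rewrite mulN1r.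
Qed.

Lemma expands_sum n (f : 'I_n -> C -> C -> C) (F : 'I_n -> fps (fps C)) :
  (forall i, expands (f i) (F i)) ->
  expands (fun x y => \sum_i f i x y) (\sum_i F i).
Proof.
elim: n f F => [|n IH] f F fF.
  rewrite big_ord0; have := expands0; congr expands.
  by apply/funext => x; apply/funext => y; rewrite big_ord0.
rewrite big_ord_recl.
have := expandsD (fF ord0) (IH _ _ (fun i => fF (lift ord0 i))); congr expands.
by apply/funext => x; apply/funext => y; rewrite big_ord_recl.
Qed.

Lemma convergentB F G : convergent F -> convergent G -> convergent (F - G).
Proof.
move=> /convergent_expands[f fF] /convergent_expands[g gG].
exact: expands_convergent (expandsB fF gG).
Qed.

Lemma convergentM F G : convergent F -> convergent G -> convergent (F * G).
Proof.
move=> /convergent_expands[f fF] /convergent_expands[g gG].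
exact: expands_convergent (expandsM fF gG).
Qed.

Lemma convergent_comb n (c : 'I_n -> C) (F : 'I_n -> fps (fps C)) :
  (forall i, convergent (F i)) -> convergent (\sum_i c i *: F i).
Proof.
move=> cF; have /choice[f fF] i := convergent_expands (cF i).
exact: expands_convergent (expands_sum (fun i => expandsZ (c i) (fF i))).
Qed.
End HolomorphicGerms.

(** * From commuting fields to the theorem *)

Section CommutingFields.
Context {K : numFieldType}.
Implicit Types (a b z w : fps (fps K)).

Definition commuting a b z1 z2 :=
  vf a b z1 = vf z1 z2 a /\ vf a b z2 = vf z1 z2 b.

Lemma vf_wedge a b z1 z2 w1 w2 : commuting a b z1 z2 -> commuting a b w1 w2 ->
  vf a b (z1 * w2 - z2 * w1) = (dx a + dy b) * (z1 * w2 - z2 * w1).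
Proof.
by move=> [z1E z2E] [w1E w2E]; rewrite vfD vfN !vfM z1E z2E w1E w2E /vf; ring.
Qed.

Lemma quotient_integral_wedge a b z1 z2 w1 w2 y1 y2 u1 u2 :
  commuting a b z1 z2 -> commuting a b w1 w2 ->
  commuting a b y1 y2 -> commuting a b u1 u2 ->
  quotient_integral a b (z1 * w2 - z2 * w1) (y1 * u2 - y2 * u1).
Proof.
by move=> cz cw cy cu; rewrite /quotient_integral !vf_wedge//; ring.
Qed.

End CommutingFields.

Section MainTheorem.
Context {R : realType}.
Local Notation C := R[i].
Implicit Types (X Y Z W : CC2 R -> CC2 R) (a b g u v : fps (fps C)).

Definition vf_expands Z (z1 z2 : fps (fps C)) :=
  expands (fun x y => (Z (x, y)).1) z1 /\ expands (fun x y => (Z (x, y)).2) z2.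

Lemma nc_le_norm (p : CC2 R) (s : R) : `|p| <= s%:C%C -> nc p.1 <= s /\ nc p.2 <= s.
Proof.
rewrite prod_normE /= !norm_nc comparable_ge_max; last first.
  by rewrite /Order.comparable !lecR le_total.
by rewrite !lecR => /andP[].
Qed.

Lemma linear_combinationE n (c : 'I_n -> C) (h : 'I_n -> CC2 R -> CC2 R) p :
  (\sum_i c i *: h i) p =
  (\sum_i c i * (h i p).1, \sum_i c i * (h i p).2) :> CC2 R.
Proof.
rewrite fct_sumE; elim/big_rec3: _ => [|i x y z _ ->]; first by [].
by [].
Qed.

(** Analyticity comes together with the rule for Lie derivatives, because both rest on the same
    partial derivatives of Z, chosen as functions of the point with value 0 away from the domain. *)
Lemma vf_expands_exists Z : vector_field_germ Z ->
  exists z1 z2, vf_expands Z z1 z2 /\ forall W w1 w2, vf_expands W w1 w2 ->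
    vf_expands (lie_derivative W Z) (vf w1 w2 z1) (vf w1 w2 z2).
Proof.
move=> /near0_nc[r r0 dZ].
have /choice[AB HAB] : forall p : CC2 R, exists AB : CC2 R * CC2 R,
    nc p.1 < r -> nc p.2 < r ->
    (forall v : CC2 R, 'D_v Z p = v.1 *: AB.1 + v.2 *: AB.2) /\
    forall e : R, 0 < e -> exists2 d : R, 0 < d & forall h k, nc h < d -> nc k < d ->
    `|Z (p.1 + h, p.2 + k) - Z p - (h *: AB.1 + k *: AB.2)| <=
      (e * (nc h + nc k))%:C%C.
  move=> [x y]; case: (pselect (nc x < r /\ nc y < r)) => [[xr yr]|n].
    by have [A [B H]] := differentiable_expansion (dZ x y xr yr); exists (A, B).
  by exists (0, 0) => xr yr; case: n.
have H1 x y : nc x < r -> nc y < r ->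
    frechet (fun x y => (Z (x, y)).1) x y (AB (x, y)).1.1 (AB (x, y)).2.1.
  move=> xr yr e e0; have [_ /(_ e e0)[d d0 H]] := HAB (x, y) xr yr.
  exists d => // h k hd kd; have [+ _] := nc_le_norm (H h k hd kd).
  by rewrite /= [_ * h]mulrC [_ * k]mulrC.
have H2 x y : nc x < r -> nc y < r ->
    frechet (fun x y => (Z (x, y)).2) x y (AB (x, y)).1.2 (AB (x, y)).2.2.
  move=> xr yr e e0; have [_ /(_ e e0)[d d0 H]] := HAB (x, y) xr yr.
  exists d => // h k hd kd; have [_ +] := nc_le_norm (H h k hd kd).
  by rewrite /= [_ * h]mulrC [_ * k]mulrC.
have [z1 Zz1] := hol_expands (frechet_hol r0 H1).
have [z2 Zz2] := hol_expands (frechet_hol r0 H2).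
exists z1, z2; split=> // W w1 w2 [Ww1 Ww2].
have [A1 B1] := expands_derivative r0 H1 Zz1.
have [A2 B2] := expands_derivative r0 H2 Zz2.
have D x y : nc x < r -> nc y < r -> lie_derivative W Z (x, y) =
    (W (x, y)).1 *: (AB (x, y)).1 + (W (x, y)).2 *: (AB (x, y)).2.
  by move=> xr yr; have [E _] := HAB (x, y) xr yr; exact: E.
split.
  apply: expands_near (expandsD (expandsM Ww1 A1) (expandsM Ww2 B1)).
  by exists r => // x y xr yr; rewrite D.
apply: expands_near (expandsD (expandsM Ww1 A2) (expandsM Ww2 B2)).
by exists r => // x y xr yr; rewrite D.
Qed.

Lemma vf_expands_inj Z W z1 z2 : vf_expands Z z1 z2 -> vf_expands W z1 z2 ->
  eq_germ Z W.
Proof.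
move=> [Z1 Z2] [W1 W2]; apply/near0_nc.
have [r r0 E1] := expands_eq Z1 W1; have [r' r'0 E2] := expands_eq Z2 W2.
exists (Num.min r r'); first by rewrite lt_min r0.
move=> x y; rewrite !lt_min => /andP[xr xr'] /andP[yr yr'].
have /= := E1 x y xr yr; have /= := E2 x y xr' yr'.
by case: (Z (x, y)) (W (x, y)) => [? ?] [? ?] /= -> ->.
Qed.

Lemma vf_expands_uniq Z W z1 z2 w1 w2 : vf_expands Z z1 z2 -> vf_expands W w1 w2 ->
  eq_germ Z W -> z1 = w1 /\ z2 = w2.
Proof.
move=> [Z1 Z2] [W1 W2] /near0_nc[r r0 E]; split.
  apply: asym_unique (expands_asym Z1) _; apply: asym_near (expands_asym W1).
  by exists r => // x y xr yr; rewrite E.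
apply: asym_unique (expands_asym Z2) _; apply: asym_near (expands_asym W2).
by exists r => // x y xr yr; rewrite E.
Qed.

Lemma vf_expands0 : vf_expands (fun=> 0) 0 0.
Proof. by split; exact: expands0. Qed.

Lemma commuting_expands X Z a b : vf_expands X a b -> vector_field_germ X ->
  centralizer X Z -> exists z1 z2, vf_expands Z z1 z2 /\ commuting a b z1 z2.
Proof.
move=> Xab hX [hZ XZ].
have [a' [b' [Xab' DX]]] := vf_expands_exists hX.
have XX : eq_germ X X by apply/near0_nc; exists 1.
have [aE bE] := vf_expands_uniq Xab Xab' XX.
subst a' b'; have [z1 [z2 [Zz DZ]]] := vf_expands_exists hZ.
exists z1, z2; split; first exact: Zz.
have [D1 D2] := DZ _ _ _ Xab; have [D1' D2'] := DX _ _ _ Zz.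
have Br : vf_expands (lie_bracket X Z) (vf a b z1 - vf z1 z2 a)
    (vf a b z2 - vf z1 z2 b).
  by split; [exact: expandsB D1 D1'|exact: expandsB D2 D2'].
have := vf_expands_uniq Br vf_expands0 XZ.
by move=> [/subr0_eq E1 /subr0_eq E2]; split; [exact: E1|exact: E2].
Qed.

(** The sum of u is a holomorphic first integral of X, hence constant near 0, and uniqueness of
    expansions brings this back to the series. *)
Lemma first_integral_cst X a b u : vf_expands X a b ->
  (forall f, first_integrals X f -> constant_germs f) ->
  convergent u -> vf a b u = 0 -> exists c : C, u = fpsC (fpsC c).
Proof.
move=> [Xa Xb] Icst /convergent_derivative[f [A [B [fu Au Bu [r r0 fr]]]]] u0.
pose phi (p : CC2 R) : CC R := f p.1 p.2.
have D (p : CC2 R) : nc p.1 < r -> nc p.2 < r -> differentiable phi p /\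
    forall v : CC2 R, 'D_v phi p = v.1 * A p.1 p.2 + v.2 * B p.1 p.2.
  by move=> xr yr; apply: frechet_differentiable; exact: fr.
have /Icst[c /near0_nc fc] : first_integrals X phi.
  split; apply/near0_nc; first by exists r => // x y xr yr; have [] := D (x, y) xr yr.
  have := expandsD (expandsM Xa Au) (expandsM Xb Bu).
  rewrite -/(vf a b u) u0 => /expands_eq/(_ expands0)[r' r'0 E].
  exists (Num.min r r'); first by rewrite lt_min r0.
  move=> x y; rewrite !lt_min => /andP[xr xr'] /andP[yr yr'].
  have [_ D'] := D (x, y) xr yr; rewrite /lie_derivative D'.
  exact: E.
exists c; apply: asym_unique (expands_asym fu) _.
apply: asym_near (asym_cst c); have [d d0 H] := fc; exists d => // x y xd yd.
symmetry; exact: H x y xd yd.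
Qed.

(** Cramer's rule enters as a hypothesis so that one argument covers both situations: Y independent
    of X, and C(X) collinear with X, where Y is X itself and v = 0. *)
Lemma finite_dim_centralizer X Y a b y1 y2 g : vf_expands X a b ->
  vf_expands Y y1 y2 -> centralizer X X -> centralizer X Y ->
  a != 0 \/ b != 0 -> g != 0 -> convergent g ->
  (forall f, first_integrals X f -> constant_germs f) ->
  (forall Z, centralizer X Z -> exists z1 z2 u v,
    [/\ vf_expands Z z1 z2, convergent u /\ convergent v,
        quotient_integral a b g u /\ quotient_integral a b g v &
        g * z1 = u * a + v * y1 /\ g * z2 = u * b + v * y2]) ->
  finite_dim_germs (centralizer X).
Proof.
move=> [Xa Xb] [Yy1 Yy2] CX CY ab0 g0 cg Icst dec.
have [N dep] := dependent_modulo ab0 g0.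
pose I Z := exists k l : C, eq_germ Z (fun p => k *: X p + l *: Y p).
have ID Z W : I Z -> I W -> I (Z + W).
  move=> [k [l ZE]] [k' [l' WE]]; exists (k + k'), (l + l').
  near=> p; rewrite fctE.
  have -> : Z p = k *: X p + l *: Y p by near: p.
  have -> : W p = k' *: X p + l' *: Y p by near: p.
  by rewrite !scalerDl addrACA.
have IZ c Z : I Z -> I (c *: Z).
  move=> [k [l ZE]]; exists (c * k), (c * l).
  near=> p; rewrite fctE.
  have -> : Z p = k *: X p + l *: Y p by near: p.
  by rewrite scalerDr !scalerA.
have dich (h : 'I_N.+1 -> CC2 R -> CC2 R) : (forall i, centralizer X (h i)) ->
    exists2 c : 'I_N.+1 -> C, exists i, c i != 0 & I (\sum_i c i *: h i).
  move=> Ch; have /choice[z1 /choice[z2 /choice[u /choice[v H]]]] i := dec _ (Ch i).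
  have Vu i : quotient_integral a b g (u i) by have [_ _ []] := H i.
  have Vv i : quotient_integral a b g (v i) by have [_ _ []] := H i.
  have [c [i ci] [[al alE] [be beE]]] := dep u v Vu Vv.
  exists c; first by exists i.
  (* The quotient t is convergent, and the identity for t g over g reduces to g^2 X(t) = 0; the
     absence of non-constant first integrals then makes t constant. *)
  have quo w t : (forall i, convergent (w i)) ->
      (forall i, quotient_integral a b g (w i)) ->
      \sum_i c i *: w i = t * g -> exists k : C, t = fpsC (fpsC k).
    move=> cw Vw E; apply: first_integral_cst (conj Xa Xb) Icst _ _.
      exact: convergent_quotient g0 cg (convergent_comb c cw) E.
    have := quotient_integral_sum c Vw; rewrite E /quotient_integral vfM.
    have -> : g * (vf a b t * g + t * vf a b g) =
      g * g * vf a b t + t * g * vf a b g by ring.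
    move=> /(congr1 (fun s => s - t * g * vf a b g)); rewrite addrK subrr.
    move=> E0; apply: (mulfI_nzd fps2_nzd g0); apply: (mulfI_nzd fps2_nzd g0).
    by rewrite !mulr0 mulrA.
  have [k kE] := quo u al (fun i => (let: And4 _ H2 _ _ := H i in H2).1) Vu alE.
  have [l lE] := quo v be (fun i => (let: And4 _ H2 _ _ := H i in H2).2) Vv beE.
  have sumE (z : 'I_N.+1 -> fps (fps C)) (a' y' : fps (fps C)) :
      (forall i, g * z i = u i * a' + v i * y') ->
      \sum_i c i *: z i = k *: a' + l *: y'.
    move=> zE; apply: (mulfI_nzd fps2_nzd g0).
    have -> : g * (k *: a' + l *: y') = al * g * a' + be * g * y'.
      by rewrite kE lE -[k *: a']/(fpsC (fpsC k) * a') -[l *: y']/(fpsC (fpsC l) * y'); ring.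
    rewrite -alE -beE !mulr_suml mulr_sumr -big_split; apply: eq_bigr => j _ /=.
    have S (t : fps (fps C)) : c j *: t = fpsC (fpsC (c j)) * t by [].
    by rewrite !S mulrCA zE; ring.
  exists k, l; apply: (vf_expands_inj (z1 := \sum_i c i *: z1 i) (z2 := \sum_i c i *: z2 i)).
    have Ez1 i := let: And4 (conj H1 _) _ _ _ := H i in expandsZ (c i) H1.
    have Ez2 i := let: And4 (conj _ H1) _ _ _ := H i in expandsZ (c i) H1.
    split.
      apply: expands_near (expands_sum Ez1); exists 1 => // x y _ _.
      by rewrite linear_combinationE.
    apply: expands_near (expands_sum Ez2); exists 1 => // x y _ _.
    by rewrite linear_combinationE.
  have E1 : forall i, g * z1 i = u i * a + v i * y1 by move=> j; have [_ _ _ []] := H j.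
  have E2 : forall i, g * z2 i = u i * b + v i * y2 by move=> j; have [_ _ _ []] := H j.
  rewrite (sumE _ _ _ E1) (sumE _ _ _ E2); split.
    exact: expandsD (expandsZ k Xa) (expandsZ l Yy1).
  exact: expandsD (expandsZ k Xb) (expandsZ l Yy2).
have [m [e [Ce He]]] := span_modulo ID IZ dich.
pose XY (Z W : CC2 R -> CC2 R) (i : 'I_2) := if i == 0 then Z else W.
exists (2 + m)%N, (fun i => match fintype.split i with inl j => XY X Y j | inr j => e j end).
split=> [i|Z CZ].
  case: fintype.split => j; last exact: Ce.
  by rewrite /XY; case: (j == 0); [exact: CX|exact: CY].
have [c [k [l /near0_nc[r r0 ZE]]]] := He Z CZ.
exists (fun i => match fintype.split i with
  inl j => if j == 0 then k else l | inr j => c j end).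
apply/near0_nc; exists r => // x y xr yr; have := ZE x y xr yr.
set p := (x, y) => E.
have -> : Z p = (Z - \sum_i c i *: e i) p + (\sum_i c i *: e i) p.
  symmetry; exact: (subrK ((\sum_i c i *: e i) p) (Z p)).
rewrite E big_split_ord; congr (_ + _).
  rewrite big_ord_recl big_ord1 -!/(unsplit (inl _)) !unsplitK.
  exact: erefl.
rewrite fct_sumE; apply: eq_bigr => i _; rewrite -/(unsplit (inr i)) unsplitK.
exact: erefl.
Unshelve. all: by end_near.
Qed.
End MainTheorem.

Theorem theorem1 (R : realType) (X : CC2 R -> CC2 R)
    (X_holo : vector_field_germ X)
    (X_neq0 : ~ eq_germ X (fun=> 0))
    (dX_infinite : ~ finite_dim_germs (centralizer X)) :
  exists f : CC2 R -> CC R, first_integrals X f /\ ~ constant_germs f.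
Proof.
apply: contrapT => nf; apply: dX_infinite.
have Icst f : first_integrals X f -> constant_germs f.
  by move=> If; apply: contrapT => cf; apply: nf; exists f.
have CX : centralizer X X.
  split=> //; apply/near0_nc; exists 1 => // x y _ _; exact: subrr.
have [a [b [Xab _]]] := vf_expands_exists X_holo.
have [ca cb] : convergent a /\ convergent b.
  by case: Xab => /expands_convergent ? /expands_convergent ?.
have ab0 : a != 0 \/ b != 0.
  apply: contrapT => /not_orP[/negP/negbNE/eqP a0 /negP/negbNE/eqP b0].
  by apply: X_neq0; apply: vf_expands_inj vf_expands0; rewrite -{1}a0 -b0.
have cab : commuting a b a b by [].
have dec Z : centralizer X Z -> exists z1 z2,
    [/\ vf_expands Z z1 z2, commuting a b z1 z2, convergent z1 & convergent z2].
  move=> CZ; have [z1 [z2 [Zz cz]]] := commuting_expands Xab X_holo CZ.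
  exists z1, z2; split=> //; case: Zz => /expands_convergent ? /expands_convergent ? //.
case: (pselect (exists2 Y, centralizer X Y & exists y1 y2,
    vf_expands Y y1 y2 /\ a * y2 - b * y1 != 0)) => [|collinear].
  move=> [Y CY [y1 [y2 [Yy g0]]]].
  have [y1' [y2' [Yy' cy cy1 cy2]]] := dec Y CY.
  have YY : eq_germ Y Y by apply/near0_nc; exists 1.
  have [E1 E2] := vf_expands_uniq Yy' Yy YY; subst y1' y2'.
  apply: (finite_dim_centralizer Xab Yy CX CY ab0 g0 _ Icst).
    by apply: convergentB; exact: convergentM.
  move=> Z /dec[z1 [z2 [Zz cz cz1 cz2]]].
  (* Cramer's rule: the coefficients are the wedges of Z with Y and of X with Z. *)
  exists z1, z2, (z1 * y2 - z2 * y1), (a * z2 - b * z1); split; first exact: Zz.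
  - by split; apply: convergentB; exact: convergentM.
  - by split; exact: quotient_integral_wedge.
  - by split; ring.
have {}collinear Z z1 z2 : centralizer X Z -> vf_expands Z z1 z2 -> a * z2 = b * z1.
  move=> CZ Zz; apply/eqP; rewrite -subr_eq0; apply/negP => /negP g0.
  by apply: collinear; exists Z => //; exists z1, z2.
(* Every Z in C(X) is a meromorphic multiple of X, with factor z1/a or z2/b. By collinearity, the
   commutation relation for the corresponding component says that this factor is a first
   integral. *)
case: ab0 => [a0|b0].
  apply: (finite_dim_centralizer Xab Xab CX CX (or_introl a0) a0 ca Icst).
  move=> Z CZ; have [z1 [z2 [Zz [cz _] cz1 cz2]]] := dec Z CZ.
  have col := collinear _ _ _ CZ Zz.
  exists z1, z2, z1, 0; split; first exact: Zz.
  - by split; [exact: cz1|rewrite -(subrr a); exact: convergentB].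
  - split; last by rewrite /quotient_integral vf0 mulr0 mul0r.
    rewrite /quotient_integral cz /vf mulrDr mulrA [a * (z2 * _)]mulrA col; ring.
  - by split; [rewrite mul0r addr0 mulrC|rewrite mul0r addr0 col mulrC].
apply: (finite_dim_centralizer Xab Xab CX CX (or_intror b0) b0 cb Icst).
move=> Z CZ; have [z1 [z2 [Zz [_ cz] cz1 cz2]]] := dec Z CZ.
have col := collinear _ _ _ CZ Zz.
exists z1, z2, z2, 0; split; first exact: Zz.
- by split; [exact: cz2|rewrite -(subrr a); exact: convergentB].
- split; last by rewrite /quotient_integral vf0 mulr0 mul0r.
  rewrite /quotient_integral cz /vf mulrDr mulrA -col; ring.
- by split; [rewrite mul0r addr0 -col mulrC|rewrite mul0r addr0 mulrC].
Qed.
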